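(* Let $R,R'$ be two distinct observers on $\mathbb{P}(\mathcal{V})$. Then $$\mathbf{m}_{R'}=\begin{cases}1 & \text{on } [R',\langle R,R',O\rangle],\\ \langle I^R,I^{R'}\rangle & \text{on } (\langle R,R',O\rangle,R],\\ \gamma_R^{R'}\cdot\mathbf{m}_R & \text{on }\mathbb{P}(\mathcal{V})\setminus[R',R],\end{cases}$$ where $\gamma_R^{R'}(P)=\langle\nu^P,I^{R'}\rangle/\langle\nu^P,I^{R}\rangle$.
   Context: **Setting.** $S$ is a germ of smooth complex analytic surface with special point $O$; $\mathcal{O}\simeq\mathbb{C}[[x,y]]$ is its formal local ring, with maximal ideal $\mathcal{M}$. A branch is a germ at $O$ of formal irreducible curve on $S$; $(D_1\cdot D_2)$ is the intersection number at $O$ ($\infty$ if there is a common branch); $Z(f)$ is the divisor of $f$. **Semivaluations.** A semivaluation of $\mathcal{O}$ is a function $\nu:\mathcal{O}\to[0,\infty]$ with $\nu(fg)=\nu(f)+\nu(g)$, $\nu(f+g)\ge\min(\nu(f),\nu(g))$, $\nu(\lambda)=0$ for $\lambda\in\mathbb{C}^*$, $\nu(0)=\infty$. It is centered at $O$ if it is strictly positive on $\mathcal{M}$. For a divisor $D=Z(f)$, $\nu(D):=\nu(f)$; for an ideal $\mathcal{I}$, $\nu(\mathcal{I}):=\min\{\nu(f):f\in\mathcal{I}\}$. $\mathcal{V}$ is the set of semivaluations with the topology of pointwise convergence, on which $(\mathbb{R}_+^*,\cdot)$ acts by multiplication of values. $\mathrm{triv}^S$ takes the value $0$ on $\mathcal{O}\setminus\{0\}$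 and $\mathrm{triv}^O$ takes the value $\infty$ on $\mathcal{M}$ (and $0$ on units). For a branch $A$: $I^A(f)=(A\cdot Z(f))$, and $\mathrm{ord}^A$ is the order of vanishing along $A$; $I^O(f)=\max\{n:f\in\mathcal{M}^n\}$. **The tree $\mathbb{P}(\mathcal{V})$.** It is the biggest Hausdorff quotient of $\mathcal{V}^*=\mathcal{V}\setminus\{\mathrm{triv}^S,\mathrm{triv}^O\}$ under the action of $(\mathbb{R}_+^*,\cdot)$ by multiplication of the values of semivaluations, with quotient map $\pi$; a semivaluation represents $P$ if its image is $P$. One has $\pi(I^A)=\pi(\mathrm{ord}^A)$ for every branch $A$. By Favre-Jonsson, $\mathbb{P}(\mathcal{V})$ is a compact $\mathbb{R}$-tree with its weak topology, and $\pi$ restricts to homeomorphisms from $\mathcal{V}_O=\{\nu:\nu(\mathcal{M})=1\}$ and from $\mathcal{V}_L=\{\nu:\nu(L)=1\}$ ($L$ a smooth branch) onto $\mathbb{P}(\mathcal{V})$; the tree structure (segments $[P,Q]$) is the one induced by the pointwise partial order $\nu_1\preceq\nu_2\Leftrightarrow\nu_1(f)\le\nu_2(f)\ \forall f$ on either of these spaces. For three points, $\langle A,B,C\rangle$ is the center of the tripod they generate, i.e. the unique point common to $[A,B],[B,C],[C,A]$. **Observers.** An observer $R$ is either the point $O$ or a smooth branch $L$; it is identified with the point $\pi(I^R)$. The bracket with $I^R$ is given by $\langle\nu,I^L\rangle=\nu(L)$ and $\langle\nu,I^O\rangle=\nu(\mathcal{M})$. Thus $\langle I^L,I^{L'}\rangle=(L\cdot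 L')$ and $\langle I^O,I^L\rangle=1$. In the definition of $\gamma_R^{R'}(P)$, $\nu^P$ is any semivaluation centered at $O$, different from $\mathrm{triv}^O$, representing $P$. **Relative multiplicity.** For an observer $R$, $P\preceq_R Q$ means $[R,P]\subseteq[R,Q]$ in $\mathbb{P}(\mathcal{V})$. The multiplicity relative to $R$ is $\mathbf{m}_R(P)=\min\{\langle I^R,I^C\rangle : C\text{ a branch on }S,\ P\preceq_R\pi(I^C)\}\in\mathbb{N}^*\cup\{\infty\}$ ($\infty$ if there is no such $C$), where $\langle I^L,I^C\rangle=(L\cdot C)$ and $\langle I^O,I^C\rangle$ is the multiplicity of $C$ at $O$. *)

(* Defs.v *)
From HB Require Import structures.
From mathcomp Require Import all_boot all_order all_algebra.
From mathcomp Require Import generic_quotient complex.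
From mathcomp Require Import all_classical all_reals all_analysis.

Set Implicit Arguments.
Unset Strict Implicit.
Unset Printing Implicit Defensive.
Import Order.TTheory GRing.Theory Num.Theory.

Local Open Scope classical_set_scope.
Local Open Scope quotient_scope.
Local Open Scope ring_scope.

Record fps (K : Type) : Type := Fps { fps_coef :> nat -> K }.

Lemma fpsP (K : Type) (f g : fps K) : (forall n, f n = g n) -> f = g.
Proof. by case: f g => [f] [g] /= fg; congr Fps; apply/funext. Qed.

HB.instance Definition _ (K : Type) := gen_eqMixin (fps K).
HB.instance Definition _ (K : Type) := gen_choiceMixin (fps K).

Section FpsRing.
Variable K : comNzRingType.
Implicit Types f g h : fps K.

Definition fps_const (c : K) : fps K := Fps (fun n => if n == 0%N then c else 0).
Definition fps_opp f : fps K := Fps (fun n => - f n).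
Definition fps_add f g : fps K := Fps (fun n => f n + g n).
Definition fps_mul f g : fps K :=
  Fps (fun n => \sum_(i < n.+1) f i * g (n - i)%N).

Lemma fps_addA : associative fps_add.
Proof. by move=> f g h; apply: fpsP => n /=; rewrite addrA. Qed.
Lemma fps_addC : commutative fps_add.
Proof. by move=> f g; apply: fpsP => n /=; rewrite addrC. Qed.
Lemma fps_add0 : left_id (fps_const 0) fps_add.
Proof. by move=> f; apply: fpsP => n /=; rewrite if_same add0r. Qed.
Lemma fps_addN : left_inverse (fps_const 0) fps_opp fps_add.
Proof. by move=> f; apply: fpsP => n /=; rewrite if_same addNr. Qed.

Let trunc N f : {poly K} := \poly_(i < N) f i.

Let trunc_mul N f g n : (n < N)%N -> fps_mul f g n = (trunc N f * trunc N g)`_n.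
Proof.
move=> nN; rewrite coefM /=; apply: eq_bigr => i _.
by rewrite !coef_poly (leq_trans (ltn_ord i) nN) (leq_ltn_trans (leq_subr i n) nN).
Qed.

Lemma fps_mulA : associative fps_mul.
Proof.
move=> f g h; apply: fpsP => n.
transitivity ((trunc n.+1 f * (trunc n.+1 g * trunc n.+1 h))`_n).
  rewrite coefM /=; apply: eq_bigr => i _.
  rewrite -trunc_mul ?ltnS ?leq_subr //; congr (_ * _).
  by rewrite coef_poly ltn_ord.
rewrite mulrA coefM /=; apply: eq_bigr => i _.
rewrite -(trunc_mul f g (ltn_ord i)); congr (_ * _).
by rewrite coef_poly ltnS leq_subr.
Qed.

Lemma fps_mulC : commutative fps_mul.
Proof.
move=> f g; apply: fpsP => n.
by rewrite !(@trunc_mul n.+1) // mulrC.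
Qed.

Lemma fps_mul1 : left_id (fps_const 1) fps_mul.
Proof.
move=> f; apply: fpsP => n /=; rewrite big_ord_recl /= mul1r subn0.
by rewrite big1 ?addr0 // => i _; rewrite mul0r.
Qed.

Lemma fps_mulDl : left_distributive fps_mul fps_add.
Proof.
move=> f g h; apply: fpsP => n /=; rewrite -big_split /=.
by apply: eq_bigr => i _; rewrite mulrDl.
Qed.

Lemma fps_1neq0 : fps_const 1 != fps_const 0.
Proof.
apply/eqP => /(congr1 (fun f : fps K => f 0%N)) /= /eqP.
by rewrite oner_eq0.
Qed.

HB.instance Definition _ :=
  GRing.isZmodule.Build (fps K) fps_addA fps_addC fps_add0 fps_addN.
HB.instance Definition _ :=
  GRing.Zmodule_isComNzRing.Build (fps K)
    fps_mulA fps_mulC fps_mul1 fps_mulDl fps_1neq0.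

Definition fps_unit : pred (fps K) := fun f => `[< exists g, g * f = 1 >].
Definition fps_inv f : fps K := xget f [set g | g * f = 1].

Lemma fps_mulVr : {in fps_unit, left_inverse 1 fps_inv *%R}.
Proof. by move=> f /asboolP [g gf]; rewrite /fps_inv; case: xgetP => // /(_ g). Qed.

Lemma fps_unitP f g : g * f = 1 -> fps_unit f.
Proof. by move=> gf; apply/asboolP; exists g. Qed.

Lemma fps_inv_out : {in [predC fps_unit], fps_inv =1 id}.
Proof.
move=> f /asboolP nf; rewrite /fps_inv; case: xgetP => // g _ gf.
by case: nf; exists g.
Qed.

HB.instance Definition _ :=
  GRing.ComNzRing_hasMulInverse.Build (fps K) fps_mulVr fps_unitP fps_inv_out.
End FpsRing.

Lemma fps_neq0 (K : comNzRingType) (f : fps K) :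
  f != 0 -> exists n, (f n != 0) && [forall i : 'I_n, f i == 0].
Proof.
move=> f0; have [n fn] : exists n, f n != 0.
  apply/not_existsP => f00; case/eqP: f0; apply: fpsP => n.
  by rewrite /= if_same; apply/eqP; apply: contrapT => /negP /f00.
pose m := ex_minn (ex_intro (fun n => f n != 0) n fn).
exists m; rewrite /m; case: ex_minnP => {}m -> min /=.
apply/forallP => i; apply: contraT => /min.
by rewrite leqNgt ltn_ord.
Qed.

Lemma fps_integral (K : idomainType) : GRing.integral_domain_axiom (fps K).
Proof.
move=> f g fg0; apply/norP => -[] /fps_neq0 [m /andP[fm /forallP fi]].
move=> /fps_neq0 [n /andP[gn /forallP gi]].
have mmn : (m < (m + n).+1)%N by rewrite ltnS leq_addr.
have : (f * g) (m + n)%N = 0 by rewrite fg0 /= if_same.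
rewrite [LHS]/= (bigD1 (Ordinal mmn)) //= big1 => [|i im].
  by rewrite addr0 addKn => /eqP; rewrite mulf_eq0 (negbTE fm) (negbTE gn).
have [lt_im|le_mi] := ltnP i m.
  by rewrite (eqP (fi (Ordinal lt_im))) mul0r.
have lt_mi : (m < i)%N by rewrite ltn_neqAle le_mi andbT eq_sym; apply: im.
have lt_n : (m + n - i < n)%N.
  by rewrite ltn_subLR ?ltn_add2r // -ltnS.
by rewrite (eqP (gi (Ordinal lt_n))) mulr0.
Qed.

HB.instance Definition _ (K : idomainType) :=
  GRing.ComUnitRing_isIntegral.Build (fps K) (@fps_integral K).

(* The formal local ring C[[x, y]] = C[[x]][[y]], with C = R[i]: the coefficient
   of x^i y^j in f is f j i. *)
Notation formalring R := (fps (fps (complex R))).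

Section FormalLocalRing.
Variable R : realType.
Local Notation C := (complex R).
Local Notation O := (formalring R).
Implicit Types (f g h : O) (I J : set O).

Definition scalar (c : C) : O := fps_const (fps_const c).

Definition maxideal : set O := [set f : O | f 0%N 0%N = 0].

Definition ideal_mul I J : set O :=
  [set f | exists n (a b : 'I_n -> O),
     (forall i, I (a i) /\ J (b i)) /\ f = \sum_(i < n) a i * b i].

Definition ideal_exp I n : set O := iter n (ideal_mul I) setT.

Definition ideal1 f : set O := [set h | exists a, h = a * f].
Definition ideal2 f g : set O := [set h | exists a b, h = a * f + b * g].

Definition irreducible_series f : Prop :=
  f \isn't a GRing.unit /\
  forall g h, f = g * h -> g \is a GRing.unit \/ h \is a GRing.unit.

(* dim_C (O / I), possibly infinite *)
Definition colength I : \bar R :=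
  ereal_sup [set (n%:R)%:E | n in [set n : nat |
    exists v : 'I_n -> O, forall c : 'I_n -> C,
      I (\sum_(i < n) scalar (c i) * v i) -> forall i, c i = 0]].

(* (Z(f) . Z(g)) = dim_C O/(f, g) *)
Definition internum f g : \bar R := colength (ideal2 f g).

(* A branch is encoded by its ideal, so that equality of branches is equality
   of formal germs of curves. *)
Definition branch : Type :=
  set_type [set I : set O | exists2 f, irreducible_series f & I = ideal1 f].

Lemma branch_equation (A : branch) : exists f, set_val A = ideal1 f.
Proof. by have [f _ If] := set_mem (valP A); exists f. Qed.

(* A chosen equation of A; equations of A differ by units, so the choice is
   immaterial. *)
Definition equation (A : branch) : O := sval (cid (branch_equation A)).

Definition I_branch (A : branch) : O -> \bar R := fun f => internum (equation A) f.

(* max {n | f in M^n}, and +oo for f = 0 *)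
Definition I_origin : O -> \bar R :=
  fun f => ereal_sup [set (n%:R)%:E | n in [set n : nat | ideal_exp maxideal n f]].

Definition smooth_branch (A : branch) : Prop := I_origin (equation A) = 1%E.

Inductive observer : Type :=
  | ObsOrigin
  | ObsBranch (L : branch) of smooth_branch L.

Definition I_obs (S : observer) : O -> \bar R :=
  match S with ObsOrigin => I_origin | ObsBranch L _ => I_branch L end.

Definition val_branch (nu : O -> \bar R) (A : branch) : \bar R := nu (equation A).

Definition val_ideal (nu : O -> \bar R) I : \bar R := ereal_inf (nu @` I).

Definition bracket (nu : O -> \bar R) (S : observer) : \bar R :=
  match S with
  | ObsOrigin => val_ideal nu maxideal
  | ObsBranch L _ => val_branch nu L
  end.

Definition semivaluation (nu : O -> \bar R) : Prop :=
  [/\ forall f, (0 <= nu f)%E,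
      forall f g, nu (f * g) = (nu f + nu g)%E,
      forall f g, (Order.min (nu f) (nu g) <= nu (f + g)%R)%E,
      forall c : C, c != 0 -> nu (scalar c) = 0%E
    & nu 0 = +oo%E].

Definition centered (nu : O -> \bar R) : Prop :=
  forall f, maxideal f -> (0 < nu f)%E.

Definition trivS : O -> \bar R := fun f => if f == 0 then +oo%E else 0%E.
Definition trivO : O -> \bar R :=
  fun f => if f \in maxideal then +oo%E else 0%E.

Definition Vstar : Type :=
  set_type [set nu : {ptws O -> \bar R} |
    [/\ semivaluation nu, nu <> trivS & nu <> trivO]].

Definition val_of (nu : Vstar) : O -> \bar R := set_val nu.

Definition same_orbit (mu nu : Vstar) : Prop :=
  exists2 c : R, 0 < c & forall f, val_of nu f = (c%:E * val_of mu f)%E.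

(* The biggest Hausdorff quotient identifies two points as soon as every
   action-invariant equivalence relation with Hausdorff quotient does. *)
Definition hausdorff_eq : rel Vstar := fun mu nu =>
  `[< forall E : equiv_rel Vstar,
        (forall mu' nu', same_orbit mu' nu' -> E mu' nu') ->
        hausdorff_space (quotient_topology {eq_quot E}) ->
        E mu nu >].

Lemma hausdorff_eq_refl : reflexive hausdorff_eq.
Proof. by move=> mu; apply/asboolP => E _ _; exact: generic_quotient.equiv_refl. Qed.
Lemma hausdorff_eq_sym : symmetric hausdorff_eq.
Proof.
by move=> mu nu; apply/asboolP/asboolP => + E orbE hE => /(_ E orbE hE);
   rewrite generic_quotient.equiv_sym.
Qed.
Lemma hausdorff_eq_trans : transitive hausdorff_eq.
Proof.
move=> nu mu xi /asboolP mn /asboolP nx; apply/asboolP => E orbE hE.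
exact: generic_quotient.equiv_trans (mn E orbE hE) (nx E orbE hE).
Qed.
Canonical hausdorff_equiv :=
  EquivRel hausdorff_eq hausdorff_eq_refl hausdorff_eq_sym hausdorff_eq_trans.

Definition PV : Type := quotient_topology {eq_quot hausdorff_equiv}.
HB.instance Definition _ := Topological.on PV.

Definition toPV (nu : Vstar) : PV := (\pi_(PV) nu)%qT.

(* \mathbb{P}(V) is nonempty: it contains the class of the semivaluation which
   is +oo on the multiples of y and 0 elsewhere. *)
Definition trivY : O -> \bar R := fun f => if f 0%N == 0 then +oo%E else 0%E.

Lemma trivY_Vstar :
  [/\ semivaluation trivY, trivY <> trivS & trivY <> trivO].
Proof.
have coefM0 f g : (f * g) 0%N = f 0%N * g 0%N by rewrite /= big_ord1.
have y_series : exists2 f : O, f != 0 & f 0%N = 0.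
  exists (Fps (fun n => if n == 1%N then 1 else 0)) => //.
  apply/eqP => /(congr1 (fun f : O => f 1%N)) /= /eqP.
  by rewrite oner_eq0.
have x_series : exists2 f : O, f 0%N != 0 & maxideal f.
  exists (fps_const (Fps (fun n => if n == 1%N then 1 else 0))) => //.
  apply/eqP => /(congr1 (fun f : fps C => f 1%N)) /= /eqP.
  by rewrite oner_eq0.
split.
- split=> [f|f g|f g|c c0|]; rewrite /trivY.
  + by case: ifP.
  + rewrite coefM0 mulf_eq0.
    by case: (f 0%N == 0); case: (g 0%N == 0); rewrite //= add0e.
  + case: ((f + g) 0%N =P 0) => [_|fg]; first exact: leey.
    rewrite ge_min; case: (f 0%N =P 0) => [f0|_]; last by rewrite lexx.
    case: (g 0%N =P 0) => [g0|_]; last by rewrite lexx orbT.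
    by case: fg; rewrite /= f0 g0 addr0.
  + case: ifP => // /eqP /(congr1 (fun f : fps C => f 0%N)) /= /eqP.
    by rewrite (negbTE c0).
  + by rewrite /= eqxx.
- have [f f0 fy] := y_series => /(congr1 (fun nu => nu f)).
  by rewrite /trivY /trivS fy eqxx (negbTE f0).
- have [f f0 fM] := x_series => /(congr1 (fun nu => nu f)).
  by rewrite /trivY /trivO (negbTE f0) mem_set.
Qed.

HB.instance Definition _ :=
  isPointed.Build PV (toPV (SigSub (mem_set trivY_Vstar))).

(* The point pi(nu) for nu in V^* (in particular for I_obs S and I_branch A);
   an irrelevant point otherwise. *)
Definition point_of (nu : O -> \bar R) : PV :=
  get [set P | exists2 mu : Vstar, val_of mu = nu & toPV mu = P].

(* Pointwise order on V_O = {nu | nu(M) = 1}, transported by pi. *)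
Definition PV_le (P Q : PV) : Prop :=
  exists mu nu : Vstar,
    [/\ toPV mu = P, toPV nu = Q,
        val_ideal (val_of mu) maxideal = 1%E,
        val_ideal (val_of nu) maxideal = 1%E
      & forall f, (val_of mu f <= val_of nu f)%E].

Definition is_meet (P Q T : PV) : Prop :=
  [/\ PV_le T P, PV_le T Q
    & forall T', PV_le T' P -> PV_le T' Q -> PV_le T' T].

Definition segment (P Q : PV) : set PV :=
  [set S | exists2 T, is_meet P Q T
                    & PV_le T S /\ (PV_le S P \/ PV_le S Q)].

Definition tripod_center (A B D : PV) : PV :=
  get (segment A B `&` segment B D `&` segment D A).

Definition obs_point (S : observer) : PV := point_of (I_obs S).

Definition obs_le (S : observer) (P Q : PV) : Prop :=
  segment (obs_point S) P `<=` segment (obs_point S) Q.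

(* <I^S, I^A> is I^S(A), i.e. (L . A), resp. the multiplicity of A at O; the
   infimum is +oo when no branch A satisfies the condition. *)
Definition relmult (S : observer) (P : PV) : \bar R :=
  ereal_inf [set val_branch (I_obs S) A |
             A in [set A : branch | obs_le S P (point_of (I_branch A))]].

Definition gamma (S S' : observer) (nu : O -> \bar R) : \bar R :=
  (bracket nu S' / bracket nu S)%E.

End FormalLocalRing.

Arguments ObsOrigin {R}.

(* Main.v *)
From HB Require Import structures.
From mathcomp Require Import all_boot all_order all_algebra.
From mathcomp Require Import generic_quotient complex zify ring lra.
From mathcomp Require Import all_classical all_reals all_analysis.
Require Import Defs.

(** Only finitely many facts about the tree are needed, and all of them concern
    normalized semivaluations, those with value 1 on the maximal ideal.

    Points. Every semivaluation other than the two trivial ones is represented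
    by a unique normalized one: a multiple of it if it is centered, and otherwise
    the valuation of the branch on which it is positive ([represents_exists],
    [represents_unique]). The value at a fixed series of this representative
    is continuous, including at noncentered semivaluations, so it defines a
    Hausdorff quotient; hence two normalized semivaluations with the same image
    in the tree are equal ([toPV_inj]). The continuity rests on [near_branch]: a
    normalized semivaluation with a large value on the equation of a branch
    takes on any other series the value given by a parametrization of the
    branch. This in turn follows from the Newton-Puiseux theorem ([puiseux]):
    the parametrization makes C[[t]] integral over the coordinate ring, and an
    integral equation bounds values ([arc_compare]). The same parametrization
    shows that intersecting with a branch is a semivaluation, proportional to
    the order along the arc ([internum_scale]).

    Segments. For a smooth branch L take coordinates in which L is an axis.
    Monomial valuations are then the least normalized valuations with a given
    value on L ([mono_min]), and a normalized valuation whose value on L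
    increases strictly along some nu above it is monomial ([mono_max]). So the
    points below L are parametrized by their bracket with L, and a point sig
    lies on the segment from the observer S to the point mu exactly when
    <mu, S> <= <sig, S> and sig is below S or below mu ([segmentE]). In
    particular the branches competing in the multiplicity of mu relative to S
    are those C, normalized to c, with <c, S> <= <mu, S> and mu below S or below
    c. The point <R, R', O> is the meet of R and R', and its brackets with R and
    with R' are n = <R, R'> ([tripod_centerE]).

    Multiplicities. Below R' a branch transversal to R' competes, which gives 1.
    Between <R, R', O> and R, a point is not below R', so its competing branches
    lie above it and meet R' with multiplicity at least n, a value reached by R
    itself. Off the segment [R', R] there are two cases. If mu is below R or R',
    then <mu, R> and <mu, R'> are smaller than n, and the ultrametric inequality
    [obs_ultra] shows that mu is below both observers with equal brackets, and
    that the same holds for the brackets of the competing branches. Otherwise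
    the competing branches of both observers are those above mu, and their
    normalized brackets are those of mu. In both cases the same branches
    compete for R and R', with intersection numbers in the ratio
    <mu, R'> / <mu, R> ([off_val_branch]). *)

Set Implicit Arguments.
Unset Strict Implicit.
Unset Printing Implicit Defensive.
Import Order.TTheory GRing.Theory Num.Theory.

Local Open Scope classical_set_scope.
Local Open Scope ring_scope.

(** * Formal power series in one variable *)

Section OneVariable.
Variable A : comNzRingType.
Implicit Types (f g : fps A) (c : A).

Lemma fps0E n : (0 : fps A) n = 0. Proof. by rewrite /= if_same. Qed.
Lemma fpsDE f g n : (f + g) n = f n + g n. Proof. by []. Qed.
Lemma fpsNE f n : (- f) n = - f n. Proof. by []. Qed.
Lemma fpsBE f g n : (f - g) n = f n - g n. Proof. by []. Qed.
Lemma fps1E n : (1 : fps A) n = (n == 0%N)%:R. Proof. by rewrite /=; case: eqP. Qed.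
Lemma fpsME f g n : (f * g) n = \sum_(i < n.+1) f i * g (n - i)%N.
Proof. by []. Qed.
Lemma fps_constE c n : fps_const c n = if n == 0%N then c else 0.
Proof. by []. Qed.
Lemma fps_sumE (I : Type) (r : seq I) (P : pred I) (F : I -> fps A) n :
  (\sum_(i <- r | P i) F i) n = \sum_(i <- r | P i) F i n.
Proof. by elim/big_rec2: _ => [|i x y _ <-]; rewrite ?fps0E. Qed.
Lemma fpsM0 f g : (f * g) 0%N = f 0%N * g 0%N.
Proof. by rewrite fpsME big_ord1 subn0. Qed.

Lemma at0_zmod : zmod_morphism (fun f => f 0%N). Proof. by []. Qed.
Lemma at0_monoid : monoid_morphism (fun f => f 0%N).
Proof. by split=> // f g; rewrite fpsM0. Qed.

Definition at0 f : A := f 0%N.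
HB.instance Definition _ := GRing.isZmodMorphism.Build (fps A) A at0 at0_zmod.
HB.instance Definition _ := GRing.isMonoidMorphism.Build (fps A) A at0 at0_monoid.

Lemma fps_const_zmod : zmod_morphism (@fps_const A).
Proof. by move=> c d; apply: fpsP => n; rewrite fpsBE !fps_constE; case: eqP => // _; rewrite subr0. Qed.
Lemma fps_const_mulE c f n : (fps_const c * f) n = c * f n.
Proof.
rewrite fpsME big_ord_recl subn0 big1 ?addr0 // => i _.
by rewrite fps_constE mul0r.
Qed.
Lemma fps_const_monoid : monoid_morphism (@fps_const A).
Proof.
split=> // c d; apply: fpsP => n.
by rewrite fps_const_mulE !fps_constE; case: eqP => // _; rewrite mulr0.
Qed.
HB.instance Definition _ := GRing.isZmodMorphism.Build A (fps A) (@fps_const A) fps_const_zmod.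
HB.instance Definition _ := GRing.isMonoidMorphism.Build A (fps A) (@fps_const A) fps_const_monoid.

Definition fpsX : fps A := Fps (fun n => (n == 1%N)%:R).

Lemma FpsE (u : nat -> A) n : Fps u n = u n. Proof. by []. Qed.

Lemma fpsXE n : fpsX n = (n == 1%N)%:R. Proof. by []. Qed.

Lemma fpsX_mulE f n : (fpsX * f) n = if n is k.+1 then f k else 0.
Proof.
rewrite fpsME; case: n => [|n]; first by rewrite big_ord1 fpsXE mul0r.
rewrite 2!big_ord_recl !fpsXE mul0r add0r mul1r big1 ?addr0 => [|i _].
  by rewrite /bump /= subn1.
by rewrite fpsXE mul0r.
Qed.

Lemma fpsXn_mulE m f n : (fpsX ^+ m * f) n = if (n < m)%N then 0 else f (n - m)%N.
Proof.
elim: m n => [|m IH] n; first by rewrite mul1r subn0.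
by rewrite exprS -mulrA fpsX_mulE; case: n => [|n] //; rewrite IH ltnS.
Qed.

Lemma fpsXnE m n : (fpsX ^+ m) n = (n == m)%:R.
Proof.
rewrite -[fpsX ^+ m]mulr1 fpsXn_mulE fps1E; case: ltngtP => //= [lt|->].
  by rewrite subn_eq0 leqNgt lt.
by rewrite subnn.
Qed.

Definition fps_shift f : fps A := Fps (fun n => f n.+1).
Lemma fps_shift_coef f n : fps_shift f n = f n.+1. Proof. by []. Qed.
Lemma fps_shiftE f : f = fps_const (f 0%N) + fpsX * fps_shift f.
Proof. by apply: fpsP => -[|n]; rewrite fpsDE fps_constE fpsX_mulE ?addr0 ?add0r. Qed.

Lemma fps_shift0 f : f 0%N = 0 -> f = fpsX * fps_shift f.
Proof. by move=> f0; rewrite {1}[f]fps_shiftE f0 rmorph0 add0r. Qed.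

(** Orders of vanishing are first handled as a filtration, which makes sense
    over any coefficient ring. *)
Definition vge n f := forall i, (i < n)%N -> f i = 0.

Lemma vgeW m n f : (m <= n)%N -> vge n f -> vge m f.
Proof. by move=> mn fn i im; apply: fn; apply: leq_trans mn. Qed.
Lemma vgeD n f g : vge n f -> vge n g -> vge n (f + g).
Proof. by move=> fn gn i lt; rewrite fpsDE fn ?gn ?addr0. Qed.
Lemma vgeM m n f g : vge m f -> vge n g -> vge (m + n) (f * g).
Proof.
move=> fm gn i lt; rewrite fpsME big1 // => j _.
have [/fm->|le] := ltnP j m; first by rewrite mul0r.
by rewrite [X in _ * X]gn ?mulr0 //; have := ltn_ord j; lia.
Qed.
Lemma vgeX n f k : vge n f -> vge (n * k)%N (f ^+ k).
Proof.
move=> fn; elim: k => [|k IH]; first by rewrite muln0.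
by rewrite exprS mulnS; apply: vgeM.
Qed.
Lemma vge_all f : (forall n, vge n f) -> f = 0.
Proof. by move=> H; apply: fpsP => n; rewrite fps0E (H n.+1). Qed.
Lemma vgeP n f : vge n f <-> exists g, f = fpsX ^+ n * g.
Proof.
split=> [fn|[g ->]]; last by move=> i lt; rewrite fpsXn_mulE lt.
exists (Fps (fun i => f (i + n)%N)); apply: fpsP => i; rewrite fpsXn_mulE.
by case: ltnP => [/fn //|le]; rewrite /= subnK.
Qed.

(** The inverse is the geometric series: its coefficients are finite sums because
    the k-th power of f has order at least k. *)
Lemma fps_unit1B f : f 0%N = 0 -> exists g, g * (1 - f) = 1.
Proof.
move=> f0; exists (Fps (fun n => (\sum_(k < n.+1) f ^+ k) n)).
have fk k : vge k (f ^+ k).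
  by rewrite -[X in vge X](mul1n k); apply: vgeX => -[].
have tr n N : (n <= N)%N -> (\sum_(k < n.+1) f ^+ k) n = (\sum_(k < N.+1) f ^+ k) n.
  move=> nN; rewrite !fps_sumE (big_ord_widen N.+1 (fun k => (f ^+ k) n)) // big_mkcond.
  apply: eq_bigr => k _; case: ifP => // /negbT; rewrite -leqNgt => lt.
  by rewrite (fk k).
apply: fpsP => n; transitivity (((\sum_(k < n.+1) f ^+ k) * (1 - f)) n).
  rewrite !fpsME; apply: eq_bigr => i _; rewrite [X in X * _](tr i n) //.
  by rewrite -ltnS.
rewrite mulrC -opprB mulNr -subrX1 opprB fpsBE [X in _ - X](fk n.+1) //.
by rewrite subr0.
Qed.

End OneVariable.

Arguments fpsX {A}.
Arguments at0 {A}.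

Section OneVariableUnit.
Variable A : comUnitRingType.
Lemma fps_unitE (f : fps A) : (f \is a GRing.unit) = (f 0%N \is a GRing.unit).
Proof.
apply/idP/idP => [|uf0]; first exact: (rmorph_unit at0).
apply/unitrPr; have [|g gK] := @fps_unit1B A (1 - fps_const (f 0%N)^-1 * f).
  by rewrite fpsBE fps_const_mulE fps1E mulVr // subrr.
exists (g * fps_const (f 0%N)^-1); rewrite -{}gK subKr; ring.
Qed.
End OneVariableUnit.

Section FieldSeries.
Variable F : fieldType.
Local Notation D := (fps F).
Implicit Types f g : D.

(** The zero series gets order 0, so that orders only make sense for nonzero
    series. *)
Definition ordn f : nat :=
  if pselect (exists n, f n != 0) is left e then ex_minn e else 0%N.

Lemma ordnP f : f != 0 -> f (ordn f) != 0 /\ vge (ordn f) f.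
Proof.
move=> f0; rewrite /ordn; case: pselect => [e|ne].
  case: ex_minnP => n fn min; split=> // i lt; apply/eqP; apply: contraT => /min.
  by rewrite leqNgt lt.
case/eqP: f0; apply: fpsP => n; rewrite fps0E; apply/eqP; apply: contraT => fn.
by case: ne; exists n.
Qed.

Lemma ordn_eq f n : f n != 0 -> vge n f -> f != 0 /\ ordn f = n.
Proof.
move=> fn vn; have f0 : f != 0.
  by apply: contraNneq fn => ->; rewrite fps0E.
split=> //; have [fo vo] := ordnP f0.
case: (ltngtP (ordn f) n) => // [/vn fo0|/vo fn0].
  by rewrite fo0 eqxx in fo.
by rewrite fn0 eqxx in fn.
Qed.

Lemma ordn_vge f n : f != 0 -> vge n f <-> (n <= ordn f)%N.
Proof.
move=> f0; have [fo vo] := ordnP f0; split=> [vn|le]; last exact: vgeW vo.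
by rewrite leqNgt; apply: contra fo => /vn ->.
Qed.

Lemma ordn_unit f : f != 0 -> exists2 u, u \is a GRing.unit & f = fpsX ^+ ordn f * u.
Proof.
move=> f0; have [fo vo] := ordnP f0; have [u uE] := (vgeP _ _).1 vo.
exists u => //; rewrite fps_unitE unitfE; move: fo.
by rewrite {1}uE fpsXn_mulE ltnn subnn.
Qed.

Lemma ordnXn_unit n u : u \is a GRing.unit ->
  fpsX ^+ n * u != 0 /\ ordn (fpsX ^+ n * u) = n.
Proof.
rewrite fps_unitE unitfE => u0; apply: ordn_eq; first by rewrite fpsXn_mulE ltnn subnn.
by apply/vgeP; exists u.
Qed.

Lemma ordnM f g : f != 0 -> g != 0 -> ordn (f * g) = (ordn f + ordn g)%N.
Proof.
move=> /ordn_unit[u uu ->] /ordn_unit[v vv ->].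
rewrite mulrACA -exprD !(proj2 (ordnXn_unit _ _)) //.
by rewrite unitrM uu.
Qed.

Lemma ordn1 : ordn 1 = 0%N.
Proof. by apply: (proj2 (@ordn_eq 1 0 _ _)); rewrite ?fps1E ?oner_eq0. Qed.

Lemma ordnX f k : f != 0 -> ordn (f ^+ k) = (k * ordn f)%N.
Proof.
move=> f0; elim: k => [|k IH]; first by rewrite expr0 ordn1.
by rewrite exprS ordnM ?expf_neq0 // IH mulSn.
Qed.

Lemma ordn_gt0 f : f != 0 -> (0 < ordn f)%N = (f 0%N == 0).
Proof.
move=> f0; have [fo vo] := ordnP f0; apply/idP/eqP => [/vo //|f00].
by rewrite lt0n; apply: contra_neqN fo => /eqP ->; rewrite f00.
Qed.

End FieldSeries.

(** * Formal power series in two variables *)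

Lemma mulr_11 (A : nzRingType) (a b c : A) : c * (a ^+ 0 * b ^+ 0) = c.
Proof. by rewrite !expr0 !mulr1. Qed.

Section TwoVariables.
Variable K : realType.
Local Notation C := (complex K).
Local Notation O := (formalring K).
Implicit Types (f g h : O) (c : C).

Lemma scalar_zmod : zmod_morphism (@scalar K).
Proof. by move=> c d; rewrite /scalar !rmorphB. Qed.
Lemma scalar_monoid : monoid_morphism (@scalar K).
Proof. by split=> [|c d]; rewrite /scalar ?rmorph1 ?rmorphM. Qed.
HB.instance Definition _ := GRing.isZmodMorphism.Build C O (@scalar K) scalar_zmod.
HB.instance Definition _ := GRing.isMonoidMorphism.Build C O (@scalar K) scalar_monoid.

Definition varX : O := fps_const fpsX.
Definition varY : O := fpsX.

Lemma scalarE c j i : scalar c j i = if (i == 0%N) && (j == 0%N) then c else 0.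
Proof.
rewrite /scalar fps_constE; case: (j =P 0%N) => _; last by rewrite andbF fps0E.
by rewrite andbT fps_constE.
Qed.

Lemma fps2ME f g j i :
  (f * g) j i = \sum_(a < j.+1) \sum_(b < i.+1) f a b * g (j - a)%N (i - b)%N.
Proof. by rewrite fpsME fps_sumE. Qed.

Lemma scalarME c f j i : (scalar c * f) j i = c * f j i.
Proof. by rewrite /scalar !fps_const_mulE. Qed.

Lemma varXnME m f j i :
  (varX ^+ m * f) j i = if (i < m)%N then 0 else f j (i - m)%N.
Proof. by rewrite /varX -rmorphXn fps_const_mulE fpsXn_mulE. Qed.

Lemma varYnME n f j i :
  (varY ^+ n * f) j i = if (j < n)%N then 0 else f (j - n)%N i.
Proof. by rewrite fpsXn_mulE; case: ifP; rewrite ?fps0E. Qed.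

Lemma monomialE c m n j i :
  (scalar c * (varX ^+ m * varY ^+ n)) j i = if (i == m) && (j == n) then c else 0.
Proof.
rewrite scalarME mulrC [varX ^+ m * _]mulrC varYnME /varX -rmorphXn fps_constE.
have [lt|le] := ltnP j n; first by rewrite (ltn_eqF lt) andbF mul0r.
rewrite -[j in RHS](subnK le) -[n in RHS]add0n eqn_add2r andbC.
case: (j - n =P 0)%N => [_|_]; last by rewrite fps0E mul0r.
by rewrite fpsXnE; case: (i == m); rewrite ?mul1r ?mul0r.
Qed.

Lemma fps2_eq0 f : (forall j i, f j i = 0) -> f = 0.
Proof. by move=> H; apply: fpsP => j; apply: fpsP => i; rewrite !fps0E H. Qed.

(** Membership in the n-th power of the maximal ideal, read on coefficients;
    see [Mge_ideal_exp]. *)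
Definition Mge n f := forall j i, (i + j < n)%N -> f j i = 0.

Lemma MgeW m n f : (m <= n)%N -> Mge n f -> Mge m f.
Proof. by move=> mn fn j i lt; apply: fn; apply: leq_trans mn. Qed.
Lemma Mge_0 f : Mge 0 f. Proof. by []. Qed.
Lemma Mge0 n : Mge n 0. Proof. by move=> j i _; rewrite !fps0E. Qed.
Lemma MgeD n f g : Mge n f -> Mge n g -> Mge n (f + g).
Proof. by move=> fn gn j i lt; rewrite !fpsDE fn ?gn ?addr0. Qed.
Lemma MgeN n f : Mge n f -> Mge n (- f).
Proof. by move=> fn j i lt; rewrite !fpsNE fn ?oppr0. Qed.
Lemma MgeB n f g : Mge n f -> Mge n g -> Mge n (f - g).
Proof. by move=> fn gn; apply: MgeD => //; apply: MgeN. Qed.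
Lemma Mge_sum n (I : Type) (r : seq I) (P : pred I) (F : I -> O) :
  (forall i, P i -> Mge n (F i)) -> Mge n (\sum_(i <- r | P i) F i).
Proof. by move=> H; elim/big_rec: _ => [|i f /H]; [apply: Mge0|apply: MgeD]. Qed.
Lemma MgeM m n f g : Mge m f -> Mge n g -> Mge (m + n) (f * g).
Proof.
move=> fm gn j i lt; rewrite fps2ME big1 // => a _; rewrite big1 // => b _.
have [/fm->|le] := ltnP (b + a) m; first by rewrite mul0r.
rewrite [X in _ * X]gn ?mulr0 //.
by have := ltn_ord a; have := ltn_ord b; lia.
Qed.
Lemma MgeMl n f g : Mge n f -> Mge n (g * f).
Proof. by move=> fn; apply: (@MgeM 0 n) fn. Qed.
Lemma MgeMr n f g : Mge n f -> Mge n (f * g).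
Proof. by rewrite mulrC; apply: MgeMl. Qed.
Lemma MgeX n f k : Mge n f -> Mge (n * k)%N (f ^+ k).
Proof.
move=> fn; elim: k => [|k IH]; first by rewrite muln0.
by rewrite exprS mulnS; apply: MgeM.
Qed.
Lemma MgeX1 f k : Mge 1 f -> Mge k (f ^+ k).
Proof. by move=> /MgeX -/(_ k); rewrite mul1n. Qed.
Lemma Mge_all f : (forall n, Mge n f) -> f = 0.
Proof. by move=> H; apply: fps2_eq0 => j i; apply: (H (i + j).+1). Qed.
Lemma MgeX_var : Mge 1 varX.
Proof. by move=> j i; rewrite ltnS leqn0 addn_eq0 => /andP[/eqP-> /eqP->]. Qed.
Lemma MgeY_var : Mge 1 varY.
Proof. by move=> j i; rewrite ltnS leqn0 addn_eq0 => /andP[/eqP-> /eqP->]; rewrite fpsXE fps0E. Qed.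
Lemma Mge1P f : Mge 1 f <-> maxideal f.
Proof.
split=> [f1|f0]; first exact: f1.
by move=> j i; rewrite ltnS leqn0 addn_eq0 => /andP[/eqP-> /eqP->].
Qed.

Lemma split_xy f :
  f = scalar (f 0%N 0%N) + varX * fps_const (fps_shift (f 0%N)) + varY * fps_shift f.
Proof. by rewrite {1}[f]fps_shiftE {1}[f 0%N]fps_shiftE rmorphD rmorphM. Qed.

Lemma Mge_split n f : Mge n.+1 f ->
  exists g h, [/\ Mge n g, Mge n h & f = varX * g + varY * h].
Proof.
move=> fn; exists (fps_const (fps_shift (f 0%N))), (fps_shift f); split.
- move=> j i lt; rewrite fps_constE; case: eqP => [j0|]; rewrite ?fps0E // fps_shift_coef.
  by apply: fn; lia.
- by move=> j i lt; rewrite fps_shift_coef; apply: fn; lia.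
by rewrite {1}[f]split_xy fn // rmorph0 add0r.
Qed.

Lemma Mge_ideal_exp n f : Mge n f <-> ideal_exp (@maxideal K) n f.
Proof.
elim: n f => [|n IH] f; first by split=> // _; apply: Mge_0.
split=> [/Mge_split[g [h [gn hn ->]]]|[m [a [b [ab ->]]]]].
  exists 2%N, (fun i : 'I_2 => if val i == 0%N then varX else varY),
    (fun i : 'I_2 => if val i == 0%N then g else h); split.
    move=> i; case: ifP => _; split.
    - exact: (Mge1P _).1 MgeX_var.
    - exact: (IH _).1 gn.
    - exact: (Mge1P _).1 MgeY_var.
    - exact: (IH _).1 hn.
  by rewrite !big_ord_recl big_ord0 addr0.
apply: Mge_sum => i _; rewrite -add1n; have [ai bi] := ab i; apply: MgeM.
  exact: (Mge1P _).2 ai.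
exact: (IH _).2 bi.
Qed.

(** The sum of a series whose k-th term lies in the k-th power of the maximal
    ideal: only finitely many terms contribute to a given coefficient. *)
Definition fsum (q : nat -> O) : O :=
  Fps (fun j => Fps (fun i => \sum_(k < (i + j).+1) q k j i)).

Lemma fsumP (q : nat -> O) : (forall k, Mge k (q k)) ->
  forall n, Mge n (fsum q - \sum_(k < n) q k).
Proof.
move=> qk n j i lt; rewrite !fpsBE !FpsE !fps_sumE (big_ord_widen n (fun k => q k j i)) //.
rewrite big_mkcond -sumrB big1 // => k _; case: ifP; first by rewrite subrr.
by rewrite ltnS => /negbT; rewrite -ltnNge => /qk->; rewrite subrr.
Qed.

(** Values of semivaluations and images by substitutions are read off this
    finite sum of monomials. *)
Lemma truncP n f :
  Mge n (f - \sum_(j < n) \sum_(i < n) scalar (f j i) * (varX ^+ i * varY ^+ j)).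
Proof.
move=> j i lt; have [jn im] : (j < n)%N /\ (i < n)%N by lia.
have row k : (\sum_(l < n) scalar (f k l) * (varX ^+ l * varY ^+ k)) j i
             = if j == k then f k i else 0.
  rewrite !fps_sumE (bigD1 (Ordinal im)) //= monomialE eqxx /= big1 ?addr0 //.
  by move=> l; rewrite -val_eqE monomialE eq_sym => /negbTE->.
rewrite !fpsBE !fps_sumE (bigD1 (Ordinal jn)) //= row eqxx big1 ?addr0 ?subrr //.
by move=> k; rewrite -val_eqE row eq_sym => /negbTE->.
Qed.

Lemma unitO f : (f \is a GRing.unit) = (f 0%N 0%N != 0).
Proof. by rewrite !fps_unitE unitfE. Qed.

Lemma nunitO f : f \isn't a GRing.unit <-> Mge 1 f.
Proof. by rewrite unitO negbK Mge1P; split=> /eqP. Qed.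

Section Substitution.
Variables a b : O.
Hypotheses (Ma : Mge 1 a) (Mb : Mge 1 b).

Let cfa : commr_rmorph (@scalar K) a. Proof. by move=> c; apply: mulrC. Qed.
Let evx : {rmorphism {poly C} -> O} := horner_morph cfa.
Let cfb : commr_rmorph evx b. Proof. by move=> c; apply: mulrC. Qed.
Let ev : {rmorphism {poly {poly C}} -> O} := horner_morph cfb.

Let evxC c : evx c%:P = scalar c. Proof. exact: horner_morphC. Qed.
Let evxX : evx 'X = a. Proof. exact: horner_morphX. Qed.
Let evC q : ev q%:P = evx q. Proof. exact: horner_morphC. Qed.
Let evX : ev 'X = b. Proof. exact: horner_morphX. Qed.
Let ev_poly n (E : nat -> {poly C}) :
  ev (\poly_(j < n) E j) = \sum_(j < n) evx (E j) * b ^+ j.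
Proof.
rewrite poly_def rmorph_sum; apply: eq_bigr => j _.
by rewrite -mul_polyC rmorphM rmorphXn evC evX.
Qed.
Let evx_poly n (E : nat -> C) :
  evx (\poly_(i < n) E i) = \sum_(i < n) scalar (E i) * a ^+ i.
Proof.
rewrite poly_def rmorph_sum; apply: eq_bigr => j _.
by rewrite -mul_polyC rmorphM rmorphXn evxC evxX.
Qed.

Let ev_Mge n (P : {poly {poly C}}) : (forall j i, (j < n)%N -> (i < n)%N -> P`_j`_i = 0) -> Mge n (ev P).
Proof.
move=> H; rewrite -[P]coefK ev_poly; apply: Mge_sum => j _.
rewrite -[P`_j]coefK evx_poly mulr_suml.
apply: Mge_sum => i _.
have [le|gt] := leqP n (i + j).
  apply: MgeW le _; rewrite -mulrA; apply: MgeMl.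
  by apply: MgeM; apply: MgeX1.
by rewrite H ?rmorph0 ?mul0r; [apply: Mge0|lia|lia].
Qed.

Let tr n f : {poly {poly C}} := \poly_(j < n) \poly_(i < n) f j i.

Let trE n f j i : (j < n)%N -> (i < n)%N -> (tr n f)`_j`_i = f j i.
Proof. by move=> jn im; rewrite coef_poly jn coef_poly im. Qed.

(** A coefficient of the substituted series only depends on the terms of f of
    at most the same degree, so that a polynomial truncation computes it. *)
Definition subst_def f : O :=
  Fps (fun j => Fps (fun i => ev (tr (i + j).+1 f) j i)).

Let substP n f : Mge n (subst_def f - ev (tr n f)).
Proof.
move=> j i lt; rewrite !fpsBE !FpsE -!fpsBE -rmorphB.
apply: (@ev_Mge (i + j).+1) => // l k ll kk.
by rewrite !coefB !trE ?subrr //; lia.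
Qed.

Let subst_zmod : zmod_morphism subst_def.
Proof.
move=> f g; apply: fpsP => j; apply: fpsP => i; rewrite !fpsBE !FpsE -!fpsBE -rmorphB.
congr ((ev _) j i); apply/polyP => l; apply/polyP => k.
rewrite !coefB !coef_poly; case: ifP => _; last by rewrite coef0 subrr.
by rewrite !coef_poly; case: ifP => _; rewrite ?subrr.
Qed.

Let subst_monoid : monoid_morphism subst_def.
Proof.
split=> [|f g]; apply/eqP; rewrite -subr_eq0; apply/eqP/Mge_all => n.
  case: n => [|n]; first exact: Mge_0.
  rewrite -[X in _ - X](rmorph1 ev) (_ : 1 = tr n.+1 1) //.
  apply/polyP => l; apply/polyP => k; rewrite coef1 coef_poly.
  case: l => [|l]; last by rewrite coef0 fps1E; case: ifP; rewrite ?coef0 // coef_poly fps0E if_same.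
  rewrite coef1 coef_poly; case: k => [|k]; first by rewrite !fps1E.
  by rewrite fps1E if_same.
rewrite [X in Mge _ X](_ : _ = (subst_def (f * g) - ev (tr n (f * g)))
   - ev (tr n f * tr n g - tr n (f * g))
   - (subst_def f - ev (tr n f)) * subst_def g
   - ev (tr n f) * (subst_def g - ev (tr n g))); last by rewrite rmorphB rmorphM; ring.
apply: MgeB; last by apply: MgeMl; apply: substP.
apply: MgeB; last by apply: MgeMr; apply: substP.
apply: MgeB; first exact: substP.
apply: ev_Mge => j i jn im; rewrite !coefB trE //; apply/eqP; rewrite subr_eq0.
rewrite coefM fps2ME coef_sum; apply/eqP/eq_bigr => u _; rewrite coefM.
by apply: eq_bigr => w _; rewrite !trE //; have := ltn_ord u; have := ltn_ord w; lia.
Qed.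

HB.instance Definition _ := GRing.isZmodMorphism.Build O O subst_def subst_zmod.
HB.instance Definition _ := GRing.isMonoidMorphism.Build O O subst_def subst_monoid.

Let ev_tr_lin n f : ev (tr n f) =
  \sum_(j < n) \sum_(i < n) scalar (f j i) * (a ^+ i * b ^+ j).
Proof.
rewrite ev_poly; apply: eq_bigr => j _; rewrite evx_poly mulr_suml.
by apply: eq_bigr => i _; rewrite mulrA.
Qed.

Lemma subst_approx n f :
  Mge n (subst_def f - \sum_(j < n) \sum_(i < n) scalar (f j i) * (a ^+ i * b ^+ j)).
Proof. by rewrite -ev_tr_lin; apply: substP. Qed.

End Substitution.

(** Preserving the maximal ideal makes these endomorphisms continuous for its
    powers. *)
Definition local_endo (h : O -> O) :=
  (forall c, h (scalar c) = scalar c) /\ (forall f, Mge 1 f -> Mge 1 (h f)).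

Lemma local_endo_Mge (h : {rmorphism O -> O}) : local_endo h ->
  forall n f, Mge n f -> Mge n (h f).
Proof.
move=> [_ h1]; elim=> [|n IH] f; first by move=> _; apply: Mge_0.
move=> /Mge_split[g [k [gn kn ->]]]; rewrite rmorphD !rmorphM -(add1n n).
by apply: MgeD; apply: MgeM; [exact: h1 _ MgeX_var|exact: IH|exact: h1 _ MgeY_var|exact: IH].
Qed.

Lemma local_endo_trunc (h : {rmorphism O -> O}) n f : local_endo h ->
  Mge n (h f - \sum_(j < n) \sum_(i < n) scalar (f j i) * (h varX ^+ i * h varY ^+ j)).
Proof.
move=> hl; have := local_endo_Mge hl (@truncP n f); rewrite rmorphB rmorph_sum.
congr (Mge _ (_ - _)); apply: eq_bigr => j _; rewrite rmorph_sum; apply: eq_bigr => i _.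
by rewrite !rmorphM !rmorphXn hl.1.
Qed.

(** By continuity: modulo any power of the maximal ideal, the image of a series
    is a polynomial in the images of the variables. *)
Lemma local_endo_eq (h1 h2 : {rmorphism O -> O}) : local_endo h1 -> local_endo h2 ->
  h1 varX = h2 varX -> h1 varY = h2 varY -> h1 =1 h2.
Proof.
move=> l1 l2 eX eY f; apply/eqP; rewrite -subr_eq0; apply/eqP/Mge_all => n.
have := MgeB (@local_endo_trunc h1 n f l1) (@local_endo_trunc h2 n f l2).
by rewrite eX eY; congr (Mge _ _); ring.
Qed.

(** The approximation by truncations is exact on a series with a single monomial,
    which gives the values on the scalars and on the variables. *)
Lemma subst_exists a b : Mge 1 a -> Mge 1 b ->
  exists h : {rmorphism O -> O}, [/\ local_endo h, h varX = a & h varY = b].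
Proof.
move=> Ma Mb; unshelve (eexists (subst_def a b : {rmorphism O -> O})); [exact: Ma|exact: Mb|].
have ap n f := @subst_approx a b Ma Mb n f.
have only n (c : C) (j0 i0 : nat) f : (j0 < n)%N -> (i0 < n)%N ->
    (forall j i, f j i = if (i == i0) && (j == j0) then c else 0) ->
  \sum_(j < n) \sum_(i < n) scalar (f j i) * (a ^+ i * b ^+ j) = scalar c * (a ^+ i0 * b ^+ j0).
  move=> jn im fE; rewrite (bigD1 (Ordinal jn)) //= (bigD1 (Ordinal im)) //=.
  rewrite fE !eqxx /= big1 => [|k]; last first.
    by rewrite -val_eqE /= => /negbTE kj; rewrite fE kj rmorph0 mul0r.
  rewrite big1 ?addr0 // => k; rewrite -val_eqE /= => /negbTE kj.
  by rewrite big1 // => l _; rewrite fE kj andbF rmorph0 mul0r.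
have val (c : C) (j0 i0 : nat) f :
    (forall j i, f j i = if (i == i0) && (j == j0) then c else 0) ->
    subst_def a b f = scalar c * (a ^+ i0 * b ^+ j0).
  move=> fE; apply/eqP; rewrite -subr_eq0; apply/eqP/Mge_all => n.
  apply: (@MgeW _ (n + i0 + j0).+1); first by lia.
  by rewrite -(only (n + i0 + j0).+1 c j0 i0 f) //; lia.
split; first split.
- move=> c; etransitivity; first by apply: (val c 0%N 0%N) => j i; apply: scalarE.
  exact: mulr_11.
- move=> f f1; rewrite -[X in Mge _ X]subr0; have := ap 1%N f.
  by rewrite !big_ord1 f1 // rmorph0 mul0r.
- etransitivity; first by apply: (val 1 0%N 1%N) => j i; rewrite -(monomialE 1) rmorph1 mul1r mulr1.
  by rewrite rmorph1 mul1r; apply: mulr1.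
etransitivity; first by apply: (val 1 1%N 0%N) => j i; rewrite -(monomialE 1) rmorph1 mul1r mul1r.
by rewrite rmorph1 mul1r; apply: mul1r.
Qed.

Lemma local_endo_comp (h1 h2 : {rmorphism O -> O}) :
  local_endo h1 -> local_endo h2 -> local_endo (h1 \o h2).
Proof. by move=> [s1 m1] [s2 m2]; split=> [c|f f1]; [exact: etrans (congr1 h1 (s2 c)) (s1 c)|exact/m1/m2]. Qed.

Lemma local_endo_id : local_endo idfun. Proof. by []. Qed.

End TwoVariables.
Arguments varX {K}.
Arguments varY {K}.

Arguments fps_coef : simpl never.

(** * Weierstrass division by a series of order one *)

Section MapSeries.
Variables (A B : comNzRingType) (h : {rmorphism A -> B}).
Definition fps_map (f : fps A) : fps B := Fps (fun n => h (f n)).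
Lemma fps_mapE f n : fps_map f n = h (f n). Proof. by []. Qed.
Lemma fps_map_zmod : zmod_morphism fps_map.
Proof. by move=> f g; apply: fpsP => n; rewrite fpsBE !fps_mapE fpsBE rmorphB. Qed.
Lemma fps_map_monoid : monoid_morphism fps_map.
Proof.
split=> [|f g]; apply: fpsP => n; first by rewrite fps_mapE !fps1E rmorph_nat.
rewrite fps_mapE !fpsME rmorph_sum; apply: eq_bigr => i _.
by rewrite rmorphM.
Qed.
HB.instance Definition _ := GRing.isZmodMorphism.Build (fps A) (fps B) fps_map fps_map_zmod.
HB.instance Definition _ := GRing.isMonoidMorphism.Build (fps A) (fps B) fps_map fps_map_monoid.
End MapSeries.

Section Division.
Variable K : realType.
Local Notation C := (complex K).
Local Notation D := (fps C).
Local Notation O := (formalring K).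
Local Notation cst := (@fps_const D).
Implicit Types (f g h : O) (c : C).

(** Restriction to the line x = 0, and its section by the series in y alone. *)
Definition atX0 : O -> D := fps_map (@at0 C).
Definition inY : D -> O := fps_map (@fps_const C).
HB.instance Definition _ := GRing.RMorphism.on atX0.
HB.instance Definition _ := GRing.RMorphism.on inY.

Lemma atX0E f j : atX0 f j = f j 0%N. Proof. by []. Qed.
Lemma inYE (c : D) j : inY c j = fps_const (c j). Proof. by []. Qed.
Lemma inYK : cancel inY atX0. Proof. by move=> c; apply: fpsP. Qed.
Lemma atX0_scalar c : atX0 (scalar c) = fps_const c.
Proof.
apply: fpsP => j; rewrite atX0E scalarE eqxx /= fps_constE.
by case: eqP.
Qed.
Lemma inY_const c : inY (fps_const c) = scalar c.
Proof.
apply: fpsP => j; apply: fpsP => i; rewrite scalarE inYE !fps_constE.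
by case: (j == 0%N); rewrite ?andbT ?andbF // if_same.
Qed.
Lemma atX0_varX : atX0 varX = 0.
Proof. by apply: fpsP => j; rewrite atX0E /varX fps_constE fps0E; case: eqP => // _; rewrite ?fps0E. Qed.
Lemma atX0_varY : atX0 varY = fpsX.
Proof. by apply: fpsP => j; rewrite atX0E /varY !fpsXE; case: eqP => // _; rewrite ?fps1E ?fps0E. Qed.
Lemma atX0_eq0 f : atX0 f = 0 -> exists g, f = varX * g.
Proof.
move=> f0; exists (Fps (fun j => fps_shift (f j))); apply: fpsP => j.
rewrite /varX fps_const_mulE -fps_shift0 //.
by rewrite -atX0E f0 fps0E.
Qed.

(** Iterating the hypothesis divides the remainder by x each time, and the
    successive quotients and constants are the coefficients of convergent series
    in x. With e = 1 this is division with a remainder in x alone, and with e = 0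
    it shows that an ideal is principal. *)
Lemma x_adic_division (I : set O) (b e : O) :
    (forall f, I f -> exists q c g, I g /\ f = q * b + scalar c * e + varX * g) ->
  forall f, I f -> exists q (c : D), f = q * b + cst c * e.
Proof.
move=> H.
have /choice[next nextP] : forall f, exists t : O * C * O, I f ->
    I t.2 /\ f = t.1.1 * b + scalar t.1.2 * e + varX * t.2.
  move=> f; have [If|nIf] := pselect (I f); last by exists (0, 0, 0).
  by have [q [c [g qcg]]] := H f If; exists (q, c, g).
move=> f If.
pose F n := iter n (fun f => (next f).2) f.
have IF n : I (F n) by elim: n => [//|n IH]; apply: (nextP _ IH).1.
pose q n := (next (F n)).1.1; pose c n := (next (F n)).1.2.
have E n : f = (\sum_(k < n) varX ^+ k * q k) * b
              + (\sum_(k < n) varX ^+ k * scalar (c k)) * e + varX ^+ n * F n.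
  elim: n => [|n IH]; first by rewrite !big_ord0 -[F 0%N]/f; ring.
  rewrite !big_ord_recr /= {1}IH {1}(nextP _ (IF n)).2 exprS -/(q n) -/(c n).
  by rewrite -[(next (F n)).2]/(F n.+1); ring.
exists (fsum (fun k => varX ^+ k * q k)), (Fps c).
apply/eqP; rewrite -subr_eq0; apply/eqP/Mge_all => n.
have Xk k g : Mge k (varX ^+ k * g) by apply: MgeMr; apply: MgeX1; apply: MgeX_var.
have Mq := @fsumP K (fun k => varX ^+ k * q k) (fun k => Xk k (q k)) n.
have Mc : Mge n (cst (Fps c) - \sum_(k < n) varX ^+ k * scalar (c k)).
  move=> j i lt; have im : (i < n)%N by lia.
  rewrite !fpsBE !fps_sumE (bigD1 (Ordinal im)) //= big1 ?addr0.
    rewrite varXnME ltnn subnn scalarE eqxx /= fps_constE.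
    by case: (j == 0%N); rewrite ?fps0E ?FpsE subrr.
  move=> k; rewrite -val_eqE /= varXnME scalarE subn_eq0 => ki.
  by case: ltnP => // le; rewrite leqNgt ltn_neqAle le ki.
rewrite {1}(E n).
rewrite [X in Mge _ X](_ : _ = varX ^+ n * F n
  - (fsum (fun k => varX ^+ k * q k) - \sum_(k < n) varX ^+ k * q k) * b
  - (cst (Fps c) - \sum_(k < n) varX ^+ k * scalar (c k)) * e); last by ring.
by apply: MgeB; [apply: MgeB|]; [|apply: MgeMr|apply: MgeMr].
Qed.

(** Modulo x, the divisor is y times a unit. *)
Lemma divide_order1 g : g 0%N 0%N = 0 -> g 1%N 0%N != 0 ->
  forall f, exists q (c : D), f = q * g + cst c.
Proof.
move=> g0 g1 f.
have [] := @x_adic_division setT g 1 _ f => // [{}f _|q [c ->]]; last by exists q, c; rewrite mulr1.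
pose u := fps_shift (atX0 g).
have gE : atX0 g = fpsX * u by rewrite -fps_shift0 // atX0E.
have uu : u \is a GRing.unit by rewrite fps_unitE unitfE.
pose q := inY (fps_shift (atX0 f) / u).
have [|r rE] := @atX0_eq0 (f - q * g - scalar (f 0%N 0%N)).
  rewrite !rmorphB rmorphM /= inYK gE atX0_scalar {1}[atX0 f]fps_shiftE.
  by rewrite mulrCA divrK // addrK atX0E subrr.
by exists q, (f 0%N 0%N), r; split=> //; rewrite -rE mulr1; ring.
Qed.

(** Division of y by g presents the curve g = 0 as the graph of the remainder; the
    quotient is a unit by comparison of the coefficients of y. *)
Lemma order1_graph g : g 0%N 0%N = 0 -> g 1%N 0%N != 0 ->
  exists (psi : D) (q : O), [/\ psi 0%N = 0, q \is a GRing.unit & varY - cst psi = q * g].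
Proof.
move=> g0 g1; have [q [psi E]] := divide_order1 g0 g1 varY; exists psi, q; split.
- have := congr1 (fun f => f 0%N 0%N) E; rewrite /= /varY !fpsDE !fpsM0 g0 mulr0 add0r.
  by rewrite fpsXE fps0E => <-.
- have := congr1 (fun f => f 1%N 0%N) E; rewrite /= !fpsDE fps2ME fps_constE fps0E addr0.
  rewrite !big_ord_recl !big_ord0 /= !addr0 /bump leqnn addn0 subnn g0 mulr0 addr0.
  rewrite unitO => qg; apply: contra_eqN qg => /eqP ->.
  by rewrite mul0r oner_eq0.
by rewrite {1}E addrK.
Qed.

End Division.

(** * The Newton-Puiseux theorem *)

Section Puiseux.
Variable K : realType.
Local Notation C := (complex K).
Local Notation D := (fps C).
Local Notation O := (formalring K).
Local Notation cst := (@fps_const D).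
Implicit Types (f g h : O) (c : C).

Lemma at0_cst (c : D) : at0 (cst c) = c. Proof. by []. Qed.
Lemma at0_varX : at0 (varX : O) = fpsX. Proof. by []. Qed.
Lemma at0_varY : at0 (varY : O) = 0. Proof. by apply: fpsP => i; rewrite fps0E. Qed.

(** Composing with the projection of f(x, y) to f(x, 0) reduces the claim to an
    equality of two local endomorphisms on the variables. *)
Lemma endo_cst (h : {rmorphism O -> O}) : local_endo h -> h varX = varX ->
  forall c : D, h (cst c) = cst c.
Proof.
move=> lh hX c; pose pr : {rmorphism O -> O} := @fps_const D \o @at0 D.
have lpr : local_endo pr.
  split=> [d|f f1] //; apply/Mge1P; apply: (f1 0%N 0%N); exact: isT.
have prY : pr varY = 0 by rewrite /= at0_varY rmorph0.
have E : h \o pr =1 pr.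
  apply: (local_endo_eq (h1 := h \o pr : {rmorphism O -> O}) (local_endo_comp lh lpr) lpr).
    exact: hX.
  by rewrite -[LHS]/(h (pr varY)) prY rmorph0.
exact: (E (cst c)).
Qed.

(** The k-th derivative in y divided by k!. *)
Definition hasse k f : O := Fps (fun j => f (j + k)%N *+ 'C(j + k, k)).

Lemma hasseE k f j : hasse k f j = f (j + k)%N *+ 'C(j + k, k). Proof. by []. Qed.

Lemma fpsMnE (A : comNzRingType) (f : fps A) m n : (f *+ m) n = f n *+ m.
Proof. by elim: m => [|m IH]; rewrite ?mulr0n ?fps0E // !mulrS fpsDE IH. Qed.

Lemma hasse_zmod k : zmod_morphism (hasse k).
Proof. by move=> f g; apply: fpsP => j; rewrite fpsBE !hasseE fpsBE mulrnBl. Qed.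
HB.instance Definition _ k := GRing.isZmodMorphism.Build O O (hasse k) (hasse_zmod k).

Lemma cstYE (a : D) m j : (cst a * varY ^+ m) j = if j == m then a else 0.
Proof. by rewrite fps_const_mulE fpsXnE; case: eqP => _; rewrite ?mulr1 ?mulr0. Qed.

Lemma truncY n f : Mge n (f - \sum_(j < n) cst (f j) * varY ^+ j).
Proof.
move=> j i lt; have jn : (j < n)%N by lia.
rewrite !fpsBE fps_sumE (bigD1 (Ordinal jn)) //= cstYE eqxx big1 ?addr0 ?subrr //.
by move=> k; rewrite -val_eqE cstYE eq_sym => /negbTE->.
Qed.

(** Taylor's formula for the shift y -> y + psi(x). By continuity it is enough
    to treat monomials, where it is the binomial formula. *)
Lemma hasse_shift (h h0 : {rmorphism O -> O}) (psi : D) :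
    local_endo h -> local_endo h0 -> h varX = varX -> h0 varX = varX ->
    h varY = varY + cst psi -> h0 varY = cst psi ->
  forall k f, h f k = at0 (h0 (hasse k f)).
Proof.
move=> lh lh0 hX h0X hY h0Y k f.
apply/eqP; rewrite -subr_eq0; apply/eqP/vge_all => n.
have small r : Mge (n + k) r -> vge n (h r k - at0 (h0 (hasse k r))).
  move=> rn i lt; rewrite fpsBE (local_endo_Mge lh rn) ?sub0r; last by lia.
  have hr : Mge n (hasse k r) by move=> l m lm; rewrite hasseE fpsMnE rn ?mul0rn //; lia.
  by rewrite (local_endo_Mge lh0 hr) ?oppr0 ?addn0.
have mono (a : D) j : h (cst a * varY ^+ j) k = at0 (h0 (hasse k (cst a * varY ^+ j))).
  have -> : hasse k (cst a * varY ^+ j) = cst (a *+ 'C(j, k)) * varY ^+ (j - k).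
    apply: fpsP => l; rewrite hasseE !cstYE.
    have [le|lt] := leqP k j.
      have -> : (l + k == j)%N = (l == j - k)%N by apply/eqP/eqP; lia.
      by case: eqP => [->|_]; rewrite ?mul0rn ?subnK.
    by rewrite (bin_small lt) mulr0n if_same (gtn_eqF (ltn_addl _ lt)) mul0rn.
  have -> : h (cst a * varY ^+ j) = cst a * (varY + cst psi) ^+ j.
    by rewrite rmorphM rmorphXn hY (endo_cst lh hX).
  have -> : h0 (cst (a *+ 'C(j, k)) * varY ^+ (j - k)) = cst (a *+ 'C(j, k) * psi ^+ (j - k)).
    by rewrite rmorphM rmorphXn h0Y (endo_cst lh0 h0X) [RHS]rmorphM rmorphXn.
  rewrite at0_cst addrC exprDn fps_const_mulE fps_sumE.
  have E (i : nat) : (cst psi ^+ (j - i) * varY ^+ i *+ 'C(j, i)) k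
         = if k == i then psi ^+ (j - i) *+ 'C(j, i) else 0.
    by rewrite fpsMnE -rmorphXn cstYE; case: eqP; rewrite ?mul0rn.
  have [le|lt] := leqP k j.
    rewrite (bigD1 (Ordinal (le : k < j.+1)%N)) //= E eqxx big1 ?addr0.
      by rewrite mulrnAl mulrnAr.
    by move=> i; rewrite -val_eqE E eq_sym => /negbTE->.
  rewrite big1 ?mulr0 ?bin_small ?mulr0n ?mul0r // => i _.
  by rewrite E gtn_eqF // (leq_trans (ltn_ord i)).
have := small _ (@truncY (n + k) f).
have -> // : h (f - \sum_(j < n + k) cst (f j) * varY ^+ j) k -
    at0 (h0 (hasse k (f - \sum_(j < n + k) cst (f j) * varY ^+ j))) =
    h f k - at0 (h0 (hasse k f)).
rewrite rmorphB fpsBE rmorph_sum fps_sumE; under eq_bigr do rewrite mono.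
rewrite (raddfB (hasse k : {additive O -> O})) (raddf_sum (hasse k : {additive O -> O})).
by rewrite (rmorphB h0) (rmorph_sum h0) (rmorphB at0) (rmorph_sum at0) opprB addrA subrK.
Qed.

Lemma MgeY_cst (psi : D) : psi 0%N = 0 -> Mge 1 (cst psi).
Proof. by move=> p0; apply/Mge1P. Qed.

(** The Tschirnhausen transformation. The Hasse derivative of order e has order
    one in y, by characteristic zero, so that it has a root y = psi(x); by
    Taylor's formula, its value there is the coefficient of y^e after the
    translation of y by psi. *)
Lemma tschirnhausen e f : (forall j, (j <= e)%N -> f j 0%N = 0) -> f e.+1 0%N != 0 ->
  exists h : {rmorphism O -> O},
    [/\ local_endo h, h varX = varX, h f e = 0 & forall j, h f j 0%N = f j 0%N].
Proof.
move=> fj fe.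
have H0 : hasse e f 0%N 0%N = 0 by rewrite hasseE fpsMnE fj // mul0rn.
have H1 : hasse e f 1%N 0%N != 0.
  by rewrite hasseE fpsMnE add1n mulrn_eq0 (negbTE fe) orbF binSn.
have [psi [q [psi0 uq E]]] := order1_graph H0 H1.
have [h [lh hX hY]] := subst_exists (@MgeX_var K) (MgeD (@MgeY_var K) (MgeY_cst psi0)).
have [h0 [lh0 h0X h0Y]] := subst_exists (@MgeX_var K) (MgeY_cst psi0).
exists h; split=> //.
  rewrite (hasse_shift lh lh0 hX h0X hY h0Y).
  have : h0 (varY - cst psi) = 0 by rewrite rmorphB h0Y (endo_cst lh0 h0X) subrr.
  rewrite E rmorphM => /eqP; rewrite mulf_eq0 => /orP[|/eqP-> //].
  by move=> /eqP q0; have := rmorph_unit h0 uq; rewrite q0 unitr0.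
move=> j; rewrite -!atX0E.
pose m : {rmorphism O -> O} := @inY K \o @atX0 K.
have lm : local_endo m.
  split=> [c|g g1]; first by rewrite /= atX0_scalar inY_const.
  by apply/Mge1P; apply: (g1 0%N 0%N); exact: isT.
have mX : m varX = 0 by rewrite /= atX0_varX rmorph0.
have mh : m \o h =1 m.
  apply: (local_endo_eq (h1 := m \o h : {rmorphism O -> O}) (local_endo_comp lm lh) lm).
    by rewrite -[LHS]/(m (h varX)) hX.
  rewrite -[LHS]/(m (h varY)) hY rmorphD -[m (cst psi)]/(inY (atX0 (cst psi))).
  rewrite (_ : atX0 (cst psi) = 0) ?rmorph0 ?addr0 //.
  apply: fpsP => i; rewrite atX0E fps_constE fps0E.
  by case: eqP => _; rewrite ?fps0E.
rewrite -[atX0 f]inYK -[atX0 (h f)]inYK; congr (atX0 _ _); exact: mh.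
Qed.

End Puiseux.

Section NewtonPuiseux.
Variable K : realType.
Local Notation C := (complex K).
Local Notation D := (fps C).
Local Notation O := (formalring K).
Implicit Types (f g h : O) (c : C).

Definition xdvd m f := exists g, f = varX ^+ m * g.
Lemma xdvdD m f g : xdvd m f -> xdvd m g -> xdvd m (f + g).
Proof. by move=> [a ->] [b ->]; exists (a + b); rewrite mulrDr. Qed.
Lemma xdvd0 m : xdvd m 0. Proof. by exists 0; rewrite mulr0. Qed.
Lemma xdvd_sum m (I : Type) (r : seq I) (P : pred I) (F : I -> O) :
  (forall i, P i -> xdvd m (F i)) -> xdvd m (\sum_(i <- r | P i) F i).
Proof. by move=> H; elim/big_rec: _ => [|i f /H]; [apply: xdvd0|apply: xdvdD]. Qed.
Lemma xdvdMl m f g : xdvd m f -> xdvd m (g * f).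
Proof. by move=> [a ->]; exists (g * a); rewrite mulrCA. Qed.
Lemma xdvdMr m f g : xdvd m f -> xdvd m (f * g).
Proof. by rewrite mulrC; apply: xdvdMl. Qed.
Lemma xdvdX m n : (m <= n)%N -> xdvd m (varX ^+ n).
Proof. by move=> mn; exists (varX ^+ (n - m)); rewrite -exprD subnKC. Qed.
Lemma xdvdM m n f g : xdvd m f -> xdvd n g -> xdvd (m + n) (f * g).
Proof. by move=> [a ->] [b ->]; exists (a * b); rewrite exprD mulrACA. Qed.

(** The substitution (x^q, x^p z) turns weighted order into divisibility by
    powers of x. *)
Lemma weighted_subst (h : {rmorphism O -> O}) (z : O) p q m f :
    local_endo h -> (0 < p)%N -> (0 < q)%N -> h varX = varX ^+ q ->
    h varY = varX ^+ p * z ->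
  (forall j i, (q * i + p * j < m)%N -> f j i = 0) -> xdvd m (h f).
Proof.
move=> lh p0 q0 hX hY fw.
have big n r : Mge n r -> xdvd n (h r).
  elim: n r => [|n IH] r; first by move=> _; exists (h r); rewrite mul1r.
  move=> /Mge_split[a [b [an bn ->]]]; rewrite rmorphD !rmorphM hX hY -add1n.
  apply: xdvdD; apply: xdvdM; rewrite ?IH //; try exact: IH; first exact: xdvdX.
  by apply: xdvdMr; apply: xdvdX.
rewrite -[f](subrK (\sum_(j < m) \sum_(i < m) scalar (f j i) * (varX ^+ i * varY ^+ j))).
rewrite rmorphD; apply: xdvdD; first by apply: big; apply: truncP.
rewrite rmorph_sum; apply: xdvd_sum => j _; rewrite rmorph_sum; apply: xdvd_sum => i _.
have [le|lt] := leqP m (q * i + p * j).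
  rewrite !rmorphM !rmorphXn hX hY exprMn -!exprM; apply: xdvdMl.
  by rewrite mulrA -exprD; apply: xdvdMr; apply: xdvdX.
by rewrite fw // rmorph0 mul0r rmorph0; apply: xdvd0.
Qed.

(** The first edge of the Newton polygon from the vertex (e + 1, 0): the slope is
    minimized over the points (j, ord f_j), and written without denominators. *)
Lemma newton_slope e f : f 0%N != 0 -> exists2 j0, (j0 <= e)%N /\ f j0 != 0 &
  forall j, (j <= e)%N -> f j != 0 ->
    (ordn (f j0) * (e.+1 - j) <= ordn (f j) * (e.+1 - j0))%N.
Proof.
move=> f0; pose slope (j : 'I_e.+1) : rat := (ordn (f j))%:R / (e.+1 - j)%:R.
have [j0 fj0 min] := @Order.TotalTheory.arg_minP _ _ 'I_e.+1 ord0 (fun j => f j != 0) slope f0.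
exists (val j0); first by split=> //; rewrite -ltnS ltn_ord.
move=> j je fj; have := min (Ordinal (je : j < e.+1)%N) fj; rewrite /slope /=.
have pos (k : nat) : (k < e.+1)%N -> 0 < (e.+1 - k)%:R :> rat by rewrite ltr0n subn_gt0.
by rewrite ler_pdivrMr ?pos // mulrAC ler_pdivlMr ?pos // -!natrM ler_nat.
Qed.

(** Formal arcs through the origin, as homomorphisms of local rings. *)
Definition local_arc (al : O -> D) :=
  (forall c, al (scalar c) = fps_const c) /\ (forall f, Mge 1 f -> al f 0%N = 0).

Lemma local_arc_comp (al : {rmorphism O -> D}) (h : {rmorphism O -> O}) :
  local_arc al -> local_endo h -> local_arc (al \o h).
Proof. by move=> [s m] [s1 m1]; split=> [c|f f1] /=; [rewrite s1|apply/m/m1]. Qed.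

Lemma local_arc_at0 : local_arc (@at0 D).
Proof. by split=> // f f1; apply: (f1 0%N 0%N). Qed.

(** If lam had multiplicity e + 1, then c would be a multiple of
    (X - lam)^(e + 1); in characteristic zero its vanishing coefficient of X^e
    forces lam = 0, and c would be a monomial. This is what the Tschirnhausen
    transformation is for: it makes the multiplicity drop in the recursion. *)
Lemma root_not_maximal (F : closedFieldType) e (c : {poly F}) j0 :
    [pchar F] =i pred0 -> size c = e.+2 -> c`_e = 0 -> (j0 <= e)%N -> c`_j0 != 0 ->
  exists lam k r, [/\ (0 < k <= e)%N, c = r * ('X - lam%:P) ^+ k & r.[lam] != 0].
Proof.
move=> ch0 sc ce je cj.
have [lam rl] : exists lam, root c lam by apply/closed_rootP; rewrite sc.
have c0 : c != 0 by rewrite -size_poly_eq0 sc.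
have [k] := multiplicity_XsubC c lam; rewrite c0 /= => -[r rr cE].
have r0 : r != 0 by apply: contraNneq rr => ->; rewrite root0.
have sr : (size r + k = e.+2)%N.
  rewrite -sc cE size_Mmonic ?monic_exp ?monicXsubC // size_exp_XsubC.
  by rewrite addnS.
have sr0 : (0 < size r)%N by rewrite lt0n size_poly_eq0.
exists lam, k, r; split=> //; apply/andP; split.
  rewrite lt0n; apply: contraNneq rr => k0; move: cE.
  by rewrite k0 mulr1 => <-.
rewrite leqNgt; apply/negP => ek; have ke : k = e.+1 by lia.
have /size_poly1P[a a0 ra] : size r == 1%N by apply/eqP; lia.
move: ce; rewrite cE ra mul_polyC coefZ ke.
have -> : ('X - lam%:P) ^+ e.+1 = \prod_(x <- nseq e.+1 lam) ('X - x%:P) :> {poly F}.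
  by rewrite big_nseq iter_mulr_1.
have := @coefPn_prod_XsubC F (nseq e.+1 lam); rewrite size_nseq => /(_ isT) ->.
rewrite big_nseq iter_addr_0 => /eqP.
rewrite mulf_eq0 (negbTE a0) oppr_eq0 -mulr_natr mulf_eq0 /=.
have /pcharf0P -> := ch0; rewrite orbF => /eqP lam0.
by move: cj; rewrite cE ra lam0 subr0 ke mul_polyC coefZ coefXn ltn_eqF ?mulr0 ?eqxx.
Qed.

(** Newton's algorithm: translate by Tschirnhausen, blow up along the first edge
    of the Newton polygon, and recurse at a root of the polynomial of this edge,
    where the order in y has dropped. The fractional power series y(x^(1/N)) so
    obtained is expressed as an arc on which x is t^N. *)
Lemma puiseux d f : (0 < d)%N -> (forall j, (j < d)%N -> f j 0%N = 0) -> f d 0%N != 0 ->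
  exists (al : {rmorphism O -> D}) N,
    [/\ local_arc al, (0 < N)%N, al varX = fpsX ^+ N & al f = 0].
Proof.
elim/ltn_ind: d f => -[//|e] IH f _ fj fd.
have [h [lh hX fe f0]] := tschirnhausen fj fd.
have [E|f10] := eqVneq (h f 0%N) 0.
  exists (@at0 D \o h), 1%N; split=> //; last by rewrite /= hX at0_varX expr1.
  exact: local_arc_comp local_arc_at0 lh.
have [j0 [je fj0] slope] := newton_slope e f10.
move: fe f0 f10 fj0 slope; set f1 := h f => fe f0 f10 fj0 slope.
pose p := ordn (f1 j0); pose q := (e.+1 - j0)%N; pose m := (p * e.+1)%N.
have p0 : (0 < p)%N by rewrite ordn_gt0 // f0 fj.
have q0 : (0 < q)%N by rewrite subn_gt0.
(* the monomials of f1 lie on or above the line supporting the edge *)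
have wt j i : f1 j i != 0 -> (m <= q * i + p * j)%N.
  move=> fji; have [le|lt] := leqP e.+1 j; first by rewrite /m; nia.
  have fjn : f1 j != 0 by apply: contraNneq fji => ->; rewrite fps0E.
  have [_ vj] := ordnP fjn.
  have oi : (ordn (f1 j) <= i)%N by rewrite leqNgt; apply: contra fji => /vj ->.
  have := slope j lt fjn; rewrite -/p -/q /m => sl.
  have pe : (p * e.+1 = p * (e.+1 - j) + p * j)%N by rewrite -mulnDr subnK // ltnW.
  by rewrite pe leq_add2r (leq_trans sl) // mulnC leq_mul2l oi orbT.
(* c collects the terms on the edge: that of degree j in y has degree ex j in x *)
pose ex j := ((p * (e.+1 - j)) %/ q)%N.
pose cj j := if (q %| p * (e.+1 - j))%N then f1 j (ex j) else 0.
pose c := \poly_(j < e.+2) cj j.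
have ce1 : cj e.+1 != 0 by rewrite /cj /ex subnn muln0 dvdn0 div0n f0.
have sc : size c = e.+2 by apply: size_poly_eq.
have [|||lam [k [r [kr cE rl]]]] := @root_not_maximal _ e c j0 _ sc _ je.
- exact: pchar_num.
- by rewrite coef_poly ltnS leqnSn /cj fe fps0E if_same.
- rewrite coef_poly ltnS leqW // /cj /ex -/q dvdn_mull // mulnK //.
  exact: (ordnP fj0).1.
have Mz : Mge 1 (varX ^+ p * (scalar lam + varY)).
  by apply: MgeMr; apply: (MgeW p0 (MgeX1 (k := p) (@MgeX_var K))).
have [h2 [lh2 h2X h2Y]] := subst_exists (MgeW q0 (MgeX1 (k := q) (@MgeX_var K))) Mz.
pose init : O := \sum_(j < e.+2) scalar (cj j) * (varX ^+ ex j * varY ^+ j).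
have initE j i : init j i = if (j < e.+2)%N && (i == ex j) then cj j else 0.
  rewrite !fps_sumE; case: ltnP => [lt|le] /=.
    rewrite (bigD1 (Ordinal lt)) //= monomialE eqxx andbT big1 ?addr0 //.
    by move=> l; rewrite -val_eqE monomialE andbC eq_sym => /negbTE->.
  by rewrite big1 // => l _; rewrite monomialE andbC gtn_eqF // (leq_trans (ltn_ord l)).
have small j i : (q * i + p * j < m.+1)%N -> (f1 - init) j i = 0.
  rewrite ltnS => le; rewrite !fpsBE initE.
  have jd : (j <= e.+1)%N by rewrite -(leq_pmul2l p0) (leq_trans _ le) ?leq_addl.
  have pe : m = (p * (e.+1 - j) + p * j)%N by rewrite -mulnDr subnK.
  rewrite ltnS jd /=; move: le; rewrite pe leq_add2r => le.
  have [iE|ne] := eqVneq i (ex j).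
    rewrite /cj; case: ifP => [_|ndv]; first by rewrite iE subrr.
    rewrite subr0; apply/eqP; apply: contraFT ndv => /wt.
    rewrite pe leq_add2r => ge; have /eqP <- : (q * i == p * (e.+1 - j))%N by rewrite eqn_leq le.
    exact: dvdn_mulr.
  rewrite subr0; apply/eqP; apply: contraNT ne => /wt.
  rewrite pe leq_add2r => ge; have /eqP E : (q * i == p * (e.+1 - j))%N by rewrite eqn_leq le.
  by rewrite /ex -E mulKn.
have [g' g'E] := weighted_subst lh2 p0 q0 h2X h2Y small.
pose R : O := (map_poly (@scalar K) r).[scalar lam + varY].
(* after the blow-up and division by x^m, the edge gives c(lam + y) = y^k * R *)
have hinit : h2 init = varX ^+ m * (R * varY ^+ k).
  have -> : R * varY ^+ k = \sum_(j < e.+2) scalar (cj j) * (scalar lam + varY) ^+ j.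
    transitivity ((map_poly (@scalar K) c).[scalar lam + varY]).
      rewrite cE rmorphM rmorphXn rmorphB /= map_polyX map_polyC /= hornerM horner_exp.
      by rewrite hornerXsubC (_ : scalar lam + varY - scalar lam = varY) // addrC addKr.
    rewrite /c poly_def rmorph_sum horner_sum; apply: eq_bigr => j _ /=.
    by rewrite map_polyZ map_polyXn hornerZ hornerXn.
  rewrite mulr_sumr rmorph_sum; apply: eq_bigr => j _.
  rewrite 2!rmorphM 2!rmorphXn h2X h2Y lh2.1 exprMn -!exprM.
  rewrite (mulrA (varX ^+ (q * ex j)%N)) -exprD mulrCA.
  rewrite /cj; case: ifP => [dv|_]; last by rewrite rmorph0 (mul0r ((scalar lam + varY) ^+ j)) mulr0 mulr0.
  suff -> : (q * ex j + p * j = m)%N by [].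
  by rewrite /ex mulnC divnK // -mulnDr subnK // -ltnS ltn_ord.
pose G := R * varY ^+ k + varX * g'.
have hf1 : h2 f1 = varX ^+ m * G.
  by rewrite -(subrK init f1) rmorphD g'E hinit /G exprSr; ring.
have GE j : G j 0%N = if (j < k)%N then 0 else R (j - k)%N 0%N.
  rewrite /G !fpsDE [R * _]mulrC varYnME -[varX]expr1 varXnME addr0.
  by case: ifP.
have [k0 ke] : (0 < k)%N /\ (k < e.+1)%N by move/andP: kr.
have [||al [N [lal N0 alX alG]]] := IH k ke G k0; first by move=> j jk; rewrite GE jk.
  rewrite GE ltnn subnn; pose ev : {rmorphism O -> C} := @at0 C \o @at0 D.
  have -> : R 0%N 0%N = ev R by [].
  rewrite /R -horner_map -map_poly_comp.
  have evs a : ev (scalar a) = a by [].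
  have evY : ev varY = 0 by [].
  by rewrite rmorphD evs evY addr0 map_poly_id // => a _; apply: evs.
exists (al \o (h2 \o h)), (N * q)%N; split=> /=.
- exact: local_arc_comp lal (local_endo_comp lh2 lh).
- by rewrite muln_gt0 N0.
- by rewrite hX h2X rmorphXn alX exprM.
by rewrite -/f1 hf1 rmorphM alG mulr0.
Qed.

End NewtonPuiseux.

(** * Arcs of irreducible curves *)

Section Arcs.
Variable K : realType.
Local Notation C := (complex K).
Local Notation D := (fps C).
Local Notation O := (formalring K).
Local Notation cst := (@fps_const D).
Implicit Types (f g h a : O) (c : C).

(** The arc parametrizes the curve a = 0, possibly as a ramified cover of its
    normalization: C[[t]] is only asked to be integral over the coordinate ring. *)
Definition arc_of a (al : {rmorphism O -> D}) :=
  [/\ local_arc al, forall f, al f = 0 <-> ideal1 a f, integralRange al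
    & exists2 z, Mge 1 z & al z != 0].

Lemma trunc1 m (c : D) : vge m (c - \sum_(k < m) fps_const (c k) * fpsX ^+ k).
Proof.
move=> i im; rewrite fpsBE fps_sumE (bigD1 (Ordinal im)) //= fps_const_mulE fpsXnE eqxx mulr1.
rewrite big1 ?addr0 ?subrr // => k; rewrite -val_eqE fps_const_mulE fpsXnE eq_sym => /negbTE->.
by rewrite mulr0.
Qed.

Lemma arc_cstE (al : {rmorphism O -> D}) N : local_arc al -> (0 < N)%N ->
    al varX = fpsX ^+ N ->
  forall (c : D) n, al (cst c) n = if (N %| n)%N then c (n %/ N)%N else 0.
Proof.
move=> [als _] N0 alX c n.
have [r rE] := (vgeP _ _).1 (@trunc1 n.+1 c).
have -> : c = \sum_(k < n.+1) fps_const (c k) * fpsX ^+ k + fpsX ^+ n.+1 * r by rewrite -rE addrC subrK.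
have S k (d : C) : al (cst (fps_const d * fpsX ^+ k)) = fps_const d * fpsX ^+ (N * k).
  have -> : cst (fps_const d * fpsX ^+ k) = scalar d * varX ^+ k by rewrite rmorphM rmorphXn.
  by rewrite rmorphM rmorphXn als alX exprM.
have T : al (cst (fpsX ^+ n.+1 * r)) n = 0.
  have -> : cst (fpsX ^+ n.+1 * r) = varX ^+ n.+1 * cst r by rewrite rmorphM rmorphXn.
  by rewrite rmorphM rmorphXn alX -exprM fpsXn_mulE leq_pmull.
rewrite (rmorphD cst) rmorphD fpsDE T addr0 (rmorph_sum cst) rmorph_sum fps_sumE.
under eq_bigr do rewrite S fps_const_mulE fpsXnE.
rewrite -rE addrC subrK.
have [/dvdnP[k nE]|nd] := boolP (N %| n)%N; last first.
  rewrite big1 // => k _; case: eqP => [nE|_]; last by rewrite mulr0.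
  by rewrite nE dvdn_mulr in nd.
have kn : (k < n.+1)%N by rewrite nE ltnS leq_pmulr.
have eqN l : (n == N * l)%N = (l == k) by rewrite nE mulnC eqn_pmul2l // eq_sym.
have nk : (n %/ N)%N = k by rewrite nE mulnK.
rewrite (bigD1 (Ordinal kn)) //= eqN eqxx mulr1 nk big1 ?addr0 //.
by move=> l; rewrite -val_eqE eqN => /negbTE->; rewrite mulr0.
Qed.

(** The coordinate t is a root of T^N - x, and the series in t are a finite
    module over those in t^N: hence all of C[[t]] is integral over the
    coordinate ring of the branch. *)
Lemma arc_integral (al : {rmorphism O -> D}) N : local_arc al -> (0 < N)%N ->
  al varX = fpsX ^+ N -> integralRange al.
Proof.
move=> lal N0 alX z.
have It : integralOver al fpsX.
  exists ('X^N - varX%:P); first exact: monicXnsubC.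
  by rewrite rmorphB /= map_polyXn map_polyC /= alX /root !hornerE subrr.
have Itk k : integralOver al (fpsX ^+ k).
  by elim: k => [|k IH]; [exact: integral1|rewrite exprS; exact: integral_mul].
pose zi i : D := Fps (fun n => z (n * N + i)%N).
have -> : z = \sum_(i < N) fpsX ^+ i * al (cst (zi i)).
  apply: fpsP => n; rewrite fps_sumE.
  rewrite (bigD1 (Ordinal (ltn_pmod n N0))) //= fpsXn_mulE ltnNge leq_mod /=.
  have nm : (n - n %% N = n %/ N * N)%N by rewrite {1}(divn_eq n N) addnK.
  rewrite (arc_cstE lal N0 alX) nm dvdn_mull // mulnK // /zi /= FpsE -divn_eq.
  rewrite big1 ?addr0 // => i; rewrite -val_eqE /= => ni.
  rewrite fpsXn_mulE (arc_cstE lal N0 alX); case: ltnP => // le; case: ifP => // /dvdnP[k kE].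
  by case/eqP: ni; rewrite -(subnK le) kE modnMDl modn_small.
apply: (big_ind (integralOver al)); [exact: (mxpoly.integral0 al)|exact: integral_add|move=> i _].
by apply: integral_mul => //; apply: integral_id.
Qed.

Lemma arc_unit (al : {rmorphism O -> D}) f : al f = 0 -> f \isn't a GRing.unit.
Proof. by move=> af; apply/negP => /(rmorph_unit al); rewrite af unitr0. Qed.

Lemma nirreducible0 a : irreducible_series a -> a != 0.
Proof.
move=> [_ H]; apply/eqP => a0; have := H 0 0; rewrite a0 mulr0 => /(_ erefl).
by rewrite unitr0 => -[].
Qed.

(** The kernel of a nonconstant arc is generated by any of its elements of
    least order in y. *)
Lemma arc_kernel (al : {rmorphism O -> D}) a : irreducible_series a ->
  al varX != 0 -> atX0 a != 0 -> al a = 0 -> forall f, al f = 0 <-> ideal1 a f.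
Proof.
move=> [_ irr] alX a0 ala.
pose P n := `[< exists b, [/\ al b = 0, atX0 b != 0 & ordn (atX0 b) = n] >].
have exP : exists n, P n by exists (ordn (atX0 a)); apply/asboolP; exists a.
have [n /asboolP[b [alb b0 bn]] min] := ex_minnP exP.
have kb f : al f = 0 -> exists q, f = q * b.
  have step g : al g = 0 -> atX0 g = 0 -> exists2 r, al r = 0 & g = varX * r.
    move=> ag /atX0_eq0[r gE]; exists r => //; move/eqP: ag.
    by rewrite gE rmorphM mulf_eq0 (negbTE alX) => /eqP.
  have div : forall g, [set g | al g = 0] g -> exists q c r,
      [set g | al g = 0] r /\ g = q * b + scalar c * 0 + varX * r.
    move=> g /= ag; have [g0|g0] := eqVneq (atX0 g) 0.
      have [r ar gE] := step g ag g0; exists 0, 0, r; split=> //.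
      by rewrite {1}gE; ring.
    have le : (n <= ordn (atX0 g))%N by apply: min; apply/asboolP; exists g.
    have [u uu bE] := ordn_unit b0; have [v uv gE] := ordn_unit g0.
    pose s : D := fpsX ^+ (ordn (atX0 g) - n) * (v / u).
    have sE : atX0 g = s * atX0 b.
      rewrite {1}gE bE bn /s -{1}(subnK le) exprD.
      by rewrite -[LHS]mulrA -[RHS]mulrA [v / u * _]mulrCA divrK.
    have [||r ar rE] := step (g - inY s * b).
    - by rewrite rmorphB rmorphM alb mulr0 subr0.
    - by rewrite rmorphB rmorphM /= inYK sE subrr.
    by exists (inY s), 0, r; split=> //; rewrite -rE; ring.
  move=> af; have [q [c ->]] := x_adic_division div af.
  by exists q; ring.
have [q aE] := kb a ala.
have uq : q \is a GRing.unit.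
  by have [uq|ub] := irr q b aE; [exact: uq|case: (negP (arc_unit alb) ub)].
move=> f; split=> [/kb[r ->]|[r ->]]; last by rewrite rmorphM ala mulr0.
by exists (r / q); rewrite aE mulrA divrK.
Qed.

(** The line x = 0 is parametrized by y; any other curve has a finite order in y,
    hence a Puiseux root. *)
Lemma arc_exists a : irreducible_series a -> exists al, arc_of a al.
Proof.
move=> irra; have [nua irr] := irra; have a1 := (nunitO a).1 nua.
have [a0|a0] := eqVneq (atX0 a) 0.
  exists (@atX0 K : {rmorphism O -> D}); split.
  - by split=> [c|f f1]; [exact: atX0_scalar|exact: (f1 0%N 0%N)].
  - have [g aE] := atX0_eq0 a0.
    have ug : g \is a GRing.unit.
      have [ux|ug] := irr varX g aE; last exact: ug.
      by case: (negP ((nunitO varX).2 (@MgeX_var K)) ux).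
    move=> f; split=> [/atX0_eq0[r ->]|[r ->]]; last by rewrite rmorphM /= a0 mulr0.
    by exists (r / g); rewrite aE mulrCA divrK // mulrC.
  - by move=> z; rewrite -(inYK z); apply: integral_id.
  exists varY; first exact: MgeY_var.
  by rewrite /= atX0_varY; have [] := ordnXn_unit 1 (unitr1 D); rewrite mulr1.
have [ao av] := ordnP a0.
have d0 : (0 < ordn (atX0 a))%N by rewrite ordn_gt0 // atX0E (a1 0%N 0%N).
have [al [N [lal N0 alX ala]]] := puiseux d0 av ao.
have tN : al varX != 0.
  by rewrite alX; have [] := ordnXn_unit N (unitr1 D); rewrite mulr1.
exists al; split=> //.
- exact: arc_kernel.
- exact: arc_integral alX.
by exists varX => //; apply: MgeX_var.
Qed.

End Arcs.

(** * Semivaluations *)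

Section Semivaluations.
Variable K : realType.
Local Notation C := (complex K).
Local Notation D := (fps C).
Local Notation O := (formalring K).
Implicit Types (f g h a : O) (c : C) (mu nu : O -> \bar K).
Local Open Scope ereal_scope.

Section Basic.
Variable mu : O -> \bar K.
Hypothesis sv : semivaluation mu.

Lemma sv_ge0 f : 0 <= mu f. Proof. by have [H _ _ _ _] := sv; apply: H. Qed.
Lemma svM f g : mu (f * g)%R = mu f + mu g. Proof. by have [_ H _ _ _] := sv; apply: H. Qed.
Lemma sv0 : mu 0%R = +oo. Proof. by have [_ _ _ _ H] := sv. Qed.
Lemma sv_scalar c : c != 0%R -> mu (scalar c) = 0.
Proof. by have [_ _ _ H _] := sv; apply: H. Qed.
Lemma svD_ge x f g : x <= mu f -> x <= mu g -> x <= mu (f + g)%R.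
Proof.
have [_ _ H _ _] := sv => xf xg; apply: le_trans (H f g).
by rewrite le_min xf.
Qed.
Lemma svD_gt x f g : x < mu f -> x < mu g -> x < mu (f + g)%R.
Proof.
have [_ _ H _ _] := sv => xf xg; apply: lt_le_trans (H f g).
by rewrite lt_min xf.
Qed.
Lemma sv1 : mu 1%R = 0.
Proof. by have := sv_scalar (oner_neq0 C); rewrite rmorph1. Qed.
Lemma svN f : mu (- f)%R = mu f.
Proof.
have -> : (- f = scalar (-1) * f)%R by rewrite rmorphN1 mulN1r.
by rewrite svM sv_scalar ?add0e // oppr_eq0 oner_eq0.
Qed.
Lemma svB_ge x f g : x <= mu f -> x <= mu g -> x <= mu (f - g)%R.
Proof. by move=> xf xg; apply: svD_ge => //; rewrite svN. Qed.
Lemma svB_gt x f g : x < mu f -> x < mu g -> x < mu (f - g)%R.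
Proof. by move=> xf xg; apply: svD_gt => //; rewrite svN. Qed.
Lemma sv_sum_ge x (I : Type) (r : seq I) (P : pred I) (F : I -> O) :
  (forall i, P i -> x <= mu (F i)) -> x <= mu (\sum_(i <- r | P i) F i)%R.
Proof.
move=> H; elim/big_rec: _ => [|i f /H]; last exact: svD_ge.
by rewrite sv0 leey.
Qed.
Lemma sv_sum_gt x (I : Type) (r : seq I) (P : pred I) (F : I -> O) : x < +oo ->
  (forall i, P i -> x < mu (F i)) -> x < mu (\sum_(i <- r | P i) F i)%R.
Proof.
move=> xoo H; elim/big_rec: _ => [|i f /H]; last exact: svD_gt.
by rewrite sv0.
Qed.
Lemma sv_unit f : f \is a GRing.unit -> mu f = 0.
Proof.
move=> uf; have := sv1; rewrite -(divrr uf) svM => E.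
by apply/eqP; move/eqP: E; rewrite padde_eq0 ?sv_ge0 // => /andP[].
Qed.
Lemma svX f n : mu (f ^+ n)%R = n%:R%:E * mu f.
Proof.
elim: n => [|n IH]; first by rewrite expr0 sv1 mul0e.
rewrite exprS svM IH -natr1 EFinD ge0_muleDl ?lee_fin ?ler0n //.
by rewrite mul1e addeC.
Qed.
Lemma svMl_ge x f g : x <= mu f -> x <= mu (g * f)%R.
Proof. by move=> xf; rewrite svM; apply: le_trans xf _; rewrite leeDr ?sv_ge0. Qed.
Lemma svMl_gt x f g : x < mu f -> x < mu (g * f)%R.
Proof. by move=> xf; rewrite svM; apply: lt_le_trans xf _; rewrite leeDr ?sv_ge0. Qed.
(** The two variables generate the maximal ideal. *)
Lemma sv_M : val_ideal mu (@maxideal K) = mine (mu varX) (mu varY).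
Proof.
apply/eqP; rewrite eq_le; apply/andP; split.
  rewrite le_min; apply/andP; split; apply: ereal_inf_lbound.
    by exists varX => //; apply/Mge1P/MgeX_var.
  by exists varY => //; apply/Mge1P/MgeY_var.
apply: le_ereal_inf_tmp => _ [f /Mge1P/Mge_split[g [h [_ _ ->]]] <-].
apply: svD_ge; rewrite mulrC; apply: svMl_ge; first by rewrite ge_min lexx.
by rewrite ge_min lexx orbT.
Qed.

Lemma sv_Mge n f : 1 <= val_ideal mu (@maxideal K) -> Mge n f -> n%:R%:E <= mu f.
Proof.
rewrite sv_M le_min => /andP[x1 y1].
elim: n f => [|n IH] f; first by rewrite sv_ge0.
move=> /Mge_split[g [h [gn hn ->]]]; rewrite -natr1 addrC EFinD.
by apply: svD_ge; rewrite svM leeD ?IH.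
Qed.
End Basic.

(** The quotient f/g is regular along the arc, hence integral over the branch
    a = 0. An integral equation bounds its values from below, as long as the
    value of a is large enough for the equation to be exact. *)
Lemma arc_compare a (al : {rmorphism O -> D}) f g : arc_of a al ->
    al g != 0%R -> al f != 0%R -> (ordn (al g) <= ordn (al f))%N ->
  exists n : nat, forall mu, semivaluation mu -> mu g <= mu f \/ mu a <= n%:R%:E * mu f.
Proof.
move=> [lal ker int _] g0 f0 gf.
have [u uu gE] := ordn_unit g0; have [v uv fE] := ordn_unit f0.
pose z : D := (fpsX ^+ (ordn (al f) - ordn (al g)) * (v / u))%R.
have zE : al f = (z * al g)%R.
  rewrite {1}fE gE /z -{1}(subnK gf) exprD.
  by rewrite -[LHS]mulrA -[RHS]mulrA [(v / u * _)%R]mulrCA divrK.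
have [P Pm Pz] := int z; pose n := (size P).-1.
have sP : size P = n.+1 by rewrite /n prednK // lt0n size_poly_eq0 monic_neq0.
have Pn : (P`_n = 1)%R by apply/eqP; move: Pm; rewrite monicE lead_coefE.
(* the integral equation of f/g, multiplied by g^n, holds along the arc *)
pose E : O := (\sum_(i < n.+1) P`_i * (f ^+ i * g ^+ (n - i)))%R.
have [q qE] : ideal1 a E.
  apply/ker; rewrite rmorph_sum.
  transitivity ((map_poly al P).[z] * al g ^+ n)%R; last by rewrite (rootP Pz) mul0r.
  rewrite (horner_coef_wide z (size_poly _ _)) sP mulr_suml; apply: eq_bigr => i _.
  rewrite coef_poly ltn_ord 2!rmorphM 2!rmorphXn zE exprMn.
  have -> : (al g ^+ n = al g ^+ (n - i) * al g ^+ i)%R by rewrite -exprD subnK ?leq_ord.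
  by ring.
have fn : (f ^+ n = q * a - \sum_(i < n) P`_i * (f ^+ i * g ^+ (n - i)))%R.
  by rewrite -qE /E big_ord_recr /= Pn subnn expr0 mul1r mulr1 addrAC subrr add0r.
exists n => mu sv; have [le|lt] := leP (mu g) (mu f); [by left|right].
rewrite leNgt; apply/negP => lta.
have [r fr] : exists r, mu f = r%:E.
  move: lt (sv_ge0 sv f); case: (mu f) => [r _ _||]; first by exists r.
    by rewrite ltNge leey.
  by rewrite leNgt ltNy0.
have nr : n%:R%:E * mu f < +oo by rewrite fr ltry.
have : n%:R%:E * mu f < mu (f ^+ n)%R.
  rewrite fn; apply: svB_gt => //; first by apply: svMl_gt.
  apply: sv_sum_gt => // i _; apply: svMl_gt => //; rewrite svM // !svX //.
  have ni : (0 < n - i)%N by rewrite subn_gt0.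
  have : (n - i)%:R%:E * mu f < (n - i)%:R%:E * mu g.
    by rewrite lte_pmul2l ?lte_fin ?ltr0n.
  rewrite fr -!EFinM => h; rewrite -{1}(subnKC (ltnW (ltn_ord i))) natrD mulrDl EFinD.
  by rewrite lteD2lE.
by rewrite svX // ltxx.
Qed.

End Semivaluations.

(** * Intersection numbers *)

Section Colength.
Variable K : realType.
Local Notation C := (complex K).
Local Notation D := (fps C).
Local Notation O := (formalring K).
Implicit Types (f g h a : O) (c : C) (I : set O).

Definition is_ideal I :=
  [/\ I 0, forall f g, I f -> I g -> I (f + g) & forall f g, I f -> I (g * f)].

Lemma ideal2_ideal a f : is_ideal (ideal2 a f).
Proof.
split; first by exists 0, 0; rewrite !mul0r addr0.
  by move=> _ _ [p [q ->]] [p' [q' ->]]; exists (p + p'), (q + q'); ring.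
by move=> _ g [p [q ->]]; exists (g * p), (g * q); ring.
Qed.

Lemma ideal_sum I (J : Type) (r : seq J) (P : pred J) (F : J -> O) : is_ideal I ->
  (forall i, P i -> I (F i)) -> I (\sum_(i <- r | P i) F i).
Proof. by move=> [I0 ID _] H; elim/big_rec: _ => [//|i f /H]; apply: ID. Qed.

Definition basis_mod I (T : finType) (g : T -> O) :=
  (forall c : T -> C, I (\sum_t scalar (c t) * g t) -> forall t, c t = 0) /\
  (forall h, exists c : T -> C, I (h - \sum_t scalar (c t) * g t)).

(** More than #|T| elements are dependent modulo I: take a vector in the kernel of
    the matrix of their coordinates. *)
Lemma colength_basis I (T : finType) (g : T -> O) : is_ideal I -> basis_mod I g ->
  colength I = #|T|%:R%:E.
Proof.
move=> id [indep span]; apply/eqP; rewrite eq_le; apply/andP; split; last first.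
  apply: ereal_sup_ubound; exists #|T| => //; exists (fun i => g (enum_val i)) => c Ic i.
  have : I (\sum_t scalar (c (enum_rank t)) * g t).
    congr I: Ic; rewrite [RHS](reindex (@enum_val T T)) /=.
      by apply: eq_bigr => j _; rewrite enum_valK.
    by exists enum_rank => t _; rewrite ?enum_valK ?enum_rankK.
  by move=> /indep/(_ (enum_val i)); rewrite enum_valK.
apply: ge_ereal_sup => _ [n [v vind] <-]; rewrite lee_fin ler_nat leqNgt.
apply/negP => lt.
have /fin_all_exists[A AE] : forall i, exists c : T -> C,
  I (v i - \sum_t scalar (c t) * g t) by move=> i; apply: span.
pose M := \matrix_(i < n, j < #|T|) A i (enum_val j).
have : kermx M != 0.
  rewrite kermx_eq0 /row_free neq_ltn.
  by rewrite (leq_ltn_trans (rank_leq_col M) lt).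
move=> /rowV0Pn[u /sub_kermxP uM u0].
have : I (\sum_(i < n) scalar (u 0 i) * v i).
  have := @ideal_sum I _ _ predT (fun i : 'I_n => scalar (u 0 i) * (v i - \sum_t scalar (A i t) * g t)) id.
  move=> /(_ (index_enum _)) H.
  have {H}: I (\sum_(i < n) scalar (u 0 i) * (v i - \sum_t scalar (A i t) * g t)).
    by apply: H => i _; have [_ _ IM] := id; apply: IM.
  congr I; under eq_bigr do rewrite mulrBr.
  rewrite sumrB [X in _ - X](_ : _ = 0) ?subr0 //.
  under eq_bigr do rewrite mulr_sumr.
  rewrite exchange_big big1 //= => t _.
  under eq_bigr do rewrite mulrA -rmorphM.
  rewrite -mulr_suml -rmorph_sum.
  have := congr1 (fun B : 'rV_#|T| => B 0 (enum_rank t)) uM; rewrite !mxE => H.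
  rewrite (_ : \sum_i u 0 i * A i t = 0) ?rmorph0 ?mul0r // -[RHS]H.
  by apply: eq_bigr => i _; rewrite mxE enum_rankK.
move=> /vind uz; case/eqP: u0; apply/rowP => i.
by rewrite uz mxE.
Qed.

Lemma colength_infinite I : (forall n, exists v : 'I_n -> O, forall c : 'I_n -> C,
    I (\sum_(i < n) scalar (c i) * v i) -> forall i, c i = 0) -> colength I = +oo%E.
Proof.
move=> H; apply: eq_infty => r; have [n rn] : exists n : nat, r <= n%:R.
  by exists (Num.trunc `|r|).+1; apply: le_trans (ler_norm r) _; apply/ltW/truncnS_gt.
apply: le_trans (_ : (r%:E <= n%:R%:E)%E) _; first by rewrite lee_fin.
by apply: ereal_sup_ubound; exists n => //; apply: H.
Qed.

(** The term of least order dominates the sum. *)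
Lemma ordn_sum (T : finType) (w : T -> D) (c : T -> C) :
    (forall t, w t != 0) -> injective (fun t => ordn (w t)) -> (exists t, c t != 0) ->
  exists t, [/\ c t != 0, \sum_t fps_const (c t) * w t != 0
              & ordn (\sum_t fps_const (c t) * w t) = ordn (w t)].
Proof.
move=> w0 winj [t0 ct0]; have [t ct min] := @arg_minnP T t0 (fun t => c t != 0) (fun t => ordn (w t)) ct0.
exists t.
have [] := @ordn_eq _ (\sum_t fps_const (c t) * w t) (ordn (w t)); last by split.
  rewrite fps_sumE (bigD1 t) //= fps_const_mulE big1 ?addr0 ?mulf_neq0 ?(ordnP _).1 // => s st.
  rewrite fps_const_mulE; have [->|cs] := eqVneq (c s) 0; first by rewrite mul0r.
  rewrite (ordnP (w0 s)).2 ?mulr0 // ltn_neqAle min // andbT.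
  by apply: contra_neq st => /winj ->.
move=> i lt; rewrite fps_sumE big1 // => s _; rewrite fps_const_mulE.
have [->|cs] := eqVneq (c s) 0; first by rewrite mul0r.
by rewrite (ordnP (w0 s)).2 ?mulr0 // (leq_trans lt) ?min.
Qed.

End Colength.

Lemma subD_swap (V : zmodType) (h s u w : V) : h - (s + u) - w = h - s - w - u.
Proof. by rewrite opprD addrA -!addrA [- u - w]addrC. Qed.

Section Apery.
Variable K : realType.
Local Notation C := (complex K).
Local Notation D := (fps C).
Local Notation O := (formalring K).
Variables (a : O) (al : {rmorphism O -> D}).
Hypothesis arc : arc_of a al.
Implicit Types (f g h : O) (c : C).

Let lal : local_arc al. Proof. by case: arc. Qed.
Let ker f : al f = 0 <-> ideal1 a f. Proof. by case: arc => _ H _ _; apply: H. Qed.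

Lemma arc_Mge n f : Mge n f -> vge n (al f).
Proof.
elim: n f => [//|n IH] f /Mge_split[g [h [gn hn ->]]].
have v1 g0 : Mge 1 g0 -> vge 1 (al g0).
  by move=> g1 i; rewrite ltnS leqn0 => /eqP ->; apply: lal.2.
rewrite rmorphD !rmorphM -add1n; apply: vgeD; apply: vgeM; rewrite ?IH //.
- exact: v1 (@MgeX_var K).
- exact: IH.
- exact: v1 (@MgeY_var K).
exact: IH.
Qed.

(** The residue classes mod n met by the semigroup of orders along the arc. *)
Definition hit n (r : 'I_n) := `[< exists h, al h != 0 /\ (ordn (al h) %% n)%N = r >].
Definition nb_hit n := #|[pred r : 'I_n | hit r]|.

Section OneSeries.
Variable f : O.
Hypotheses (f1 : Mge 1 f) (f0 : al f != 0).
Let n := ordn (al f).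
Let n0 : (0 < n)%N. Proof. by rewrite ordn_gt0 //; apply/eqP/lal.2. Qed.
Let T := {r : 'I_n | hit r}.

Let apery_exists (t : T) : exists g, [/\ al g != 0, (ordn (al g) %% n)%N = val t
  & forall h, al h != 0 -> (ordn (al h) %% n)%N = val t -> (ordn (al g) <= ordn (al h))%N].
Proof.
have [h [h0 hr]] := asboolP _ (valP t).
pose P k := `[< exists h, [/\ al h != 0, (ordn (al h) %% n)%N = val t & ordn (al h) = k] >].
have exP : exists k, P k by exists (ordn (al h)); apply/asboolP; exists h.
have [k /asboolP[g [g0 gr gk]] min] := ex_minnP exP.
exists g; split=> // h' h'0 h'r; rewrite gk; apply: min.
by apply/asboolP; exists h'.
Qed.

Section AperySpan.
Variable g : T -> O.
Hypothesis g0 : forall t, al (g t) != 0.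
Hypothesis gr : forall t, (ordn (al (g t)) %% n)%N = val t.
Hypothesis gmin : forall (t : T) h, al h != 0 -> (ordn (al h) %% n)%N = val t ->
  (ordn (al (g t)) <= ordn (al h))%N.

(* The leading term of h, of order k, is cancelled by a multiple of the basis
   element g t of the same residue class; a power of f makes up the difference. *)
Let step k h : vge k (al h) -> exists u, vge k.+1 (al (h - u)) /\
  (u = 0 \/ exists t m c, u = scalar c * g t * f ^+ m /\ k = (ordn (al (g t)) + m * n)%N).
Proof.
move=> hk; have [z|nz] := eqVneq (al h k) 0.
  exists 0; split; last by left.
  by rewrite subr0 => i; rewrite ltnS leq_eqVlt => /orP[/eqP-> //|/hk].
have [h0 ho] := ordn_eq nz hk.
have hr : hit (Ordinal (ltn_pmod k n0)) by apply/asboolP; exists h; rewrite ho.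
pose t : T := exist (fun r : 'I_n => hit r) _ hr.
have le : (ordn (al (g t)) <= k)%N by rewrite -ho gmin // ho.
pose m := ((k - ordn (al (g t))) %/ n)%N.
have kE : k = (ordn (al (g t)) + m * n)%N.
  by rewrite /m divnK ?subnKC // -eqn_mod_dvd // gr.
pose w := al (g t * f ^+ m).
have w0 : w != 0 by rewrite /w rmorphM rmorphXn mulf_neq0 ?expf_neq0.
have wo : ordn w = k by rewrite /w rmorphM rmorphXn ordnM ?expf_neq0 // ordnX // -/n -kE.
have [wk wv] := ordnP w0; rewrite wo in wk wv.
exists (scalar (al h k / w k) * g t * f ^+ m); split; last by right; exists t, m, (al h k / w k).
have -> : al (h - scalar (al h k / w k) * g t * f ^+ m) = al h - fps_const (al h k / w k) * w.
  by rewrite -mulrA rmorphB rmorphM lal.1.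
move=> i; rewrite ltnS leq_eqVlt fpsBE fps_const_mulE => /orP[/eqP->|lt].
  by rewrite divfK // subrr.
by rewrite (hk i lt) (wv i lt) mulr0 subrr.
Qed.

Let span_upto k h : exists (c : T -> C) (h' : O), vge k (al (h - \sum_t scalar (c t) * g t - f * h')).
Proof.
elim: k => [|k [c [h' hk]]]; first by exists (fun=> 0 : C), 0.
have [u [uk [u0|[t [[|m] [d [uE _]]]]]]] := step hk.
- by exists c, h'; move: uk; rewrite u0 subr0.
- have [c' c'E] : exists c' : T -> C, forall s, c' s = c s + (if s == t then d else 0) by eexists.
  have S : \sum_s scalar (c' s) * g s = \sum_t scalar (c t) * g t + u.
    transitivity (\sum_s (scalar (c s) * g s + (if s == t then u else 0))).
      apply: eq_bigr => s _; rewrite c'E rmorphD mulrDl; congr (_ + _).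
      by case: eqP => [->|_]; [rewrite uE expr0 mulr1|rewrite rmorph0 mul0r].
    by rewrite big_split -big_mkcond big_pred1_eq.
  exists c', h'; suff -> : h - \sum_s scalar (c' s) * g s - f * h'
    = h - \sum_t scalar (c t) * g t - f * h' - u by exact: uk.
  exact: etrans (congr1 (fun z => h - z - f * h') S) (subD_swap _ _ _ _).
exists c, (h' + scalar d * g t * f ^+ m).
suff -> : h - \sum_s scalar (c s) * g s - f * (h' + scalar d * g t * f ^+ m)
  = h - \sum_t scalar (c t) * g t - f * h' - u by exact: uk.
by rewrite uE exprS; ring.
Qed.

Let V := (\sum_t ordn (al (g t)))%N.
Let Vge t : (ordn (al (g t)) <= V)%N. Proof. by rewrite /V (bigD1 t) //= leq_addr. Qed.

(* Beyond V the power of f used by the cancellation is large, so that the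
   cofactor of f lies in a high power of the maximal ideal. *)
Let divide_step e h : vge (V + n * e.+1) (al h) ->
  exists u, Mge e u /\ vge (V + n * e.+2) (al (h - f * u)).
Proof.
move=> hk.
have H j : exists u, Mge e u /\ vge (V + n * e.+1 + j) (al (h - f * u)).
  elim: j => [|j [u [ue uj]]].
    by exists 0; split; [exact: Mge0|rewrite mulr0 subr0 addn0].
  have [v [vj [v0|[t [m [d [vE kE]]]]]]] := step uj.
    by exists u; split=> //; move: vj; rewrite v0 subr0 addnS.
  have me : (e < m)%N.
    have := Vge t; rewrite -(ltn_pmul2l n0) => Vt.
    by move: kE; rewrite mulnS; nia.
  exists (u + scalar d * g t * f ^+ m.-1); split.
    apply: MgeD => //; apply: MgeMl; apply: MgeW (MgeX1 f1).
    by rewrite -ltnS prednK // (leq_ltn_trans _ me).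
  rewrite addnS; suff -> : h - f * (u + scalar d * g t * f ^+ m.-1) = h - f * u - v by exact: vj.
  by rewrite vE -{2}(prednK (leq_ltn_trans (leq0n e) me)) exprS; ring.
by have [u [ue un]] := H n; exists u; split=> //; move: un; rewrite -addnA -mulnSr.
Qed.

(* The successive cofactors of f converge. *)
Let divide_large h : vge (V + n) (al h) -> ideal2 a f h.
Proof.
move=> hV.
have /choice[nx nxP] : forall eh : nat * O, exists u, vge (V + n * eh.1.+1) (al eh.2) ->
    Mge eh.1 u /\ vge (V + n * eh.1.+2) (al (eh.2 - f * u)).
  move=> [e h0]; have [H|H] := pselect (vge (V + n * e.+1) (al h0)); last by exists 0.
  by have [u uP] := divide_step H; exists u.
pose H e := iteri e (fun e h0 => h0 - f * nx (e, h0)) h.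
have HE e : H e.+1 = H e - f * nx (e, H e) by [].
have HV e : vge (V + n * e.+1) (al (H e)).
  elim: e => [|e IH]; first by rewrite muln1.
  exact: (nxP (e, H e) IH).2.
pose u e := nx (e, H e).
have ue e : Mge e (u e) by apply: (nxP (e, H e) (HV e)).1.
have sumE e : h - f * (\sum_(k < e) u k) = H e.
  elim: e => [|e IH]; first by rewrite big_ord0 mulr0 subr0.
  by rewrite big_ord_recr /= mulrDr opprD addrA IH.
have : al (h - f * fsum u) = 0.
  apply: vge_all => e.
  have -> : h - f * fsum u = H e - f * (fsum u - \sum_(k < e) u k) by rewrite -sumE; ring.
  rewrite rmorphB; apply: vgeD; first by apply: vgeW (HV e); nia.
  have M : Mge e (f * (fsum u - \sum_(k < e) u k)) by apply: MgeMl; apply: fsumP.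
  by move=> i lt; rewrite fpsNE (arc_Mge M) ?oppr0.
by move=> /ker[q qE]; exists q, (fsum u); rewrite -qE mulrC; ring.
Qed.

Lemma apery_basis_mod : basis_mod (ideal2 a f) g.
Proof.
split=> [c [p [q E]]|h]; last first.
  have [c [h' H]] := span_upto (V + n) h; exists c.
  have [_ ID _] := ideal2_ideal a f.
  rewrite -[_ - _](subrK (f * h')); apply: ID; first exact: divide_large.
  by exists 0, h'; ring.
apply: contrapT => /existsNP[t0 /eqP ct0].
have aw : al (\sum_t scalar (c t) * g t) = \sum_t fps_const (c t) * al (g t).
  by rewrite rmorph_sum; apply: eq_bigr => t _; rewrite rmorphM lal.1.
have inj : injective (fun t => ordn (al (g t))).
  by move=> s t st; apply/val_inj/val_inj; rewrite /= -gr st gr.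
have [t [ct s0 so]] := ordn_sum g0 inj (ex_intro _ t0 ct0).
have az : al a = 0 by apply/ker; exists 1; rewrite mul1r.
have E' : \sum_t fps_const (c t) * al (g t) = al q * al f.
  by rewrite -aw E rmorphD !rmorphM az mulr0 add0r.
have q0 : al q != 0 by apply: contraNneq s0; rewrite E' => ->; rewrite mul0r.
have qo : (ordn (al (g t)) = ordn (al q) + n)%N by rewrite -so E' ordnM.
have := @gmin t q q0; rewrite -gr qo modnDr => /(_ erefl).
by rewrite -[X in (_ <= X)%N]addn0 leq_add2l leqNgt n0.
Qed.
End AperySpan.

(** The orders along the arc form a numerical semigroup containing n, the order
    of f. Elements whose orders are the least ones in their residue classes
    mod n form a basis of the quotient by f: larger orders are reached by
    multiplying them by powers of f. In particular the intersection number only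
    depends on n. *)
Lemma apery_basis : exists (S : finType) (b : S -> O), basis_mod (ideal2 a f) b /\ #|S| = nb_hit n.
Proof.
have /choice[g gP] := apery_exists.
exists T, g; split; last by rewrite card_sig.
by apply: apery_basis_mod => [t|t|t h]; have [] := gP t => // _ _; apply.
Qed.

End OneSeries.
End Apery.

Section Intersection.
Variable K : realType.
Local Notation C := (complex K).
Local Notation D := (fps C).
Local Notation O := (formalring K).
Implicit Types (f g h a : O) (c : C).

Definition cat_basis f (T T' : finType) (g : T -> O) (g' : T' -> O) (s : T + T') : O :=
  match s with inl t => g t | inr t => f * g' t end.

Lemma cat_basis_sum f (T T' : finType) (g : T -> O) (g' : T' -> O) (c : T + T' -> C) :
  \sum_s scalar (c s) * cat_basis f g g' s =
  \sum_t scalar (c (inl t)) * g t + f * \sum_t scalar (c (inr t)) * g' t.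
Proof.
rewrite big_sumType; congr (_ + _); rewrite [RHS]mulr_sumr.
by apply: eq_bigr => t _; apply: mulrCA.
Qed.

(** The exact sequence 0 -> O/(a, f') -> O/(a, f f') -> O/(a, f) -> 0, where
    multiplication by f is injective because f does not vanish on the branch. *)
Lemma basis_mod_product a f f' (al : {rmorphism O -> D}) (T T' : finType)
    (g : T -> O) (g' : T' -> O) : arc_of a al -> al f != 0 ->
    basis_mod (ideal2 a f) g -> basis_mod (ideal2 a f') g' ->
  basis_mod (ideal2 a (f * f')) (cat_basis f g g').
Proof.
move=> [_ ker _ _] f0 [ind span] [ind' span']; split=> [c|h].
  rewrite cat_basis_sum => -[p [q]].
  have [A AE] : exists A, A = \sum_t scalar (c (inl t)) * g t by eexists.
  have [B BE] : exists B, B = \sum_t scalar (c (inr t)) * g' t by eexists.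
  rewrite -AE -BE => E.
  have cl : forall t, c (inl t) = 0.
    apply: ind; rewrite -AE; exists p, (q * f' - B).
    by rewrite -[A](addrK (f * B)) E; ring.
  have A0 : A = 0 by rewrite AE big1 // => t _; rewrite cl rmorph0 mul0r.
  have : al f * al (B - q * f') = 0.
    rewrite -rmorphM; apply/ker; exists p.
    have -> : f * (B - q * f') = A + f * B - q * (f * f') by rewrite A0; ring.
    by rewrite E; ring.
  move/eqP; rewrite mulf_eq0 (negbTE f0) => /eqP/ker[r rE].
  have cr : forall t, c (inr t) = 0.
    by apply: ind'; exists r, q; rewrite -BE -rE subrK.
  by case.
have [c [p [q E]]] := span h; have [c' [p' [q' E']]] := span' q.
have [cc [ccl ccr]] : exists cc : T + T' -> C,
    (forall t, cc (inl t) = c t) /\ (forall t, cc (inr t) = c' t).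
  by exists (fun s => match s with inl t => c t | inr t => c' t end).
exists cc; rewrite cat_basis_sum; exists (p + f * p'), q'.
rewrite (eq_bigr (fun t => scalar (c t) * g t)) => [|t _]; last by rewrite ccl.
rewrite (eq_bigr (fun t => scalar (c' t) * g' t)) => [|t _]; last by rewrite ccr.
move: E E'; move: (\sum_t _) (\sum_t _) => B A E E'.
have -> : h - (A + f * B) = (h - A) - f * q + f * (q - B) by ring.
by rewrite E E'; ring.
Qed.

Section Along.
Variables (a : O) (al : {rmorphism O -> D}).
Hypothesis arc : arc_of a al.

Let lal : local_arc al. Proof. by case: arc. Qed.
Let ker f : al f = 0 <-> ideal1 a f. Proof. by case: arc => _ H _ _; apply: H. Qed.

Lemma internum_nb_hit f : Mge 1 f -> al f != 0 ->
  internum a f = (nb_hit al (ordn (al f)))%:R%:E.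
Proof.
move=> f1 f0; have [T [g [bg cT]]] := apery_basis arc f1 f0.
by rewrite -cT; apply: colength_basis bg; apply: ideal2_ideal.
Qed.

Lemma nb_hitD f f' : Mge 1 f -> al f != 0 -> Mge 1 f' -> al f' != 0 ->
  nb_hit al (ordn (al f) + ordn (al f')) = (nb_hit al (ordn (al f)) + nb_hit al (ordn (al f')))%N.
Proof.
move=> f1 f0 f'1 f'0; have [T [g [bg cT]]] := apery_basis arc f1 f0.
have [T' [g' [bg' cT']]] := apery_basis arc f'1 f'0.
have := colength_basis (ideal2_ideal a (f * f')) (basis_mod_product arc f0 bg bg').
rewrite -[colength _]/(internum a (f * f')) internum_nb_hit.
- rewrite rmorphM ordnM // card_sum cT cT' => /eqP.
  by rewrite eqe eqr_nat => /eqP.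
- by apply: MgeMl.
by rewrite rmorphM mulf_neq0.
Qed.

Lemma nb_hit_gt0 n : (0 < n)%N -> (0 < nb_hit al n)%N.
Proof.
move=> n0; apply/card_gt0P; exists (Ordinal n0); rewrite inE; exists 1.
by rewrite rmorph1 ordn1 mod0n oner_neq0.
Qed.

Lemma nb_hit1 : nb_hit al 1 = 1%N.
Proof.
apply/eqP; rewrite eqn_leq nb_hit_gt0 // andbT.
by apply: leq_trans (max_card _) _; rewrite card_ord.
Qed.

Lemma nb_hitX f m : Mge 1 f -> al f != 0 ->
  nb_hit al (m.+1 * ordn (al f)) = (m.+1 * nb_hit al (ordn (al f)))%N.
Proof.
move=> f1 f0; elim: m => [|m IH]; first by rewrite !mul1n.
have fm : Mge 1 (f ^+ m.+1) by rewrite exprS; apply: MgeMr.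
have fm0 : al (f ^+ m.+1) != 0 by rewrite rmorphXn expf_neq0.
rewrite mulSn [RHS]mulSn -IH -[X in (_ + X)%N](ordnX m.+1 f0) -rmorphXn.
by rewrite nb_hitD // rmorphXn ordnX.
Qed.

(** Powers of z and f have a common order, for which the two counts agree: the
    count is proportional to the order. *)
Lemma nb_hit_prop z f : Mge 1 z -> al z != 0 -> Mge 1 f -> al f != 0 ->
  (ordn (al z) * nb_hit al (ordn (al f)) = ordn (al f) * nb_hit al (ordn (al z)))%N.
Proof.
move=> z1 z0 f1 f0.
have pos h : Mge 1 h -> al h != 0 -> exists m, ordn (al h) = m.+1.
  move=> h1 h0; exists (ordn (al h)).-1; rewrite prednK // ordn_gt0 //.
  by apply/eqP/lal.2.
have [m mE] := pos z z1 z0; have [k kE] := pos f f1 f0.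
have := nb_hitX m f1 f0; have := nb_hitX k z1 z0.
by rewrite mE kE mulnC => -> ->.
Qed.

Local Open Scope ereal_scope.

Definition arc_ord f : \bar K := if al f == 0%R then +oo else (ordn (al f))%:R%:E.

(** The factor is the proportion of residue classes met by the orders along the
    arc, that is the inverse of the degree of the arc over the branch. *)
Lemma internum_arc_at z : Mge 1 z -> al z != 0%R -> forall f,
  internum a f = ((nb_hit al (ordn (al z)))%:R / (ordn (al z))%:R)%:E * arc_ord f.
Proof.
move=> z1 z0 f.
have oz : (0 < ordn (al z))%N by rewrite ordn_gt0 //; apply/eqP/lal.2.
have k0 : (0 < (nb_hit al (ordn (al z)))%:R / (ordn (al z))%:R :> K)%R.
  by rewrite divr_gt0 // ltr0n // nb_hit_gt0.
rewrite /arc_ord; have [af|af] := eqVneq (al f) 0%R.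
  rewrite gt0_muley ?lte_fin //; apply: colength_infinite => n.
  exists (fun i => z ^+ i)%R => c [p [q E]] i; apply/eqP; apply: contraT => ci.
  have az : al a = 0%R by apply/ker; exists 1%R; rewrite mul1r.
  have inj : injective (fun i : 'I_n => ordn (al (z ^+ i)%R)).
    move=> j l; rewrite !rmorphXn !ordnX // => /eqP.
    by rewrite eqn_pmul2r // => /eqP/val_inj.
  have nz (j : 'I_n) : al (z ^+ j)%R != 0%R by rewrite rmorphXn expf_neq0.
  have [t [_ + _]] := ordn_sum nz inj (ex_intro _ i ci).
  have <- : al (\sum_(i < n) scalar (c i) * z ^+ i)%R = (\sum_t fps_const (c t) * al (z ^+ t))%R.
    by rewrite rmorph_sum; apply: eq_bigr => j _; rewrite rmorphM lal.1.
  by rewrite E rmorphD !rmorphM az af !mulr0 addr0 eqxx.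
have [f1|uf] := pselect (Mge 1 f).
  rewrite internum_nb_hit // -EFinM; congr EFin.
  apply: (mulfI (_ : (ordn (al z))%:R != 0 :> K)%R); first by rewrite pnatr_eq0 -lt0n.
  rewrite -natrM nb_hit_prop // mulrA [RHS](_ : _ = (nb_hit al (ordn (al z)))%:R * (ordn (al f))%:R)%R.
    by rewrite -natrM mulnC.
  by congr (_ * _)%R; rewrite mulrCA divff ?mulr1 // pnatr_eq0 -lt0n.
have {}uf : f \is a GRing.unit by apply: contra_notT uf => /nunitO.
have -> : ordn (al f) = 0%N.
  apply/eqP; rewrite -leqn0 leqNgt ordn_gt0 // -unitfE -fps_unitE.
  by rewrite rmorph_unit.
have full h : ideal2 a f h by exists 0%R, (h / f)%R; rewrite mul0r add0r divrK.
rewrite mule0; apply: (etrans (colength_basis (T := 'I_0) (g := fun=> 0%R) (ideal2_ideal a f) _)).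
  by split=> [c _ []|h] //; exists (fun=> 0%R).
by rewrite card_ord.
Qed.

Lemma arc_ordM f g : arc_ord (f * g)%R = arc_ord f + arc_ord g.
Proof.
rewrite /arc_ord rmorphM mulf_eq0; have [f0|f0] := eqVneq (al f) 0%R; first by case: eqP.
by have [g0|g0] := eqVneq (al g) 0%R; rewrite //= ordnM // natrD.
Qed.

Lemma arc_ordD f g : mine (arc_ord f) (arc_ord g) <= arc_ord (f + g)%R.
Proof.
rewrite /arc_ord; have [fg|fg] := eqVneq (al (f + g)%R) 0%R; first exact: leey.
have [f0|f0] := eqVneq (al f) 0%R.
  by rewrite rmorphD f0 add0r ge_min; case: eqP => [|_]; rewrite ?lexx ?orbT // => g0; case/eqP: fg; rewrite rmorphD f0 g0 addr0.
have [g0|g0] := eqVneq (al g) 0%R.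
  by rewrite rmorphD g0 addr0 ge_min lexx.
rewrite ge_min !lee_fin !ler_nat.
have [le|lt] := leqP (ordn (al f)) (ordn (al (f + g)%R)); first by [].
rewrite /= leqNgt; apply/negP => lt'; have [fgo _] := ordnP fg; case/eqP: fgo.
by rewrite {1}rmorphD fpsDE (ordnP f0).2 // (ordnP g0).2 // addr0.
Qed.

Lemma arc_ord_ge0 f : 0 <= arc_ord f.
Proof. by rewrite /arc_ord; case: ifP => // _; rewrite lee_fin. Qed.

Lemma arc_ord_unit f : f \is a GRing.unit -> arc_ord f = 0.
Proof.
move=> uf; have ua : al f \is a GRing.unit by apply: rmorph_unit.
have a0 : al f != 0%R by apply: contraTneq ua => ->; rewrite unitr0.
suff o0 : ordn (al f) = 0%N by rewrite /arc_ord (negbTE a0) o0.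
by apply/eqP; rewrite -leqn0 leqNgt ordn_gt0 // -unitfE -fps_unitE.
Qed.

Lemma internum_scale : exists2 k : K, (0 < k)%R & forall f, internum a f = k%:E * arc_ord f.
Proof.
have [_ _ _ [z z1 z0]] := arc.
exists ((nb_hit al (ordn (al z)))%:R / (ordn (al z))%:R)%R; last exact: internum_arc_at.
have oz : (0 < ordn (al z))%N by rewrite ordn_gt0 //; apply/eqP/lal.2.
by rewrite divr_gt0 // ltr0n // nb_hit_gt0.
Qed.

Lemma arc_internum_sv : semivaluation (internum a).
Proof.
have [k k0 kE] := internum_scale.
split=> [f|f g|f g|c c0|]; rewrite ?kE.
- by rewrite mule_ge0 ?arc_ord_ge0 // lee_fin ltW.
- by rewrite arc_ordM ge0_muleDr ?arc_ord_ge0.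
- rewrite -mine_pMr //; last by rewrite lee_fin ltW.
  by rewrite lee_pmul2l ?lte_fin //; apply: arc_ordD.
- have u : scalar c \is a GRing.unit by rewrite unitO scalarE.
  by rewrite arc_ord_unit // mule0.
by rewrite /arc_ord rmorph0 eqxx gt0_muley ?lte_fin.
Qed.

End Along.
End Intersection.

(** * Monomial valuations *)

Section Monomial.
Variable K : realType.
Local Notation C := (complex K).
Local Notation O := (formalring K).
Implicit Types (f g h : O) (c : C) (mu nu : O -> \bar K).

Definition normal mu := semivaluation mu /\ val_ideal mu (@maxideal K) = 1%E.

Variable s : K.
Hypothesis s1 : 1 <= s.

Definition wt (i j : nat) : K := i%:R + s * j%:R.

Lemma wtD i j k l : wt (i + k) (j + l) = wt i j + wt k l.
Proof. by rewrite /wt !natrD; ring. Qed.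
Lemma wt_ge i j : (i + j)%:R <= wt i j.
Proof. by rewrite /wt natrD lerD2l ler_peMl. Qed.
Lemma wtI i i' j : wt i j = wt i' j -> i = i'.
Proof. by move=> /addIr/eqP; rewrite eqr_nat => /eqP. Qed.

(** The monomial valuation with weights 1 and s on the two variables. *)
Definition mono f : \bar K :=
  ereal_inf [set (wt ij.1 ij.2)%:E | ij in [set ij : nat * nat | f ij.2 ij.1 != 0]].

Lemma mono_le_coef f i j : f j i != 0 -> (mono f <= (wt i j)%:E)%E.
Proof. by move=> fji; apply: ereal_inf_lbound; exists (i, j). Qed.

Lemma mono_ge f x : (forall i j, f j i != 0 -> (x <= (wt i j)%:E)%E) -> (x <= mono f)%E.
Proof. by move=> H; apply: le_ereal_inf_tmp => _ [[i j] /= fji <-]; apply: H. Qed.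

Lemma mono0 : mono 0 = +oo%E.
Proof. by apply/eqP; rewrite eq_le leey; apply: mono_ge => i j; rewrite !fps0E eqxx. Qed.

(** Ties in weight are broken by the degree in y: the leading term is then unique,
    hence multiplicative. *)
Definition lead f i j := f j i != 0 /\
  forall i' j', f j' i' != 0 -> wt i j < wt i' j' \/ (wt i j = wt i' j' /\ (j <= j')%N).

Lemma lead_exists f : f != 0 -> exists i j, lead f i j.
Proof.
move=> f0.
have [j [i fji]] : exists j i, f j i != 0.
  apply/not_existsP => H; case/eqP: f0; apply: fps2_eq0 => j i.
  by apply/eqP; apply: contrapT => fji; apply: (H j); exists i; apply/negP.
pose n := (Num.trunc (wt i j)).+1.
have box k l : wt k l <= wt i j -> (k < n)%N /\ (l < n)%N.
  move=> le; have : (k + l)%:R < n%:R :> K.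
    apply: le_lt_trans (wt_ge k l) (le_lt_trans le _); exact: truncnS_gt.
  by rewrite ltr_nat; lia.
have [im jn] := box i j (lexx _).
pose F (p : 'I_n * 'I_n) := wt p.1 p.2.
have [[i1 j1] /= f1 min] := @Order.TotalTheory.arg_minP _ _ _ (Ordinal im, Ordinal jn)
  (fun p : 'I_n * 'I_n => f p.2 p.1 != 0) F fji.
have min1 k l : f l k != 0 -> wt i1 j1 <= wt k l.
  move=> fkl; have [le|lt] := leP (wt k l) (wt i j).
    have [kn ln] := box k l le; exact: (min (Ordinal kn, Ordinal ln) fkl).
  apply: le_trans (ltW lt); exact: (min (Ordinal im, Ordinal jn) fji).
pose P l := `[< exists k, f l k != 0 /\ wt k l = wt i1 j1 >].
have exP : exists l, P l by exists j1; apply/asboolP; exists i1.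
have [l /asboolP[k [fkl kl]] lmin] := ex_minnP exP.
exists k, l; split=> // i' j' f'.
have := min1 i' j' f'; rewrite kl le_eqVlt => /orP[/eqP E|]; last by left.
by right; split=> //; apply: lmin; apply/asboolP; exists i'.
Qed.

Lemma mono_lead f i j : lead f i j -> mono f = (wt i j)%:E.
Proof.
move=> [fji H]; apply/eqP; rewrite eq_le mono_le_coef // mono_ge // => k l /H.
by rewrite lee_fin => -[/ltW|[-> _]].
Qed.

Lemma coef2_neq0 f g j i : (f * g) j i != 0 -> exists a b,
  [/\ (a <= j)%N, (b <= i)%N, f a b != 0 & g (j - a)%N (i - b)%N != 0].
Proof.
move=> fg; apply: contrapT => H; case/eqP: fg; rewrite fps2ME big1 // => a _.
rewrite big1 // => b _; apply/eqP; rewrite mulf_eq0; apply: contrapT => /negP.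
rewrite negb_or => /andP[fa gb]; apply: H; exists a, b.
by split=> //; rewrite -ltnS ltn_ord.
Qed.

Lemma lead_mul f g i j k l : lead f i j -> lead g k l -> lead (f * g) (i + k)%N (j + l)%N.
Proof.
move=> [fji fmin] [glk gmin]; split.
  have jl : (j < (j + l).+1)%N by rewrite ltnS leq_addr.
  have ik : (i < (i + k).+1)%N by rewrite ltnS leq_addr.
  have other a b : (a <= j + l)%N -> (b <= i + k)%N ->
      f a b * g (j + l - a)%N (i + k - b)%N != 0 -> a = j /\ b = i.
    move=> aj bi; rewrite mulf_eq0 negb_or => /andP[/fmin fab /gmin gab].
    have W : wt b a + wt (i + k - b) (j + l - a) = wt i j + wt k l by rewrite -!wtD !subnKC.
    have aE : a = j by case: fab gab => [?|[? ?]] [?|[? ?]]; [exfalso; lra|exfalso; lra|exfalso; lra|lia].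
    split=> //; apply: (@wtI b i j); rewrite aE in fab gab W.
    by case: fab gab => [?|[? ?]] [?|[? ?]]; lra.
  rewrite fps2ME (bigD1 (Ordinal jl)) //= (bigD1 (Ordinal ik)) //=.
  rewrite big1 => [|b bi]; last first.
    apply/eqP; apply: contraNT bi => ne.
    have [_ bE] := other j b (leq_addr l j) (ltn_ord b) ne; exact/eqP/val_inj.
  rewrite addr0 big1 ?addr0 => [|a aj]; first by rewrite !addKn mulf_neq0.
  rewrite big1 // => b _; apply/eqP; apply: contraNT aj => ne.
  have [aE _] := other a b (ltn_ord a) (ltn_ord b) ne; exact/eqP/val_inj.
move=> i' j' /coef2_neq0[a [b [aj bi /fmin fa /gmin gb]]].
have W : wt b a + wt (i' - b) (j' - a) = wt i' j' by rewrite -!wtD !subnKC.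
rewrite wtD; case: fa gb => [?|[? ?]] [?|[? ?]]; [left; lra..|right].
by split; [lra|lia].
Qed.

Lemma mono_ge0 f : (0 <= mono f)%E.
Proof. by apply: mono_ge => i j _; rewrite lee_fin (le_trans _ (wt_ge i j)). Qed.

Lemma mono_sv : semivaluation mono.
Proof.
split=> [f|f g|f g|c c0|]; last exact: mono0.
- exact: mono_ge0.
- have Ny h : mono h != -oo%E by rewrite -ltNye (lt_le_trans _ (mono_ge0 h)) // ltNy0.
  have [->|f0] := eqVneq f 0; first by rewrite mul0r mono0 addye.
  have [->|g0] := eqVneq g 0; first by rewrite mulr0 mono0 addey.
  have [i [j lf]] := lead_exists f0; have [k [l lg]] := lead_exists g0.
  by rewrite (mono_lead (lead_mul lf lg)) (mono_lead lf) (mono_lead lg) wtD.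
- apply: mono_ge => i j; rewrite !fpsDE => fg; rewrite ge_min.
  have [fji|fji] := eqVneq (f j i) 0; last by rewrite mono_le_coef.
  by apply/orP; right; apply: mono_le_coef; rewrite fji add0r in fg.
have l : lead (scalar c) 0 0.
  split=> [|i j]; rewrite scalarE //.
  case: ifP => [/andP[/eqP-> /eqP->] _|_ /eqP //]; by right.
by rewrite (mono_lead l) /wt mulr0 addr0.
Qed.

Lemma mono_varX : mono varX = 1%E.
Proof.
have l : lead varX 1 0.
  have E j i : varX j i = if (i == 1%N) && (j == 0%N) then 1 else 0 :> C.
    by rewrite -(monomialE 1) rmorph1 mul1r mulr1.
  split=> [|i j]; rewrite E ?oner_eq0 //.
  by case: ifP => [/andP[/eqP-> /eqP->] _|_ /eqP //]; right.
by rewrite (mono_lead l) /wt mulr0 addr0.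
Qed.

Lemma mono_varY : mono varY = s%:E.
Proof.
have l : lead varY 0 1.
  have E j i : varY j i = if (i == 0%N) && (j == 1%N) then 1 else 0 :> C.
    by rewrite -(monomialE 1) rmorph1 mul1r mul1r.
  split=> [|i j]; rewrite E ?oner_eq0 //.
  by case: ifP => [/andP[/eqP-> /eqP->] _|_ /eqP //]; right.
by rewrite (mono_lead l) /wt mulr1 add0r.
Qed.

Lemma mono_normal : normal mono.
Proof.
split; first exact: mono_sv.
by rewrite (sv_M mono_sv) mono_varX mono_varY; apply/min_idPl; rewrite lee_fin.
Qed.

Lemma normalX mu : normal mu -> (1 <= mu varX)%E.
Proof. by move=> [sv M]; have := le_refl (1%E : \bar K); rewrite -{2}M sv_M // le_min => /andP[]. Qed.
Lemma normalY mu : normal mu -> (1 <= mu varY)%E.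
Proof. by move=> [sv M]; have := le_refl (1%E : \bar K); rewrite -{2}M sv_M // le_min => /andP[]. Qed.
Lemma normal_Mge mu n f : normal mu -> Mge n f -> (n%:R%:E <= mu f)%E.
Proof. by move=> [sv M]; apply: sv_Mge; rewrite // M. Qed.

Lemma truncP2 n f : Mge n (f - \sum_(p : 'I_n * 'I_n) scalar (f p.1 p.2) * (varX ^+ p.2 * varY ^+ p.1)).
Proof.
have := @truncP K n f.
by rewrite (pair_bigA _ (fun j i : 'I_n => scalar (f j i) * (varX ^+ i * varY ^+ j))).
Qed.

Lemma sv_monomial mu c i j : semivaluation mu -> c != 0 ->
  mu (scalar c * (varX ^+ i * varY ^+ j)) = (i%:R%:E * mu varX + j%:R%:E * mu varY)%E.
Proof. by move=> sv c0; rewrite !svM // sv_scalar // add0e !svX. Qed.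

(** Each monomial has value at least its weight. *)
Lemma mono_min mu f : normal mu -> (s%:E <= mu varY)%E -> (mono f <= mu f)%E.
Proof.
move=> nmu sY; have [sv _] := nmu; have [->|f0] := eqVneq f 0; first by rewrite (sv0 sv) leey.
have [i0 [j0 lf]] := lead_exists f0; rewrite (mono_lead lf).
pose n := (Num.trunc (wt i0 j0)).+1.
rewrite -(subrK (\sum_(p : 'I_n * 'I_n) scalar (f p.1 p.2) * (varX ^+ p.2 * varY ^+ p.1)) f).
apply: svD_ge => //.
  apply: le_trans (normal_Mge nmu (truncP2 f)); rewrite lee_fin; apply: ltW; exact: truncnS_gt.
apply: sv_sum_ge => // -[j i] _ /=.
have [->|fji] := eqVneq (f j i) 0; first by rewrite rmorph0 mul0r (sv0 sv) leey.
rewrite sv_monomial //; apply: (@le_trans _ _ (wt i j)%:E).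
  by rewrite lee_fin; case: (lf.2 i j fji) => [/ltW|[-> _]].
rewrite /wt EFinD; apply: leeD.
  by rewrite -[leLHS]mule1 lee_wpmul2l ?normalX.
by rewrite mulrC EFinM lee_wpmul2l.
Qed.

(** If mu f exceeds the weight of f, then the initial form of f has too large a
    value for mu. Divide it by its power of y: the value of the quotient is too
    large for mu, hence for nu; but nu has a larger value than mu on y, so that
    it sees only the term of least degree in y, where its value is the expected
    one. *)
Lemma mono_max mu nu f : normal mu -> normal nu -> (forall f, mu f <= nu f)%E ->
  mu varY = s%:E -> (s%:E < nu varY)%E -> (mu f <= mono f)%E.
Proof.
move=> nmu nnu le muY nuY; have [sv M] := nmu; have [sv' M'] := nnu.
have nuX : nu varX = 1%E.
  move: M'; rewrite sv_M // /Order.min; case: ifP => // _ E.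
  by move: nuY; rewrite E lte_fin ltNge s1.
have muX : mu varX = 1%E by apply/eqP; rewrite eq_le normalX // andbT -nuX le.
have [->|f0] := eqVneq f 0; first by rewrite mono0 leey.
have [i0 [j0 [f00 lf]]] := lead_exists f0; rewrite (mono_lead (conj f00 lf)).
set w := wt i0 j0; rewrite leNgt; apply/negP => wf.
pose n := (Num.trunc w).+1.
have wn : w < n%:R by exact: truncnS_gt.
have [jn im] : (j0 < n)%N /\ (i0 < n)%N.
  have : (i0 + j0)%:R < n%:R :> K by apply: le_lt_trans wn; apply: wt_ge.
  by rewrite ltr_nat; lia.
pose F (p : 'I_n * 'I_n) := scalar (f p.1 p.2) * (varX ^+ p.2 * varY ^+ p.1).
(* the indices of the initial form *)
pose In (p : 'I_n * 'I_n) := (f p.1 p.2 != 0) && (wt p.2 p.1 == w).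
have muF p : ~~ In p -> (w%:E < mu (F p))%E.
  rewrite /F; have [->|fp] := eqVneq (f p.1 p.2) 0; first by rewrite rmorph0 mul0r (sv0 sv) ltry.
  rewrite /In fp /= sv_monomial // muX muY mule1 -EFinM -EFinD lte_fin [_ * s]mulrC => ne.
  case: (lf _ _ fp) => [//|[E _]]; by rewrite /w E eqxx in ne.
have muH : (w%:E < mu (\sum_(p | In p) F p)%R)%E.
  have -> : \sum_(p | In p) F p = f - (f - \sum_p F p) - \sum_(p | ~~ In p) F p.
    by rewrite [\sum_p F p](bigID In) /=; ring.
  apply: svB_gt => //; last by apply: sv_sum_gt; rewrite ?ltry.
  apply: svB_gt => //; apply: lt_le_trans (normal_Mge nmu (truncP2 f)).
  by rewrite lte_fin.
pose G (p : 'I_n * 'I_n) := scalar (f p.1 p.2) * (varX ^+ p.2 * varY ^+ (p.1 - j0)).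
have FG : \sum_(p | In p) F p = varY ^+ j0 * \sum_(p | In p) G p.
  rewrite mulr_sumr; apply: eq_bigr => p /andP[fp /eqP wp]; rewrite /F /G.
  have jp : (j0 <= p.1)%N by case: (lf _ _ fp) => [|[]//]; rewrite -/w -wp ltxx.
  have -> : varY ^+ p.1 = varY ^+ (p.1 - j0) * varY ^+ j0 :> O by rewrite -exprD subnK.
  by ring.
have nuH : (i0%:R%:E < nu (\sum_(p | In p) G p)%R)%E.
  apply: lt_le_trans (le _); move: muH; rewrite FG svM // svX // muY -EFinM /w /wt.
  by rewrite [s * _]mulrC addrC EFinD lteD2lE.
pose p0 := (Ordinal jn, Ordinal im).
have Ip0 : In p0 by rewrite /In /= f00 eqxx.
have : (i0%:R%:E < nu (G p0))%E.
  have -> : G p0 = \sum_(p | In p) G p - \sum_(p | In p && (p != p0)) G p.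
    by rewrite [\sum_(p | In p) G p](bigD1 p0) //=; ring.
  apply: svB_gt => //; apply: sv_sum_gt; rewrite ?ltry // => -[j i] /andP[/andP[/= fp /eqP wp] ne].
  rewrite /G sv_monomial //= nuX mule1.
  have jp : (j0 < j)%N.
    case: (lf _ _ fp) => [|[_]]; first by rewrite -/w -wp ltxx.
    rewrite leq_eqVlt => /orP[/eqP jE|//]; case/eqP: ne.
    have iE : i0 = i by apply: (@wtI i0 i j0); rewrite -/w -wp -jE.
    by congr pair; apply: val_inj.
  have E : i0%:R = i%:R + s * (j - j0)%:R :> K.
    by rewrite natrB ?(ltnW jp) // mulrBr addrA -/(wt i j) wp /w /wt addrK.
  rewrite E EFinD lteD2lE // mulrC EFinM lte_pmul2l // lte_fin ltr0n.
  by rewrite subn_gt0.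
by rewrite /G sv_monomial //= nuX mule1 subnn mul0e adde0 ltxx.
Qed.

End Monomial.

Section Multiplicity.
Variable K : realType.
Local Notation O := (formalring K).
Implicit Types (f g : O).

(** This identification makes the multiplicity a semivaluation, and the least one
    among the normalized ones. *)
Lemma I_originE f : I_origin f = mono 1 f.
Proof.
have ge n : Mge n f -> (n%:R%:E <= mono 1 f)%E by apply: normal_Mge; apply: mono_normal.
have [f0|f0] := eqVneq f 0.
  rewrite f0 mono0; apply: eq_infty => r.
  have [n rn] : exists n : nat, r <= n%:R.
    by exists (Num.trunc `|r|).+1; apply: le_trans (ler_norm r) _; apply/ltW/truncnS_gt.
  apply: (@le_trans _ _ n%:R%:E); first by rewrite lee_fin.
  by apply: ereal_sup_ubound; exists n => //; apply/Mge_ideal_exp/Mge0.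
have [i [j lf]] := lead_exists (lexx 1) f0.
apply/eqP; rewrite eq_le; apply/andP; split.
  by apply: ge_ereal_sup => _ [n /= /Mge_ideal_exp/ge nf <-].
rewrite (mono_lead lf) /wt mul1r -natrD; apply: ereal_sup_ubound; exists (i + j)%N => //.
apply/Mge_ideal_exp => l k lt; apply/eqP; apply: contraTT lt => /lf.2.
rewrite -leqNgt /wt !mul1r -!natrD ltr_nat => -[/ltnW //|[/eqP]].
by rewrite eqr_nat => /eqP ->.
Qed.

Lemma I_origin_nat f : f != 0 -> exists n : nat, I_origin f = n%:R%:E.
Proof.
move=> /(lead_exists (lexx 1))[i [j lf]]; exists (i + j)%N.
by rewrite I_originE (mono_lead lf) /wt mul1r natrD.
Qed.

Lemma I_origin_normal : normal (@I_origin K).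
Proof. by rewrite (_ : @I_origin K = mono 1); [apply: mono_normal|apply/funext/I_originE]. Qed.

Lemma I_origin_min (mu : O -> \bar K) : normal mu -> forall f, (I_origin f <= mu f)%E.
Proof. by move=> nmu f; rewrite I_originE; apply: mono_min => //; apply: normalY. Qed.

End Multiplicity.

(** * Branches *)

Section Branches.
Variable K : realType.
Local Notation C := (complex K).
Local Notation D := (fps C).
Local Notation O := (formalring K).
Local Notation cst := (@fps_const D).
Implicit Types (f g h a b : O) (c : C) (A B : branch K).

Lemma ideal1_unit a b : a != 0 -> ideal1 a = ideal1 b ->
  exists2 u, u \is a GRing.unit & a = u * b.
Proof.
move=> a0 E; have [u aE] : ideal1 b a by rewrite -E; exists 1; rewrite mul1r.
have [v bE] : ideal1 a b by rewrite E; exists 1; rewrite mul1r.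
exists u => //; apply/unitrPr; exists v; apply: (mulIf a0).
by rewrite -mulrA -bE -aE mul1r.
Qed.

Lemma irreducible_mul_unit u a : u \is a GRing.unit -> irreducible_series a ->
  irreducible_series (u * a).
Proof.
move=> uu [na irr]; split; first by rewrite unitrM uu.
move=> g h E; have [|ug|uh] := irr (u^-1 * g) h; [|left|by right].
  by rewrite -mulrA -E mulKr.
by move: ug; rewrite unitrM unitrV uu.
Qed.

Lemma set_val_equation A : set_val A = ideal1 (equation A).
Proof. by rewrite /equation; case: cid. Qed.

Lemma branch_of a : irreducible_series a ->
  exists A u, u \is a GRing.unit /\ equation A = u * a.
Proof.
move=> irr.
have Ia : [set I : set O | exists2 f, irreducible_series f & I = ideal1 f] (ideal1 a) by exists a.
exists (SigSub (mem_set Ia)).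
have E : ideal1 a = ideal1 (equation (SigSub (mem_set Ia))) by rewrite -set_val_equation.
have [u uu aE] := ideal1_unit (nirreducible0 irr) E.
exists u^-1; rewrite unitrV; split=> //.
exact: (canRL (mulKr uu) (esym aE)).
Qed.

Lemma branch_irreducible A : irreducible_series (equation A).
Proof.
have [f irr fE] := set_mem (valP A).
have E : ideal1 f = ideal1 (equation A) by rewrite -set_val_equation -fE.
have [u uu aE] := ideal1_unit (nirreducible0 irr) E.
have -> : equation A = u^-1 * f by exact: (canRL (mulKr uu) (esym aE)).
by apply: irreducible_mul_unit irr; rewrite unitrV.
Qed.

Lemma internumC a b : internum a b = internum b a.
Proof.
rewrite /internum; congr colength; apply/seteqP; split=> f [p [q ->]]; exists q, p; exact: addrC.
Qed.

(** On the explicit arc of a graph, intersection numbers are orders, with no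
    factor. *)
Lemma arc_graph (psi : D) : psi 0%N = 0 -> exists al : {rmorphism O -> D},
  [/\ arc_of (varY - cst psi) al, al varX = fpsX & al varY = psi].
Proof.
move=> p0; have [h [lh hX hY]] := subst_exists (@MgeX_var K) (MgeY_cst p0).
pose al : {rmorphism O -> D} := @at0 D \o h.
have lal : local_arc al by apply: local_arc_comp lh; apply: local_arc_at0.
have alX : al varX = fpsX by rewrite /= hX at0_varX.
have alY : al varY = psi by rewrite /= hY.
have alc (d : D) : al (cst d) = d by rewrite /= (endo_cst lh hX).
have alg : al (varY - cst psi) = 0 by rewrite rmorphB alY alc subrr.
have tN : fpsX != 0 :> D by have [] := ordnXn_unit 1 (unitr1 D); rewrite mulr1.
exists al; split=> //; split=> //.
- move=> f; split=> [af|[q ->]]; last by rewrite rmorphM alg mulr0.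
  have [| |q [c fE]] := @divide_order1 K (varY - cst psi) _ _ f.
  + by rewrite !fpsBE fps_constE eqxx p0 subr0 /varY fpsXE fps0E.
  + by rewrite !fpsBE fps_constE fps0E subr0 /varY fpsXE fps1E oner_eq0.
  move: af; rewrite fE rmorphD rmorphM alg mulr0 add0r alc => ->.
  by exists q; rewrite rmorph0 addr0.
- by apply: (arc_integral lal (N := 1)) => //; rewrite alX expr1.
by exists varX; [apply: MgeX_var|rewrite alX].
Qed.

Lemma internum_arc1 a (al : {rmorphism O -> D}) z : arc_of a al -> Mge 1 z ->
  al z != 0 -> ordn (al z) = 1%N -> forall f, internum a f = arc_ord al f.
Proof.
move=> arc z1 z0 oz f; rewrite (internum_arc_at arc z1 z0) oz nb_hit1.
by rewrite divff ?oner_eq0 // mul1e.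
Qed.

Lemma ordn_fpsX : (fpsX : D) != 0 /\ ordn (fpsX : D) = 1%N.
Proof. by have := ordnXn_unit 1 (unitr1 D); rewrite mulr1. Qed.

Section Lines.
Variable lam : C.
Let psi : D := fps_const lam * fpsX.
Let psi0 : psi 0%N = 0. Proof. by rewrite /psi fps_const_mulE fpsXE mulr0. Qed.

Definition line : O := varY - scalar lam * varX.
Let lineE : line = varY - cst psi.
Proof. by rewrite /line /psi rmorphM. Qed.

Lemma Mge_line : Mge 1 line.
Proof. by apply: MgeB; [apply: MgeY_var|apply: MgeMl; apply: MgeX_var]. Qed.

Lemma internum_line_ge m a : Mge m a -> (m%:R%:E <= internum a line)%E.
Proof.
move=> am; have [al [arc alX alY]] := arc_graph psi0.
have [t0 t1] := ordn_fpsX.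
rewrite internumC lineE (internum_arc1 arc (@MgeX_var K)) ?alX //.
rewrite /arc_ord; case: eqVneq => [_|a0]; first exact: leey.
by rewrite lee_fin ler_nat -(ordn_vge _ a0); apply: (arc_Mge arc am).
Qed.

Lemma internum_line_le m a : (\poly_(j < m.+1) a j (m - j)%N).[lam] != 0 -> Mge m a ->
  (internum a line <= m%:R%:E)%E.
Proof.
move=> am ma; have [al [arc alX alY]] := arc_graph psi0.
have [t0 t1] := ordn_fpsX; have [lal _ _ _] := arc.
rewrite internumC lineE (internum_arc1 arc (@MgeX_var K)) ?alX //.
suff alm : al a m != 0.
  have a0 : al a != 0 by apply: contraNneq alm => ->; rewrite fps0E.
  rewrite /arc_ord (negbTE a0) lee_fin ler_nat leqNgt; apply: contra alm => lt.
  by rewrite (ordnP a0).2.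
have vr := arc_Mge arc (@truncP K m.+1 a).
have {vr} := vr m (ltnSn m); rewrite rmorphB fpsBE => /eqP; rewrite subr_eq0 => /eqP ->.
rewrite rmorph_sum fps_sumE; move: am; rewrite horner_poly.
congr (_ != 0); apply: eq_bigr => j _; rewrite rmorph_sum fps_sumE.
have jm : (m - j < m.+1)%N by rewrite ltnS leq_subr.
have term i : al (scalar (a j i) * (varX ^+ i * varY ^+ j)) m = if (i + j == m)%N then a j i * lam ^+ j else 0.
  rewrite !rmorphM !rmorphXn alX alY lal.1 /psi exprMn -rmorphXn.
  rewrite (_ : _ * _ = fps_const (a j i * lam ^+ j) * fpsX ^+ (i + j)); last by rewrite rmorphM exprD; ring.
  by rewrite fps_const_mulE fpsXnE eq_sym; case: eqP => _; rewrite ?mulr1 ?mulr0.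
have jlm : (j <= m)%N by rewrite -ltnS.
transitivity (\sum_(i < m.+1) if (i + j == m)%N then a j i * lam ^+ j else 0); last first.
  by apply: eq_bigr => i _; rewrite term.
rewrite (bigD1 (Ordinal jm)) //= (subnK jlm) eqxx big1 ?addr0 //.
by move=> i; rewrite -val_eqE /= => ij; case: eqP => // ijm; case/eqP: ij; lia.
Qed.
End Lines.

(** A line through the origin meets the curve with at least its multiplicity, and
    with equality unless the slope is a root of the initial form. *)
Lemma internum_M a : irreducible_series a ->
  val_ideal (internum a) (@maxideal K) = I_origin a.
Proof.
move=> irr; have [al arc] := arc_exists irr.
have sv := arc_internum_sv arc.
have a0 := nirreducible0 irr; have [i [j lf]] := lead_exists (lexx 1) a0.
have E : I_origin a = (i + j)%:R%:E by rewrite I_originE (mono_lead lf) /wt mul1r natrD.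
have Ma : Mge (i + j) a.
  move=> l k lt; apply/eqP; apply: contraTT lt => /lf.2.
  rewrite -leqNgt /wt !mul1r -!natrD ltr_nat => -[/ltnW //|[/eqP]].
  by rewrite eqr_nat => /eqP ->.
rewrite E; apply/eqP; rewrite eq_le; apply/andP; split.
  have P0 : \poly_(l < (i + j).+1) a l (i + j - l)%N != 0.
    apply/eqP => /polyP/(_ j); rewrite coef_poly ltnS leq_addl addnK coef0.
    by apply/eqP; case: lf.
  have [lam rl] := closed_nonrootP _ P0.
  apply: le_trans (internum_line_le rl Ma); apply: ereal_inf_lbound.
  by exists (line lam) => //; apply/Mge1P/Mge_line.
rewrite sv_M // le_min; apply/andP; split.
  have -> : (varX : O) = line (-1) - line 0 by rewrite /line rmorphN1 rmorph0; ring.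
  by apply: svB_ge => //; apply: internum_line_ge.
have -> : (varY : O) = line 0 by rewrite /line rmorph0; ring.
exact: internum_line_ge.
Qed.

Lemma I_branch_sv A : semivaluation (I_branch A).
Proof. by have [al arc] := arc_exists (branch_irreducible A); apply: arc_internum_sv arc. Qed.

Lemma I_branch_M A : val_ideal (I_branch A) (@maxideal K) = I_origin (equation A).
Proof. exact/internum_M/branch_irreducible. Qed.

End Branches.

(** * Semivaluations near a branch *)

Section NearBranch.
Variable K : realType.
Local Notation C := (complex K).
Local Notation D := (fps C).
Local Notation O := (formalring K).
Implicit Types (f g h a b : O) (mu nu : O -> \bar K).
Local Open Scope ereal_scope.

Lemma normal_min mu : normal mu -> mine (mu varX) (mu varY) = 1.
Proof. by move=> [sv M]; rewrite -sv_M. Qed.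

Lemma three_bounds (x y z : K) : (0 <= y)%R -> (0 <= z)%R ->
  [/\ x <= `|x| + y + z, y <= `|x| + y + z & z <= `|x| + y + z]%R.
Proof. by move=> y0 z0; have := ler_norm x; have := normr_ge0 x; split; lra. Qed.

Lemma pinch (x A : \bar K) (e v n2 n3 : K) : (0 < e)%R -> 0 <= x -> (0 <= n2)%R ->
  v%:E <= e%:E * x \/ A <= n2%:E * (e%:E * x) -> e%:E * x <= v%:E \/ A <= (n3 * v)%:E ->
  (n2 * v)%:E < A -> (n3 * v)%:E < A -> x = (v / e)%:E.
Proof.
move=> e0 x0 n20 lo hi b2 b3.
have xv : e%:E * x <= v%:E by case: hi => //; rewrite leNgt b3.
have vx : v%:E <= e%:E * x.
  case: lo => // Ax; suff : A < A by rewrite ltxx.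
  by apply: le_lt_trans Ax (le_lt_trans _ b2); rewrite EFinM lee_wpmul2l ?lee_fin.
have : e%:E * x = v%:E by apply/eqP; rewrite eq_le xv vx.
case: x x0 {lo xv vx hi} => [x|_ /eqP|//]; last by rewrite gt0_muley ?lte_fin.
move=> _ [<-]; congr EFin; field.
by rewrite gt_eqF.
Qed.

(** Here w is the coordinate of least order along the arc and w' is the other one.
    Comparing them through an integral equation gives mu w = 1 once mu a is large.
    Let e and v be the orders of w and f: both quotients of f^e and w^v have order
    zero along the arc, so that they are integral, and mu f is pinched to v/e. *)
Lemma near_branch_aux a (al : {rmorphism O -> D}) w w' f : arc_of a al -> Mge 1 w ->
    (forall mu, normal mu -> mine (mu w) (mu w') = 1) -> al w != 0%R ->
    (al w' = 0%R \/ (al w' != 0%R /\ (ordn (al w) <= ordn (al w'))%N)) -> al f != 0%R ->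
  exists r k : K, forall mu, normal mu -> k%:E < mu a -> mu f = r%:E.
Proof.
move=> arc w1 ww w0 w'0 f0; have [lal ker _ _] := arc.
have [k1 H1] : exists k1 : K, forall mu, normal mu -> k1%:E < mu a -> mu w = 1.
  have ge1 mu : normal mu -> (1 <= mu w)%E.
    by move=> nmu; have := ww mu nmu; have := le_refl (1%E : \bar K) => + E; rewrite -{2}E le_min => /andP[].
  have eq1 mu : normal mu -> ~ (mu w' <= 1) -> mu w = 1.
    move=> nmu w'1; have := ww mu nmu; rewrite /Order.min; case: ifP => // _ E.
    by case: w'1; rewrite E.
  case: w'0 => [/ker[q w'E]|[w'0 le]].
    exists 1%R => mu nmu ka; apply: eq1 => //; apply/negP; rewrite -ltNge.
    by rewrite w'E; apply: svMl_gt => //; case: nmu.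
  have [n Hn] := arc_compare arc w0 w'0 le.
  exists n%:R => mu nmu ka; have [sv _] := nmu.
  have [w'1|] := pselect (mu w' <= 1); last exact: eq1.
  have w'E : mu w' = 1 by apply/eqP; rewrite eq_le w'1 /=; have := le_refl (1%E : \bar K); rewrite -{2}(ww mu nmu) le_min => /andP[].
  case: (Hn mu sv) => [le'|]; first by apply/eqP; rewrite eq_le ge1 // andbT -w'E.
  by rewrite w'E mule1 leNgt ka.
pose e := ordn (al w); pose v := ordn (al f).
have e0 : (0 < e)%N by rewrite ordn_gt0 //; apply/eqP/lal.2.
have we : al (w ^+ v)%R != 0%R by rewrite rmorphXn expf_neq0.
have fe : al (f ^+ e)%R != 0%R by rewrite rmorphXn expf_neq0.
have ee : ordn (al (w ^+ v)%R) = ordn (al (f ^+ e)%R) by rewrite !rmorphXn !ordnX // mulnC.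
have [n2 H2] := arc_compare arc we fe (eq_leq ee).
have [n3 H3] := arc_compare arc fe we (eq_leq (esym ee)).
have [p1 p2 p3] := three_bounds k1 (mulr_ge0 (ler0n K n2) (ler0n K v)) (mulr_ge0 (ler0n K n3) (ler0n K v)).
exists (v%:R / e%:R)%R, (`|k1| + n2%:R * v%:R + n3%:R * v%:R)%R => mu nmu ka.
have [sv _] := nmu.
have big x : (x <= `|k1| + n2%:R * v%:R + n3%:R * v%:R)%R -> x%:E < mu a.
  by move=> le; apply: le_lt_trans ka; rewrite lee_fin.
have w_1 : mu w = 1 := H1 mu nmu (big k1 p1).
have c2 := H2 mu sv; have c3 := H3 mu sv.
rewrite !(svX sv) w_1 !mule1 in c2 c3; rewrite -EFinM in c3.
have e0' : (0 < e%:R :> K)%R by rewrite ltr0n.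
exact: (pinch e0' (sv_ge0 sv f) (ler0n K n2) c2 c3 (big _ p2) (big _ p3)).
Qed.

Lemma near_branch a (al : {rmorphism O -> D}) f : arc_of a al -> al f != 0%R ->
  exists r k : K, forall mu, normal mu -> k%:E < mu a -> mu f = r%:E.
Proof.
move=> arc f0; have [lal ker _ [z z1 z0]] := arc.
have nz : al varX != 0%R \/ al varY != 0%R.
  have [X0|] := eqVneq (al varX) 0%R; last by left.
  have [Y0|] := eqVneq (al varY) 0%R; last by right.
  have [g [h [_ _ zE]]] := Mge_split z1.
  by rewrite zE rmorphD !rmorphM X0 Y0 !mul0r addr0 eqxx in z0.
have mX mu : normal mu -> mine (mu varX) (mu varY) = 1 by exact: normal_min.
have mY mu : normal mu -> mine (mu varY) (mu varX) = 1 by rewrite minC; exact: normal_min.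
have [X0|X0] := eqVneq (al varX) 0%R.
  case: nz => [|Y0]; first by rewrite X0 eqxx.
  by apply: (near_branch_aux arc (@MgeY_var K) mY Y0 _ f0); left.
have [Y0|Y0] := eqVneq (al varY) 0%R.
  by apply: (near_branch_aux arc (@MgeX_var K) mX X0 _ f0); left.
case: (leqP (ordn (al varX)) (ordn (al varY))) => [le|lt].
  by apply: (near_branch_aux arc (@MgeX_var K) mX X0 _ f0); right.
by apply: (near_branch_aux arc (@MgeY_var K) mY Y0 _ f0); right; split=> //; apply: ltnW.
Qed.

(** All values are infinite or prescribed by the arc. *)
Lemma normal_infinite_unique a mu nu : irreducible_series a -> normal mu -> normal nu ->
  mu a = +oo -> nu a = +oo -> mu = nu.
Proof.
move=> irr nmu nnu mua nua; have [al arc] := arc_exists irr; have [_ ker _ _] := arc.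
apply/funext => f; have [/ker[q ->]|f0] := eqVneq (al f) 0%R.
  have [sv _] := nmu; have [sv' _] := nnu.
  by rewrite !svM // mua nua !addey // -ltNye (lt_le_trans _ (sv_ge0 _ q)) ?ltNy0.
have [r [k H]] := near_branch arc f0.
by rewrite !H ?mua ?nua ?ltry.
Qed.

Lemma sv_scale mu (c : K) : (0 < c)%R -> semivaluation mu -> semivaluation (fun f => c%:E * mu f).
Proof.
move=> c0 sv; have c0' : 0 <= c%:E by rewrite lee_fin ltW.
split=> [f|f g|f g|x x0|].
- by rewrite mule_ge0 ?sv_ge0.
- by rewrite svM // ge0_muleDr ?sv_ge0.
- rewrite -mine_pMr // lee_pmul2l ?lte_fin //; have [_ _ H _ _] := sv; exact: H.
- by rewrite sv_scalar // mule0.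
by rewrite sv0 // gt0_muley ?lte_fin.
Qed.

Lemma val_ideal_scale mu (c : K) : (0 < c)%R -> semivaluation mu ->
  val_ideal (fun f => c%:E * mu f) (@maxideal K) = c%:E * val_ideal mu (@maxideal K).
Proof.
move=> c0 sv; rewrite (sv_M (sv_scale c0 sv)) sv_M // mine_pMr //.
by rewrite lee_fin ltW.
Qed.

Definition mult (A : branch K) : K := fine (I_origin (equation A)).

Lemma multP A : [/\ (1 <= mult A)%R & I_origin (equation A) = (mult A)%:E].
Proof.
have irr := branch_irreducible A.
have [n nE] := I_origin_nat (nirreducible0 irr); rewrite /mult nE /=; split=> //.
rewrite -lee_fin -nE; apply: (normal_Mge (n := 1) (I_origin_normal K)).
by apply/nunitO; case: irr.
Qed.

Lemma mult_gt0 A : (0 < mult A)%R.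
Proof. by have [m1 _] := multP A; apply: lt_le_trans m1. Qed.

(** The normalized semivaluation in the orbit of the branch. *)
Definition nbranch (A : branch K) f : \bar K := (mult A)^-1%:E * I_branch A f.

Lemma I_branch_nbranch A f : I_branch A f = (mult A)%:E * nbranch A f.
Proof. by rewrite /nbranch muleA -EFinM divff ?mul1e // gt_eqF // mult_gt0. Qed.

Lemma nbranch_normal A : normal (nbranch A).
Proof.
have m0 := mult_gt0 A; have mi : (0 < (mult A)^-1)%R by rewrite invr_gt0.
split; first exact: sv_scale mi (I_branch_sv A).
rewrite (val_ideal_scale mi (I_branch_sv A)) I_branch_M; have [_ ->] := multP A.
by rewrite -EFinM mulVf // gt_eqF.
Qed.

Lemma nbranch_equation A : nbranch A (equation A) = +oo.
Proof.
have [al arc] := arc_exists (branch_irreducible A).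
have [k k0 kE] := internum_scale arc; have [_ ker _ _] := arc.
rewrite /nbranch /I_branch kE /arc_ord.
have -> : al (equation A) = 0%R by apply/ker; exists 1%R; rewrite mul1r.
by rewrite eqxx !gt0_muley ?lte_fin ?invr_gt0 ?mult_gt0.
Qed.

Lemma smooth_nbranch L : smooth_branch L -> nbranch L = I_branch L.
Proof.
move=> sL; apply/funext => f; rewrite /nbranch.
have -> : mult L = 1%R by rewrite /mult sL.
by rewrite invr1 mul1e.
Qed.

End NearBranch.

(** * Observers *)

Section Observers.
Variable K : realType.
Local Notation C := (complex K).
Local Notation D := (fps C).
Local Notation O := (formalring K).
Local Notation cst := (@fps_const D).
Implicit Types (f g h a b : O) (mu nu : O -> \bar K).

(** Inverse changes of coordinates that turn the curve a = 0 into the axis y = 0. *)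
Definition straightens a (h h' : {rmorphism O -> O}) :=
  [/\ local_endo h, local_endo h', cancel h h', cancel h' h
    & exists2 u, u \is a GRing.unit & h a = u * varY].

Lemma straightens_cancel (h h' : {rmorphism O -> O}) : local_endo h -> local_endo h' ->
  h' (h varX) = varX -> h' (h varY) = varY -> cancel h h'.
Proof.
move=> lh lh' hX hY f.
exact: (@local_endo_eq K (h' \o h : {rmorphism O -> O}) idfun (local_endo_comp lh' lh) (@local_endo_id K) hX hY f).
Qed.

Lemma straightens_graph a : a 0%N 0%N = 0 -> a 1%N 0%N != 0 -> exists h h' : {rmorphism O -> O}, straightens a h h'.
Proof.
move=> a0 a1; have [psi [q [p0 uq E]]] := order1_graph a0 a1.
have [h [lh hX hY]] := subst_exists (@MgeX_var K) (MgeD (@MgeY_var K) (MgeY_cst p0)).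
have [h' [lh' h'X h'Y]] := subst_exists (@MgeX_var K) (MgeB (@MgeY_var K) (MgeY_cst p0)).
have hc := endo_cst lh hX; have h'c := endo_cst lh' h'X.
exists h, h'; split=> //.
- by apply: straightens_cancel => //; [rewrite hX|rewrite hY rmorphD h'Y h'c subrK].
- by apply: straightens_cancel => //; [rewrite h'X|rewrite h'Y rmorphB hY hc addrK].
exists (h q)^-1; first by rewrite unitrV rmorph_unit.
have : h (varY - cst psi) = h q * h a by rewrite E rmorphM.
rewrite rmorphB hY hc addrK => ->.
exact: (esym (mulKr (rmorph_unit h uq) (h a))).
Qed.

(** A series of multiplicity one has order one in x or in y; exchange the variables
    in the first case. *)
Lemma straightens_smooth a : I_origin a = 1%E -> exists h h' : {rmorphism O -> O}, straightens a h h'.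
Proof.
move=> a1; have aM : Mge 1 a.
  apply/nunitO/negP => /(sv_unit (I_origin_normal K).1); rewrite a1 => /eqP.
  by rewrite eqe oner_eq0.
have a00 : a 0%N 0%N = 0 by apply: aM.
have [z|] := eqVneq (a 1%N 0%N) 0; last exact: straightens_graph.
have a01 : a 0%N 1%N != 0.
  apply/eqP => z'; have M2 : Mge 2 a.
    move=> [|[|j]] [|[|i]] //; rewrite ?a00 ?z ?z' //; lia.
  have := normal_Mge (I_origin_normal K) M2; rewrite a1 lee_fin.
  by rewrite lern1.
have [s [ls sX sY]] := subst_exists (@MgeY_var K) (@MgeX_var K).
have ss : cancel s s by apply: straightens_cancel; rewrite ?sX ?sY.
have sa : s a 1%N 0%N = a 0%N 1%N.
  have M2 : Mge 2 (a - scalar (a 0%N 1%N) * varX).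
    move=> j i lt; have [|[|]] : (i = 0 /\ j = 0)%N \/ (i = 1 /\ j = 0)%N \/ (i = 0 /\ j = 1)%N by lia.
    - by case=> -> ->; rewrite !fpsBE scalarME -[varX]expr1 -[varX ^+ 1]mulr1 varXnME mulr0 subr0.
    - case=> -> ->; rewrite !fpsBE scalarME -[varX]expr1 -[varX ^+ 1]mulr1 varXnME /= subnn.
      by rewrite !fps1E mulr1 subrr.
    by case=> -> ->; rewrite !fpsBE scalarME -[varX]expr1 -[varX ^+ 1]mulr1 varXnME mulr0 subr0.
  have := local_endo_Mge ls M2 (j := 1) (i := 0) isT; rewrite rmorphB rmorphM ls.1 sX !fpsBE scalarME.
  by rewrite /varY fpsXE fps1E mulr1 => /eqP; rewrite subr_eq0 => /eqP.
have sM : Mge 1 (s a) by apply: ls.2.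
have [h [h' [lh lh' hh' h'h [u uu E]]]] := straightens_graph (sM 0%N 0%N isT) (eq_ind_r (fun x => x != 0) a01 sa).
exists (h \o s), (s \o h'); split.
- exact: local_endo_comp.
- exact: local_endo_comp.
- by move=> f /=; rewrite hh' ss.
- by move=> f /=; rewrite ss h'h.
by exists u.
Qed.

Section Straight.
Variables (a : O) (h h' : {rmorphism O -> O}).
Hypothesis st : straightens a h h'.
Let lh : local_endo h. Proof. by case: st. Qed.
Let lh' : local_endo h'. Proof. by case: st. Qed.
Let hK : cancel h h'. Proof. by case: st. Qed.
Let h'K : cancel h' h. Proof. by case: st. Qed.

Lemma normal_endo mu (k k' : {rmorphism O -> O}) : local_endo k -> local_endo k' -> cancel k k' ->
  cancel k' k -> normal mu -> normal (mu \o k).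
Proof.
move=> lk lk' kK k'K [sv M]; split.
  split=> [f|f g|f g|c c0|] /=.
  - exact: sv_ge0.
  - by rewrite rmorphM svM.
  - by rewrite rmorphD; case: sv => _ _ H _ _; apply: H.
  - by rewrite lk.1 sv_scalar.
  by rewrite rmorph0 sv0.
rewrite -M /val_ideal; congr ereal_inf; apply/seteqP; split=> _ [f /Mge1P fM <-].
  by exists (k f) => //; apply/Mge1P/lk.2.
by exists (k' f); [apply/Mge1P/lk'.2|rewrite /= k'K].
Qed.

Lemma straight_val mu : semivaluation mu -> mu (h' varY) = mu a.
Proof.
move=> sv; have [_ _ _ _ [u uu E]] := st.
have aE : a = h' u * h' varY by rewrite -(rmorphM h') -E hK.
by rewrite [in RHS]aE (svM sv) (sv_unit sv (rmorph_unit h' uu)) add0e.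
Qed.

(** The monomial valuation in the coordinates in which a = 0 is y = 0. *)
Definition skew s : O -> \bar K := mono s \o h.

Lemma skew_normal s : 1 <= s -> normal (skew s).
Proof. by move=> s1; exact: (normal_endo lh lh' hK h'K (mono_normal s1)). Qed.

Lemma skew_val s : 1 <= s -> skew s a = s%:E.
Proof.
move=> s1; have [_ _ _ _ [u uu E]] := st; have sv := mono_sv s1.
by rewrite /skew /= E (svM sv) (sv_unit sv uu) add0e mono_varY.
Qed.

Lemma skew_min s mu : 1 <= s -> normal mu -> (s%:E <= mu a)%E -> forall f, (skew s f <= mu f)%E.
Proof.
move=> s1 nmu sa f; rewrite /skew /= -[in leRHS](hK f).
apply: (@mono_min K s s1 (mu \o h') (h f) (normal_endo lh' lh h'K hK nmu)) => /=.
by rewrite (straight_val nmu.1).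
Qed.

Lemma skew_max s mu nu : 1 <= s -> normal mu -> normal nu -> (forall f, mu f <= nu f)%E ->
  mu a = s%:E -> (s%:E < nu a)%E -> forall f, (mu f <= skew s f)%E.
Proof.
move=> s1 nmu nnu le mua nua f; rewrite /skew /= -[in leLHS](hK f).
have svm := nmu.1; have svn := nnu.1.
apply: (@mono_max K s s1 (mu \o h') (nu \o h') (h f) (normal_endo lh' lh h'K hK nmu)
  (normal_endo lh' lh h'K hK nnu)) => /=.
- by move=> g; apply: le.
- by rewrite (straight_val svm).
by rewrite (straight_val svn).
Qed.

Lemma straight_arc : exists al : {rmorphism O -> D},
  arc_of a al /\ forall f, al f = h f 0%N.
Proof.
have [_ _ _ _ [u uu E]] := st.
pose al : {rmorphism O -> D} := @at0 D \o h.
exists al; split=> //; split.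
- exact: local_arc_comp (local_arc_at0 K) lh.
- have ala : al a = 0.
    rewrite -[LHS]/(at0 (h a)) E; apply: etrans (rmorphM (@at0 D) u varY) _.
    exact: etrans (congr1 (fun z => at0 u * z) (at0_varY K)) (mulr0 _).
  move=> f; split=> [af|[q ->]]; last by rewrite rmorphM ala mulr0.
  exists (h' (fps_shift (h f)) * h' u^-1); apply: (can_inj hK).
  rewrite (rmorphM h) (rmorphM h) h'K h'K E.
  apply: etrans (fps_shift0 (af : h f 0%N = 0)) _.
  by rewrite -[RHS]mulrA (mulKr uu) mulrC.
- move=> z; have -> : z = al (h' (cst z)) by rewrite /= h'K.
  exact: integral_id.
exists (h' varX); first by apply: lh'.2; apply: MgeX_var.
by rewrite /= h'K at0_varX; have [] := ordn_fpsX K.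
Qed.

(** In straight coordinates, f is its restriction to the branch plus a multiple of
    the equation of the branch. The restriction is a unit times a power of x, whose
    exponent is the intersection number, and x has value at least 1. *)
Lemma straight_ultrametric mu f : normal mu -> (mine (mu a) (internum a f) <= mu f)%E.
Proof.
move=> nmu; have [sv _] := nmu; have [al [arc alE]] := straight_arc.
have [t0 t1] := ordn_fpsX K.
have alX : al (h' varX) = fpsX by rewrite alE h'K.
have MX : Mge 1 (h' varX) by apply: lh'.2; apply: MgeX_var.
rewrite (internum_arc1 arc MX) ?alX //.
have fE : f = h' (cst (al f)) + h' varY * h' (fps_shift (h f)).
  by apply: (can_inj hK); rewrite rmorphD rmorphM !h'K alE -fps_shiftE.
rewrite [in leRHS]fE; apply: svD_ge => //; last first.
  by rewrite mulrC; apply: svMl_ge => //; rewrite straight_val // ge_min lexx.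
rewrite ge_min; apply/orP; right; rewrite /arc_ord; case: eqVneq => [->|f0].
  by rewrite !rmorph0 sv0.
have [u uu E] := ordn_unit f0; rewrite {2}E.
have -> : cst (fpsX ^+ ordn (al f) * u) = cst u * varX ^+ ordn (al f) by rewrite mulrC rmorphM rmorphXn.
rewrite rmorphM rmorphXn; apply: svMl_ge => //.
exact: (normal_Mge nmu (MgeX1 MX)).
Qed.

End Straight.
End Observers.

(** * The order relation seen from an observer *)

Section ObserverOrder.
Variable K : realType.
Local Notation C := (complex K).
Local Notation O := (formalring K).
Implicit Types (f g a b : O) (mu nu sig tau P Q : O -> \bar K) (S R : observer K).
Local Open Scope ereal_scope.

Definition below mu nu := forall f, mu f <= nu f.

Lemma below_trans nu mu sig : below mu nu -> below nu sig -> below mu sig.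
Proof. by move=> mn ns f; apply: le_trans (ns f). Qed.

Lemma I_branch_normal L : smooth_branch L -> normal (@I_branch K L).
Proof. by move=> sL; rewrite -(smooth_nbranch sL); apply: nbranch_normal. Qed.

Lemma I_branch_equation L : @I_branch K L (equation L) = +oo.
Proof.
by rewrite I_branch_nbranch nbranch_equation gt0_muley ?lte_fin ?mult_gt0.
Qed.

Lemma obs_normal S : normal (I_obs S).
Proof. by case: S => [|L sL]; [exact: I_origin_normal|exact: I_branch_normal]. Qed.

Lemma equation_maxideal (A : branch K) : Mge 1 (equation A).
Proof. by apply/nunitO; case: (branch_irreducible A). Qed.

Lemma bracket_ge1 S mu : normal mu -> 1 <= bracket mu S.
Proof.
case: S => [|L sL] nmu; first by rewrite /= nmu.2.
exact: (normal_Mge (n := 1) nmu (equation_maxideal L)).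
Qed.

Lemma bracket_below S mu nu : normal mu -> normal nu -> below mu nu -> bracket mu S <= bracket nu S.
Proof. by case: S => [|L sL] nmu nnu H; [rewrite /= nmu.2 nnu.2|apply: H]. Qed.

Lemma obs_infinite S mu : normal mu -> bracket mu S = +oo -> mu = I_obs S.
Proof.
case: S => [|L sL] nmu; first by rewrite /= nmu.2.
move=> E; apply: (normal_infinite_unique (branch_irreducible L) nmu _ E).
  exact: I_branch_normal.
exact: I_branch_equation.
Qed.

Lemma normal_real S mu : normal mu -> bracket mu S = +oo \/ exists2 s, (1 <= s)%R & bracket mu S = s%:E.
Proof.
move=> nmu; have := bracket_ge1 S nmu; case: (bracket mu S) => [s|_|//]; last by left.
by rewrite lee_fin; right; exists s.
Qed.

(** The meet with a smooth branch is the monomial valuation with the same value on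
    the branch, in coordinates where the branch is an axis. *)
Lemma obs_meet S mu : normal mu -> exists tau,
  [/\ normal tau, below tau mu, below tau (I_obs S) & bracket tau S = bracket mu S].
Proof.
case: S => [|L sL] nmu.
  exists (@I_origin K); split=> //; [exact: I_origin_normal|exact: I_origin_min|].
  by rewrite /= nmu.2 (I_origin_normal K).2.
have [E|[s s1 sE]] := normal_real (ObsBranch sL) nmu.
  by exists mu; split=> //; rewrite -(obs_infinite nmu E).
have [h [h' st]] := straightens_smooth sL.
exists (skew h s); split.
- exact: (skew_normal st s1).
- by apply: (skew_min st s1 nmu); rewrite -sE lexx.
- by apply: (skew_min st s1 (I_branch_normal sL)); rewrite I_branch_equation leey.
by rewrite sE; apply: (skew_val st s1).
Qed.

(** A point below a smooth branch is at most monomial by [skew_max], hence below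
    whatever has a larger value on the branch by [skew_min]. *)
Lemma obs_below S sig nu : normal sig -> normal nu -> below sig (I_obs S) ->
  bracket sig S <= bracket nu S -> below sig nu.
Proof.
case: S => [|L sL] nsig nnu sI le f.
  by apply: le_trans (sI f) (I_origin_min nnu f).
have [E|[s s1 sE]] := normal_real (ObsBranch sL) nsig.
  have nE : bracket nu (ObsBranch sL) = +oo by apply/eqP; rewrite -leye_eq -E.
  by rewrite (obs_infinite nsig E) (obs_infinite nnu nE).
have [h [h' st]] := straightens_smooth sL.
apply: (@le_trans _ _ (skew h s f)).
  apply: (skew_max st s1 nsig (I_branch_normal sL) sI sE).
  by rewrite I_branch_equation ltry.
by apply: (skew_min st s1 nnu); rewrite -sE.
Qed.

(** The strict increase on the branch bounds mu by a monomial valuation. *)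
Lemma obs_strict S mu nu : normal mu -> normal nu -> below mu nu ->
  bracket mu S < bracket nu S -> below mu (I_obs S).
Proof.
case: S => [|L sL] nmu nnu le lt; first by move: lt; rewrite /= nmu.2 nnu.2 ltxx.
have [E|[s s1 sE]] := normal_real (ObsBranch sL) nmu.
  by move: lt; rewrite E ltNge leey.
have [h [h' st]] := straightens_smooth sL.
move=> f; apply: (@le_trans _ _ (skew h s f)).
  by apply: (skew_max st s1 nmu nnu le sE); rewrite -sE.
by apply: (skew_min st s1 (I_branch_normal sL)); rewrite I_branch_equation leey.
Qed.

Lemma obs_branch S C : val_branch (I_obs S) C = bracket (I_branch C) S.
Proof.
case: S => [|L sL]; first exact: (esym (I_branch_M C)).
exact: (internumC (equation L) (equation C)).
Qed.

Lemma obs_sym R R' : bracket (I_obs R) R' = bracket (I_obs R') R.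
Proof.
case: R R' => [|L sL] [|L' sL']; first by [].
- exact: (esym (I_branch_M L')).
- exact: (I_branch_M L).
exact: (internumC (equation L) (equation L')).
Qed.

Lemma obs_ultra R R' mu : normal mu ->
  mine (bracket mu R) (bracket (I_obs R) R') <= bracket mu R'.
Proof.
move=> nmu; case: R => [|L sL].
  by rewrite ge_min [X in X <= _]/= nmu.2 bracket_ge1.
case: R' => [|L' sL'].
  have E1 : bracket (I_obs (ObsBranch sL)) ObsOrigin = 1 := (I_branch_normal sL).2.
  have E2 : bracket mu ObsOrigin = 1 := nmu.2.
  by rewrite E1 E2 ge_min lexx orbT.
have [h [h' st]] := straightens_smooth sL.
exact: (straight_ultrametric st (equation L') nmu).
Qed.

Lemma irreducible_mult1 a : I_origin a = 1 -> irreducible_series a.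
Proof.
have [sv _] := I_origin_normal K.
move=> a1; split.
  by apply/negP => /(sv_unit sv); rewrite a1 => /eqP; rewrite eqe oner_eq0.
move=> g h aE; have [ug|ng] := boolP (g \is a GRing.unit); first by left.
right; apply: contrapT => /negP nh.
have H (x : O) : x \isn't a GRing.unit -> 1 <= I_origin x.
  by move=> /nunitO xM; exact: (normal_Mge (n := 1) (I_origin_normal K) xM).
have := leeD (H g ng) (H h nh); rewrite -(svM sv) -aE a1 -EFinD lee_fin.
by rewrite gerDl ler10.
Qed.

(** One of the two coordinate axes is transversal, because the values on x and y have
    minimum 1. *)
Lemma obs_transversal S : exists C : branch K, I_obs S (equation C) = 1.
Proof.
have H z : I_origin z = 1 -> I_obs S z = 1 -> exists C : branch K, I_obs S (equation C) = 1.
  move=> z1 Sz; have [C [u [uu uE]]] := branch_of (irreducible_mult1 z1).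
  by exists C; have [sv _] := obs_normal S; rewrite uE (svM sv) (sv_unit sv uu) add0e.
have X1 : I_origin (@varX K) = 1 by rewrite I_originE mono_varX.
have Y1 : I_origin (@varY K) = 1 by rewrite I_originE mono_varY.
have := normal_min (obs_normal S); rewrite /Order.min; case: ifP => _; exact: H.
Qed.

End ObserverOrder.

(** * The Hausdorff quotient *)

Section Quotient.
Variable K : realType.
Local Notation O := (formalring K).
Implicit Types (f g a b : O) (nu : Vstar K) (mu rho : O -> \bar K).
Local Open Scope ereal_scope.

Lemma VstarP nu : [/\ semivaluation (val_of nu), val_of nu <> @trivS K & val_of nu <> @trivO K].
Proof. exact: (set_mem (valP nu)). Qed.

Lemma val_of_continuous f : continuous (fun nu => val_of nu f).
Proof.
move=> nu.
have c1 : continuous (set_val : Vstar K -> {ptws O -> \bar K}) by apply: initial_continuous.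
have c2 : continuous (fun g : {ptws O -> \bar K} => g f) by exact: proj_continuous.
exact: (continuous_comp (c1 nu) (c2 _)).
Qed.

Lemma near_gt nu0 f x : x < val_of nu0 f -> \forall nu \near nu0, x < val_of nu f.
Proof.
move=> lt; apply: (@val_of_continuous f nu0 [set y | x < y]).
by apply: open_nbhs_nbhs; split=> //; exact: open_ereal_gt_ereal.
Qed.

Lemma near_lt nu0 f x : val_of nu0 f < x -> \forall nu \near nu0, val_of nu f < x.
Proof.
move=> lt; apply: (@val_of_continuous f nu0 [set y | y < x]).
by apply: open_nbhs_nbhs; split=> //; exact: open_ereal_lt_ereal.
Qed.

(** A noncentered semivaluation is identified in the Hausdorff quotient with the
    branch on which it is positive. *)
Definition represents mu (nu : O -> \bar K) := normal mu /\
  ((exists2 c : K, (0 < c)%R & forall f, nu f = c%:E * mu f) \/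
   (val_ideal nu (@maxideal K) = 0 /\
    exists a, [/\ irreducible_series a, 0 < nu a & mu a = +oo])).

(** Induction on the multiplicity, which is additive and positive on nonunits. *)
Lemma positive_irreducible (nu : O -> \bar K) f : semivaluation nu -> f != 0%R -> 0 < nu f ->
  exists2 a, irreducible_series a & 0 < nu a.
Proof.
move=> sv f0; have [n fn] := I_origin_nat f0; have [sv1 _] := I_origin_normal K.
elim/ltn_ind: n f f0 fn => n IH f f0 fn nf.
have nu_f : f \isn't a GRing.unit by apply/negP => /(sv_unit sv) E; rewrite E ltxx in nf.
have [irr|nirr] := pselect (irreducible_series f); first by exists f.
have [g [h [fE ng nh]]] : exists g h, [/\ f = (g * h)%R, g \isn't a GRing.unit & h \isn't a GRing.unit].
  apply: contrapT => H; apply: nirr; split=> // g h fE.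
  have [ug|ng] := boolP (g \is a GRing.unit); first by left.
  by right; apply: contrapT => /negP nh; apply: H; exists g, h.
have [g0 h0] : g != 0%R /\ h != 0%R by move: f0; rewrite fE mulf_eq0 negb_or => /andP[].
have [p gp] := I_origin_nat g0; have [q hq] := I_origin_nat h0.
have pq : (p + q = n)%N.
  by move: fn; rewrite fE (svM sv1) gp hq -EFinD -natrD => -[/eqP]; rewrite eqr_nat => /eqP.
have ge1 (x : O) k : x \isn't a GRing.unit -> I_origin x = k%:R%:E -> (0 < k)%N.
  move=> /nunitO xM xk; have := normal_Mge (n := 1) (I_origin_normal K) xM.
  by rewrite xk lee_fin ler_nat.
have p0 := ge1 g p ng gp; have q0 := ge1 h q nh hq.
have [gpos|g00] := boolP (0 < nu g); first by apply: (IH p _ g g0 gp gpos); lia.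
apply: (IH q _ h h0 hq); first by lia.
move: nf; rewrite fE (svM sv); have -> : nu g = 0 by apply/eqP; rewrite eq_le leNgt g00 sv_ge0.
by rewrite add0e.
Qed.

(** Were the two branches distinct, a power of each coordinate would be integral
    over the ideal generated by their equations, and the semivaluation would be
    positive on the maximal ideal. *)
Lemma noncentered_unique (nu : O -> \bar K) a b mu : semivaluation nu ->
    val_ideal nu (@maxideal K) = 0 -> irreducible_series a -> 0 < nu a -> 0 < nu b ->
  semivaluation mu -> mu a = +oo -> mu b = +oo.
Proof.
move=> sv M0 irr na nb svm ma; have [al arc] := arc_exists irr; have [lal ker _ _] := arc.
have [/ker[q ->]|b0] := eqVneq (al b) 0%R.
  by rewrite (svM svm) ma addey // -ltNye (lt_le_trans _ (sv_ge0 svm q)) ?ltNy0.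
have pos z : Mge 1 z -> 0 < nu z.
  move=> z1; have [/ker[q ->]|z0] := eqVneq (al z) 0%R; first exact: (svMl_gt sv).
  pose v := ordn (al b).
  have zv : al (z ^+ v)%R != 0%R by rewrite rmorphXn expf_neq0.
  have le : (ordn (al b) <= ordn (al (z ^+ v)%R))%N.
    rewrite rmorphXn ordnX // leq_pmulr // ordn_gt0 //; exact/eqP/lal.2.
  have [n H] := arc_compare arc b0 zv le.
  rewrite lt_neqAle (sv_ge0 sv) andbT eq_sym; apply/eqP => z00.
  case: (H nu sv); rewrite (svX sv) z00 mule0 ?mule0 leNgt; [by rewrite nb|by rewrite na].
have := M0; rewrite (sv_M sv) /Order.min; case: ifP => _ E.
  by have := pos _ (@MgeX_var K); rewrite E ltxx.
by have := pos _ (@MgeY_var K); rewrite E ltxx.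
Qed.

(** Three cases for the value of the maximal ideal: +oo is that of the trivial
    semivaluation at the point; a positive real number is divided out; 0 is the
    noncentered case. *)
Lemma represents_exists nu : exists mu, represents mu (val_of nu).
Proof.
have [sv nS nO] := VstarP nu; set w := val_of nu in sv nS nO *.
have M0 : 0 <= val_ideal w (@maxideal K) by rewrite (sv_M sv) le_min !(sv_ge0 sv).
have [Moo|Mfin] := eqVneq (val_ideal w (@maxideal K)) +oo.
  exfalso; apply: nO; apply/funext => f; rewrite /trivO; case: ifPn => fM.
    apply/eqP; rewrite -leye_eq -Moo; apply: ereal_inf_lbound.
    by exists f => //; exact: set_mem fM.
  apply: (sv_unit sv); rewrite unitO; apply: contraNneq fM => f0.
  exact/mem_set.
have [Mz|Mpos] := eqVneq (val_ideal w (@maxideal K)) 0.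
  have [f f0 wf] : exists2 f, f != 0%R & 0 < w f.
    apply: contrapT => H; apply: nS; apply/funext => f; rewrite /trivS.
    case: eqVneq => [->|f0]; first exact: (sv0 sv).
    apply/eqP; rewrite eq_le (sv_ge0 sv) andbT leNgt; apply/negP => wf.
    by apply: H; exists f.
  have [a irr wa] := positive_irreducible sv f0 wf.
  have [A [u [uu AE]]] := branch_of irr.
  exists (nbranch A); split; first exact: nbranch_normal.
  right; split=> //; exists a; split=> //.
  have svA := (nbranch_normal A).1; have := nbranch_equation A.
  by rewrite AE (svM svA) (sv_unit svA uu) add0e.
move: M0 Mfin Mpos; case E: (val_ideal w (@maxideal K)) => [m|//|//] m0 _ mn0.
have mp : (0 < m)%R by rewrite lt_neqAle eq_sym; apply/andP; split; [exact: mn0|exact: m0].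
have mi : (0 < m^-1)%R by rewrite invr_gt0.
exists (fun f => m^-1%:E * w f); split.
  split; first exact: sv_scale mi sv.
  by rewrite (val_ideal_scale mi sv) E -EFinM mulVf // gt_eqF.
by left; exists m => // f; rewrite muleA -EFinM divff ?mul1e // gt_eqF.
Qed.

Lemma emul_inj (d : K) (x y : \bar K) : (0 < d)%R -> d%:E * x = d%:E * y -> x = y.
Proof.
move=> d0 /(congr1 (fun z => d^-1%:E * z)).
by rewrite !muleA -!EFinM mulVf ?gt_eqF // !mul1e.
Qed.

Lemma represents_unique (nu : O -> \bar K) mu rho : semivaluation nu ->
  represents mu nu -> represents rho nu -> mu = rho.
Proof.
have scaled m (c : K) : normal m -> (0 < c)%R -> (forall f, nu f = c%:E * m f) ->
    val_ideal nu (@maxideal K) = c%:E.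
  move=> [sm Mm] c0 H; have -> : nu = (fun f => c%:E * m f) by apply/funext.
  by rewrite (val_ideal_scale c0 sm) Mm mule1.
move=> sv [nm [[c c0 H]|[M0 [a [irr na ma]]]]] [nr [[d d0 H']|[M0' [b [irr' nb rb]]]]].
- have := scaled _ _ nr d0 H'; rewrite (scaled _ _ nm c0 H) => -[cd].
  apply/funext => f; have := H f; rewrite H' cd => E.
  exact: (emul_inj d0 (esym E)).
- by have := scaled _ _ nm c0 H; rewrite M0' => -[cz]; rewrite -cz ltxx in c0.
- by have := scaled _ _ nr d0 H'; rewrite M0 => -[cz]; rewrite -cz ltxx in d0.
apply: (normal_infinite_unique irr' nm nr) => //.
exact: (noncentered_unique sv M0 irr na nb nm.1 ma).
Qed.

End Quotient.

Section Separation.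
Variable K : realType.
Local Notation O := (formalring K).
Implicit Types (f g a b : O) (nu : Vstar K) (mu rho : O -> \bar K).
Local Open Scope ereal_scope.

Lemma Vstar_sv nu : semivaluation (val_of nu).
Proof. by have [] := VstarP nu. Qed.

Lemma scaled_ratio_lt (c t r : K) (x : \bar K) : (0 < c)%R -> c%:E * x < t%:E ->
  (t <= c * r)%R -> x < r%:E.
Proof.
move=> c0 xt tr; rewrite -(lte_pmul2l (z := c%:E)) ?lte_fin //.
by apply: lt_le_trans xt _; rewrite -EFinM lee_fin.
Qed.

Lemma scaled_ratio_gt (c t r : K) (x : \bar K) : (0 < c)%R -> t%:E < c%:E * x ->
  (c * r <= t)%R -> r%:E < x.
Proof.
move=> c0 tx rt; rewrite -(lte_pmul2l (z := c%:E)) ?lte_fin //.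
by apply: le_lt_trans tx; rewrite -EFinM lee_fin.
Qed.

Lemma scaled_M mu (nu : O -> \bar K) (c : K) : normal mu -> (0 < c)%R ->
  (forall f, nu f = c%:E * mu f) -> mine (nu varX) (nu varY) = c%:E.
Proof.
move=> nmu c0 H; rewrite !H -mine_pMr ?lee_fin ?(ltW c0) //.
by rewrite normal_min // mule1.
Qed.

Lemma mid_lt (x : \bar K) (r : K) : r%:E < x -> exists2 y : K, (r < y)%R & y%:E < x.
Proof.
case: x => [x|_|//].
  rewrite lte_fin => rx; exists ((r + x) / 2)%R; first by lra.
  by rewrite lte_fin; lra.
by exists (r + 1)%R; [lra|rewrite ltry].
Qed.

Lemma centered_lt_const (c0 x r : K) : (0 < c0 -> 0 <= x -> x < r ->
  exists2 t, c0 * x < t & t / r < c0)%R.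
Proof.
move=> c00 x0 xr; exists (c0 * ((x + r) / 2))%R.
  by rewrite ltr_pM2l //; lra.
by rewrite ltr_pdivrMr ?ltr_pM2l //; lra.
Qed.

Lemma centered_gt_const (c0 y r : K) : (0 < c0 -> 0 <= r -> r < y ->
  exists2 t, c0 < t & t * r <= c0 * y)%R.
Proof.
move=> c00 r0 ry; exists (c0 * (1 + (y - r) / (r + 1)))%R.
  by rewrite -{1}[c0]mulr1 ltr_pM2l // ltrDl divr_gt0 //; lra.
rewrite -mulrA ler_pM2l // mulrDl mul1r mulrAC -lerBrDl ler_pdivrMr; last by lra.
by rewrite ler_wpM2l //; lra.
Qed.

(** Near a centered semivaluation the normalizing constants are controlled by the
    values on the two variables. *)
Section NearCentered.
Variables (nu0 : Vstar K) (mu0 : O -> \bar K) (c0 : K).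
Hypotheses (nmu0 : normal mu0) (c00 : (0 < c0)%R).
Hypothesis scaled0 : forall f, val_of nu0 f = c0%:E * mu0 f.

Lemma near_centered_lt f (r : K) : mu0 f < r%:E ->
  \forall nu \near nu0, forall mu, represents mu (val_of nu) -> mu f < r%:E.
Proof.
move=> fr; have := sv_ge0 nmu0.1 f; move: fr (scaled0 f).
case: (mu0 f) => [x||//]; last by rewrite ltNge leey.
rewrite lte_fin lee_fin -EFinM => xr E x0.
have r0 : (0 < r)%R by apply: le_lt_trans xr.
have [t ft tr] := centered_lt_const c00 x0 xr.
have t0 : (0 < t)%R by apply: le_lt_trans ft; rewrite mulr_ge0 // ltW.
have big (z : O) : 1 <= mu0 z -> (t / r)%:E < val_of nu0 z.
  move=> z1; rewrite scaled0; apply: (@lt_le_trans _ _ c0%:E); first by rewrite lte_fin.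
  by rewrite -[leLHS]mule1 lee_pmul2l ?lte_fin.
have nf : \forall nu \near nu0, val_of nu f < t%:E by apply: near_lt; rewrite E lte_fin.
have nX := near_gt (big _ (normalX nmu0)).
have nY := near_gt (big _ (normalY nmu0)).
near=> nu => mu [nmu [[c cp H]|[M0 _]]].
  apply: (scaled_ratio_lt cp (t := t)); first by rewrite -H; near: nu.
  have : (t / r)%:E < c%:E.
    by rewrite -(scaled_M nmu cp H) lt_min; apply/andP; split; near: nu.
  by rewrite lte_fin ltr_pdivrMr // => /ltW.
have sv := (Vstar_sv nu); exfalso.
have : 0 < mine (val_of nu varX) (val_of nu varY).
  have p : 0 < (t / r)%:E by rewrite lte_fin divr_gt0.
  by rewrite lt_min; apply/andP; split; apply: lt_trans p _; near: nu.
by rewrite -(sv_M sv) M0 ltxx.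
Unshelve. all: by end_near.
Qed.

Lemma near_centered_gt f (r : K) : r%:E < mu0 f ->
  \forall nu \near nu0, forall mu, represents mu (val_of nu) -> r%:E < mu f.
Proof.
move=> rf; have [rneg|r0] := ltP r 0%R.
  near=> nu => mu [nmu _]; apply: lt_le_trans (sv_ge0 nmu.1 f).
  by rewrite lte_fin.
have [y ry yf] := mid_lt rf; have [t ct tr] := centered_gt_const c00 r0 ry.
have nf : \forall nu \near nu0, (c0 * y)%:E < val_of nu f.
  by apply: near_gt; rewrite scaled0 EFinM lte_pmul2l ?lte_fin.
have pos (z : O) : 1 <= mu0 z -> 0 < val_of nu0 z.
  by move=> z1; rewrite scaled0 mule_gt0 ?lte_fin // (lt_le_trans _ z1).
have [z [zM z0]] : exists z : O, Mge 1 z /\ val_of nu0 z = c0%:E.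
  have := scaled_M nmu0 c00 scaled0; rewrite /Order.min; case: ifP => _ E.
    by exists varX; split=> //; apply: MgeX_var.
  by exists varY; split=> //; apply: MgeY_var.
have nz : \forall nu \near nu0, val_of nu z < t%:E by apply: near_lt; rewrite z0 lte_fin.
have nX := near_gt (pos _ (normalX nmu0)).
have nY := near_gt (pos _ (normalY nmu0)).
near=> nu => mu [nmu [[c cp H]|[M0 _]]].
  apply: (scaled_ratio_gt cp (t := c0 * y)%R); first by rewrite -H; near: nu.
  have ct' : c%:E < t%:E.
    apply: (@le_lt_trans _ _ (val_of nu z)); last by near: nu.
    by rewrite H -[leLHS]mule1 lee_pmul2l ?lte_fin //; apply: (normal_Mge (n := 1) nmu zM).
  by apply: le_trans tr; rewrite ler_wpM2r // ltW.
have sv := (Vstar_sv nu); exfalso.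
have : 0 < mine (val_of nu varX) (val_of nu varY).
  by rewrite lt_min; apply/andP; split; near: nu.
by rewrite -(sv_M sv) M0 ltxx.
Unshelve. all: by end_near.
Qed.
End NearCentered.

Section NearNoncentered.
Variables (nu0 : Vstar K) (mu0 : O -> \bar K) (a : O).
Hypotheses (nmu0 : normal mu0) (M0 : val_ideal (val_of nu0) (@maxideal K) = 0).
Hypotheses (irr : irreducible_series a) (a0 : 0 < val_of nu0 a) (mua : mu0 a = +oo).

(** Near nu0 the value on a stays away from 0 while that on the maximal ideal gets
    small, so that normalization makes the value on a large. *)
Lemma near_large (k : K) :
  \forall nu \near nu0, forall mu, represents mu (val_of nu) -> k%:E < mu a.
Proof.
have [t tp ta] := mid_lt a0.
pose k' := (`|k| + 1)%R; have k'0 : (0 < k')%R by rewrite ltr_wpDl.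
have [z [zM z0]] : exists z : O, Mge 1 z /\ val_of nu0 z = 0.
  have := M0; rewrite (sv_M (Vstar_sv nu0)) /Order.min; case: ifP => _ E.
    by exists varX; split=> //; apply: MgeX_var.
  by exists varY; split=> //; apply: MgeY_var.
have na := near_gt ta.
have nz : \forall nu \near nu0, val_of nu z < (t / k')%:E.
  by apply: near_lt; rewrite z0 lte_fin divr_gt0.
near=> nu => mu [nmu [[c cp H]|[M0' [b [irrb nb mub]]]]].
  apply: (@lt_trans _ _ k'%:E); first by rewrite lte_fin /k' ltr_pwDr // ler_norm.
  apply: (scaled_ratio_gt cp (t := t)); first by rewrite -H; near: nu.
  have : c%:E < (t / k')%:E.
    apply: (@le_lt_trans _ _ (val_of nu z)); last by near: nu.
    by rewrite H -[leLHS]mule1 lee_pmul2l ?lte_fin //; apply: (normal_Mge (n := 1) nmu zM).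
  by rewrite lte_fin ltr_pdivlMr // => /ltW.
have apos : 0 < val_of nu a by apply: (@lt_trans _ _ t%:E); [rewrite lte_fin|near: nu].
by rewrite (noncentered_unique (Vstar_sv nu) M0' irrb nb apos nmu.1 mub) ltry.
Unshelve. all: by end_near.
Qed.

Lemma near_noncentered_lt f (r : K) : mu0 f < r%:E ->
  \forall nu \near nu0, forall mu, represents mu (val_of nu) -> mu f < r%:E.
Proof.
move=> fr; have [al arc] := arc_exists irr; have [_ ker _ _] := arc.
have [/ker[q fE]|f0] := eqVneq (al f) 0%R.
  move: fr; rewrite fE (svM nmu0.1) mua addey ?ltNge ?leey //.
  by rewrite -ltNye (lt_le_trans _ (sv_ge0 nmu0.1 q)) ?ltNy0.
have [x [k H]] := near_branch arc f0.
have nk := near_large k.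
near=> nu => mu rmu; have [nmu _] := rmu.
rewrite (H mu nmu); first by rewrite -(H mu0 nmu0) // mua ltry.
by move: mu rmu {nmu}; near: nu.
Unshelve. all: by end_near.
Qed.

Lemma near_noncentered_gt f (r : K) : r%:E < mu0 f ->
  \forall nu \near nu0, forall mu, represents mu (val_of nu) -> r%:E < mu f.
Proof.
move=> fr; have [al arc] := arc_exists irr; have [_ ker _ _] := arc.
have [/ker[q fE]|f0] := eqVneq (al f) 0%R.
  have nr := near_large r.
  near=> nu => mu rmu; rewrite fE; apply: (svMl_gt rmu.1.1).
  by move: mu rmu; near: nu.
have [x [k H]] := near_branch arc f0.
have nk := near_large k.
near=> nu => mu rmu; have [nmu _] := rmu.
rewrite (H mu nmu); first by rewrite -(H mu0 nmu0) // mua ltry.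
by move: mu rmu {nmu}; near: nu.
Unshelve. all: by end_near.
Qed.
End NearNoncentered.

Lemma represents_near_lt nu0 mu0 f (r : K) : represents mu0 (val_of nu0) -> mu0 f < r%:E ->
  \forall nu \near nu0, forall mu, represents mu (val_of nu) -> mu f < r%:E.
Proof.
move=> [nmu0 [[c c0 H]|[M0 [a [irr a0 mua]]]]]; first exact: (near_centered_lt nmu0 c0 H).
exact: (near_noncentered_lt nmu0 M0 irr a0 mua).
Qed.

Lemma represents_near_gt nu0 mu0 f (r : K) : represents mu0 (val_of nu0) -> r%:E < mu0 f ->
  \forall nu \near nu0, forall mu, represents mu (val_of nu) -> r%:E < mu f.
Proof.
move=> [nmu0 [[c c0 H]|[M0 [a [irr a0 mua]]]]]; first exact: (near_centered_gt nmu0 c0 H).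
exact: (near_noncentered_gt nmu0 M0 irr a0 mua).
Qed.

End Separation.

Local Open Scope quotient_scope.
Section Injectivity.
Variable K : realType.
Local Notation O := (formalring K).
Implicit Types (f g : O) (nu : Vstar K) (mu rho : O -> \bar K).
Local Open Scope ereal_scope.

Lemma represents_orbit mu nu nu' : same_orbit nu nu' ->
  represents mu (val_of nu) -> represents mu (val_of nu').
Proof.
move=> [c c0 H] [nmu rep]; have E : val_of nu' = (fun f => c%:E * val_of nu f).
  exact/funext.
split=> //; case: rep => [[d d0 H']|[M0 [a [irr na ma]]]]; [left|right].
  exists (c * d)%R; first exact: mulr_gt0.
  by move=> f; rewrite H H' muleA -EFinM.
split; first by rewrite E (val_ideal_scale c0 (Vstar_sv nu)) M0 mule0.
by exists a; split=> //; rewrite H mule_gt0 ?lte_fin.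
Qed.

Definition normal_rep nu : O -> \bar K := sval (cid (represents_exists nu)).

Lemma normal_repP nu : represents (normal_rep nu) (val_of nu).
Proof. exact: svalP (cid (represents_exists nu)). Qed.

Lemma normal_rep_orbit nu nu' : same_orbit nu nu' -> normal_rep nu = normal_rep nu'.
Proof.
move=> orb; apply: (represents_unique (Vstar_sv nu') _ (normal_repP nu')).
exact: represents_orbit orb (normal_repP nu).
Qed.

(** For each series f, the value at f of the normalized representatives defines an
    invariant equivalence relation with a Hausdorff quotient, and together these
    relations separate the normalized semivaluations. *)
Section Separate.
Variable f : O.
Definition same_value : rel (Vstar K) := fun mu nu : Vstar K => normal_rep mu f == normal_rep nu f.
Lemma same_value_refl : reflexive same_value. Proof. by move=> mu; apply: eqxx. Qed.
Lemma same_value_sym : symmetric same_value. Proof. by move=> mu nu; apply: eq_sym. Qed.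
Lemma same_value_trans : transitive same_value.
Proof. by move=> nu mu xi /eqP e /eqP e'; apply/eqP; rewrite e e'. Qed.
Definition same_value_equiv :=
  EquivRel same_value same_value_refl same_value_sym same_value_trans.

Local Notation Q := (quotient_topology {eq_quot same_value_equiv}).

Definition quotient_value (q : Q) : \bar K := normal_rep (repr q) f.

Lemma quotient_value_pi nu : quotient_value (\pi_Q nu)%qT = normal_rep nu f.
Proof.
apply/eqP; rewrite /quotient_value.
have : (repr (\pi_Q nu)%qT == nu %[mod {eq_quot same_value_equiv}])%qT by rewrite reprK.
by move=> /eqP/eqmodP.
Qed.

Lemma quotient_value_inj : injective quotient_value.
Proof.
move=> p q; rewrite -[p]reprK -[q]reprK !quotient_value_pi => E.
by apply/eqmodP/eqP.
Qed.

Lemma open_quotient_lt (r : K) : open [set q | quotient_value q < r%:E].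
Proof.
rewrite /open /= /quotient_open openE => nu; rewrite /= quotient_value_pi => H.
have := represents_near_lt (normal_repP nu) H; apply: filterS => nu' {}H /=.
by rewrite quotient_value_pi; apply/H/normal_repP.
Qed.

Lemma open_quotient_gt (r : K) : open [set q | r%:E < quotient_value q].
Proof.
rewrite /open /= /quotient_open openE => nu; rewrite /= quotient_value_pi => H.
have := represents_near_gt (normal_repP nu) H; apply: filterS => nu' {}H /=.
by rewrite quotient_value_pi; apply/H/normal_repP.
Qed.

Lemma real_between (x y : \bar K) : 0 <= x -> x < y -> exists r : K, x < r%:E /\ r%:E < y.
Proof.
case: x => [x _|_|//]; last by rewrite ltNge leey.
by move=> /mid_lt[r xr ry]; exists r; rewrite lte_fin.
Qed.

Lemma quotient_hausdorff : hausdorff_space Q.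
Proof.
have sep p q : quotient_value p < quotient_value q -> exists r,
    quotient_value p < r%:E /\ r%:E < quotient_value q.
  by apply: real_between; apply: (sv_ge0 (normal_repP (repr p)).1.1).
have disj (r : K) : [set q | quotient_value q < r%:E] `&` [set q | r%:E < quotient_value q] = set0.
  by apply/seteqP; split=> q //= [a b]; have := lt_trans a b; rewrite ltxx.
rewrite open_hausdorff => p q pq; have : quotient_value p != quotient_value q.
  by apply: contra_neq pq => /quotient_value_inj.
case: ltgtP => // [/sep[r [pr rq]]|/sep[r [qr rp]]] _.
  exists ([set q | quotient_value q < r%:E], [set q | r%:E < quotient_value q]).
    by split; apply: mem_set.
  by split; [exact: open_quotient_lt|exact: open_quotient_gt|apply/eqP/disj].
exists ([set q | r%:E < quotient_value q], [set q | quotient_value q < r%:E]).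
  by split; apply: mem_set.
by split; [exact: open_quotient_gt|exact: open_quotient_lt|rewrite setIC; apply/eqP/disj].
Qed.

End Separate.

Lemma toPV_normal_rep (mu nu : Vstar K) : toPV mu = toPV nu -> normal_rep mu = normal_rep nu.
Proof.
move=> /eqmodP/asboolP H; apply/funext => f; apply/eqP.
apply: (H (same_value_equiv f)); last exact: quotient_hausdorff.
by move=> mu' nu' /normal_rep_orbit E; apply/eqP; rewrite E.
Qed.

Lemma toPV_orbit (mu nu : Vstar K) : same_orbit mu nu -> toPV mu = toPV nu.
Proof. by move=> orb; apply/eqmodP/asboolP => E H _; apply: H. Qed.

Lemma toPV_inj (mu nu : Vstar K) : normal (val_of mu) -> normal (val_of nu) ->
  toPV mu = toPV nu -> val_of mu = val_of nu.
Proof.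
have rep (xi : Vstar K) : normal (val_of xi) -> represents (val_of xi) (val_of xi).
  by move=> nxi; split=> //; left; exists 1%R => // f; rewrite mul1e.
have E (xi : Vstar K) : normal (val_of xi) -> normal_rep xi = val_of xi.
  by move=> nxi; exact (represents_unique (Vstar_sv xi) (normal_repP xi) (rep xi nxi)).
by move=> nmu nnu /toPV_normal_rep; rewrite !E.
Qed.

End Injectivity.

(** * Segments and tripod centers *)

Section Tree.
Variable K : realType.
Local Notation O := (formalring K).
Implicit Types (f g : O) (mu nu sig tau : O -> \bar K) (C : branch K) (P Q X : PV K).
Implicit Types (S R : observer K).
Local Open Scope ereal_scope.

Lemma varX_neq0 : (varX : O) != 0%R.
Proof. by apply/eqP => X0; have := @mono_varX K 1%R; rewrite X0 mono0. Qed.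

Lemma scaled_Vstar mu nu (c : K) : normal mu -> (0 < c)%R -> (forall f, nu f = c%:E * mu f) ->
  [/\ semivaluation nu, nu <> @trivS K & nu <> @trivO K].
Proof.
move=> nmu c0 H; have M := scaled_M nmu c0 H; split.
- by rewrite (_ : nu = (fun f => c%:E * mu f)); [apply: sv_scale c0 nmu.1|apply/funext].
- move=> E; have : 0 < nu varX.
    by rewrite H mule_gt0 ?lte_fin // (lt_le_trans _ (normalX nmu)).
  by rewrite E /trivS (negbTE varX_neq0) ltxx.
- have H' (z : O) : Mge 1 z -> trivO z = +oo by move=> /Mge1P zM; rewrite /trivO mem_set.
  by move=> E; move: M; rewrite E (H' _ (@MgeX_var K)) (H' _ (@MgeY_var K)) minxx.
Qed.

Lemma point_of_val (nu : Vstar K) : point_of (val_of nu) = toPV nu.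
Proof.
rewrite /point_of; set A := (X in get X).
have [nu' E <-] : A (get A) by apply: getPex; exists (toPV nu), nu.
by congr toPV; apply: val_inj.
Qed.

Lemma scaled_point mu nu (c : K) : normal mu -> (0 < c)%R -> (forall f, nu f = c%:E * mu f) ->
  exists2 xi : Vstar K, val_of xi = nu & point_of nu = toPV xi.
Proof.
move=> nmu c0 H; pose xi : Vstar K := SigSub (mem_set (scaled_Vstar nmu c0 H)).
have E : val_of xi = nu by [].
by exists xi; rewrite // -E point_of_val.
Qed.

Lemma normal_point mu : normal mu -> exists2 xi : Vstar K, val_of xi = mu & point_of mu = toPV xi.
Proof. by move=> nmu; apply: (scaled_point nmu ltr01) => f; rewrite mul1e. Qed.

Lemma point_scale mu nu (c : K) : normal mu -> (0 < c)%R -> (forall f, nu f = c%:E * mu f) ->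
  point_of nu = point_of mu.
Proof.
move=> nmu c0 H; have [xi xiE ->] := scaled_point nmu c0 H; have [xi' xiE' ->] := normal_point nmu.
by apply/esym/toPV_orbit; exists c; rewrite // xiE xiE'.
Qed.

Lemma point_of_inj mu nu : normal mu -> normal nu -> point_of mu = point_of nu -> mu = nu.
Proof.
move=> nmu nnu; have [xi xiE ->] := normal_point nmu; have [xi' xiE' ->] := normal_point nnu.
by rewrite -xiE -xiE' in nmu nnu *; apply: toPV_inj.
Qed.

Lemma point_branch C : point_of (I_branch C) = point_of (nbranch C).
Proof.
exact: (point_scale (nbranch_normal C) (mult_gt0 C) (I_branch_nbranch C)).
Qed.

Lemma PV_le_normal P Q : PV_le P Q -> exists mu nu,
  [/\ normal mu, normal nu, P = point_of mu, Q = point_of nu & below mu nu].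
Proof.
move=> [mu [nu [<- <- mM nM le]]]; exists (val_of mu), (val_of nu).
by split; rewrite ?point_of_val //; split=> //; apply: Vstar_sv.
Qed.

Lemma PV_leE mu nu : normal mu -> normal nu ->
  PV_le (point_of mu) (point_of nu) <-> below mu nu.
Proof.
move=> nmu nnu; split.
  move=> /PV_le_normal[mu' [nu' [nmu' nnu' Em En le]]].
  by rewrite (point_of_inj nmu nmu' Em) (point_of_inj nnu nnu' En).
move=> le; have [xi xiE ->] := normal_point nmu; have [xi' xiE' ->] := normal_point nnu.
by exists xi, xi'; rewrite xiE xiE'; split=> //; [apply: nmu.2|apply: nnu.2].
Qed.

Lemma below_anti mu nu : below mu nu -> below nu mu -> mu = nu.
Proof. by move=> mn nm; apply/funext => f; apply/eqP; rewrite eq_le mn nm. Qed.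

Lemma PV_le_anti P Q : PV_le P Q -> PV_le Q P -> P = Q.
Proof.
move=> /PV_le_normal[mu [nu [nmu nnu -> -> le]]] /(PV_leE nnu nmu) le'.
by rewrite (below_anti le le').
Qed.

(** Anything below both has a smaller bracket with S, hence is below the monomial
    valuation [obs_meet]. *)
Lemma obs_is_meet S mu : normal mu -> exists tau,
  [/\ normal tau, below tau mu, below tau (I_obs S), bracket tau S = bracket mu S
    & is_meet (obs_point S) (point_of mu) (point_of tau)].
Proof.
move=> nmu; have [tau [nt tm tS tE]] := obs_meet S nmu; exists tau.
have nS := obs_normal S; split=> //; split.
- exact/(PV_leE nt nS).
- exact/(PV_leE nt nmu).
move=> T' /PV_le_normal[sig [I' [ns nI -> EI sI]]] /PV_le_normal[sig' [mu' [ns' nm' Es Em sm]]].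
have EI' := point_of_inj nS nI EI; have Em' := point_of_inj nmu nm' Em.
have Es' := point_of_inj ns ns' Es; rewrite -Es' -Em' in sm; rewrite -EI' in sI.
apply/(PV_leE ns nt); apply: (obs_below ns nt sI).
by rewrite tE; apply: bracket_below.
Qed.

(** Above the meet of S and mu means having a larger bracket with S than mu, because
    the meet is below S and has the same bracket as mu. *)
Lemma segmentE S mu sig : normal mu -> normal sig ->
  segment (obs_point S) (point_of mu) (point_of sig) <->
  bracket mu S <= bracket sig S /\ (below sig (I_obs S) \/ below sig mu).
Proof.
move=> nmu ns; have [tau [nt tm tS tE [m1 m2 m3]]] := obs_is_meet S nmu.
have nS := obs_normal S; split.
  move=> [T [T1 T2 T3] [Ts or]]; have TE : T = point_of tau.
    by apply: PV_le_anti; [exact: m3|exact: T3].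
  move: Ts; rewrite TE => /(PV_leE nt ns) ts; split.
    by rewrite -tE; apply: bracket_below.
  by case: or => [/(PV_leE ns nS)|/(PV_leE ns nmu)]; [left|right].
move=> [le or]; exists (point_of tau); first by split.
split; first by apply/(PV_leE nt ns)/(obs_below nt ns tS); rewrite tE.
by case: or => [H|H]; [left; apply/(PV_leE ns nS)|right; apply/(PV_leE ns nmu)].
Qed.

Lemma segment_sym P Q X : segment P Q X -> segment Q P X.
Proof.
move=> [T [T1 T2 T3] [TX or]]; exists T; first by split=> // T' a b; apply: T3.
by split=> //; case: or; [right|left].
Qed.

Lemma segment_normal P Q X : segment P Q X -> exists2 sig, normal sig & X = point_of sig.
Proof. by move=> [T _ [/PV_le_normal[mu [nu [_ nnu _ -> _]]] _]]; exists nu. Qed.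

Lemma bracket_scale S mu (c : K) : normal mu -> (0 < c)%R ->
  bracket (fun f => c%:E * mu f) S = c%:E * bracket mu S.
Proof. by case: S => [|L sL] nmu c0 //; apply: (val_ideal_scale c0 nmu.1). Qed.

Lemma val_branch_obs S C : val_branch (I_obs S) C = (mult C)%:E * bracket (nbranch C) S.
Proof.
rewrite obs_branch -(bracket_scale S (nbranch_normal C) (mult_gt0 C)).
by congr bracket; apply/funext => f; apply: I_branch_nbranch.
Qed.

Lemma bracket_le_obs S C : bracket (nbranch C) S <= val_branch (I_obs S) C.
Proof.
have [m1 _] := multP C; rewrite val_branch_obs -{1}[bracket _ _]mul1e lee_wpmul2r ?lee_fin //.
by apply: le_trans (bracket_ge1 S (nbranch_normal C)).
Qed.

(** The branches over which the multiplicity of mu relative to S is a minimum. *)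
Definition competes S mu C :=
  bracket (nbranch C) S <= bracket mu S /\ (below mu (I_obs S) \/ below mu (nbranch C)).

Lemma obs_leE S mu C : normal mu ->
  obs_le S (point_of mu) (point_of (I_branch C)) <-> competes S mu C.
Proof.
have nc := nbranch_normal C; rewrite point_branch /obs_le => nmu; split.
  move=> H; apply/(segmentE S nc nmu)/H/(segmentE S nmu nmu).
  by split; [exact: lexx|right=> f].
move=> [le or] X sX; have [sig ns XE] := segment_normal sX.
move: sX; rewrite XE => /(segmentE S nmu ns)[le' or'].
apply/(segmentE S nc ns); split; first exact: le_trans le le'.
case: or' => [|sm]; first by left.
by case: or => H; [left|right]; apply: below_trans sm H.
Qed.

Lemma relmultE S mu : normal mu ->
  relmult S (point_of mu) = ereal_inf [set val_branch (I_obs S) C | C in [set C | competes S mu C]].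
Proof.
move=> nmu; rewrite /relmult; congr ereal_inf.
by apply/seteqP; split=> _ [C H <-]; exists C => //; apply/(obs_leE S C nmu).
Qed.

Lemma relmult_min S mu (x : \bar K) : normal mu ->
  (forall C, competes S mu C -> x <= val_branch (I_obs S) C) ->
  (exists2 C, competes S mu C & val_branch (I_obs S) C = x) -> relmult S (point_of mu) = x.
Proof.
move=> nmu lb [C cC CE]; rewrite relmultE //; apply/eqP; rewrite eq_le; apply/andP; split.
  by apply: ereal_inf_lbound; exists C.
by apply: le_ereal_inf_tmp => _ [C' cC' <-]; apply: lb.
Qed.

(** The segments from an observer to O consist of the points below the observer, so
    that the center is the meet of R and R'. *)
Lemma tripod_centerE R R' : exists tau,
  [/\ normal tau, below tau (I_obs R), below tau (I_obs R'),
      bracket tau R = bracket (I_obs R) R' /\ bracket tau R' = bracket (I_obs R) R'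
    & tripod_center (obs_point R) (obs_point R') (obs_point ObsOrigin) = point_of tau].
Proof.
have nR := obs_normal R; have nR' := obs_normal R'; have nO := obs_normal (@ObsOrigin K).
have [tau [nt tR tR' tE]] := obs_meet R' nR; exists tau.
have tE' : bracket tau R = bracket (I_obs R) R'.
  apply/eqP; rewrite eq_le; apply/andP; split.
    by rewrite obs_sym; apply: bracket_below.
  by have := obs_ultra R' R nt; rewrite tE (obs_sym R' R) minxx.
have O_below sig : normal sig -> below (I_obs (@ObsOrigin K)) sig.
  by move=> ns f; apply: I_origin_min.
split=> //; rewrite /tripod_center; set A := (X in get X).
have At : A (point_of tau).
  split; first split.
  - by apply/(segmentE R nR' nt); split; [rewrite tE' (obs_sym R' R)|left].
  - apply/(segmentE R' nO nt); split; last by left.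
    by apply: bracket_below => //; apply: O_below.
  - apply/(segmentE ObsOrigin nR nt); split; last by right.
    by rewrite /= nR.2 nt.2.
have [] : A (get A) by apply: getPex; exists (point_of tau).
move: (get A) => X [sRR' sR'O sOR]; have [sig ns XE] := segment_normal sRR'; rewrite XE in sRR' sR'O sOR *.
have [le _] := (segmentE R nR' ns).1 sRR'.
have sR' : below sig (I_obs R').
  by have [_ [//|H]] := (segmentE R' nO ns).1 sR'O; apply: below_trans H (O_below _ nR').
have sR : below sig (I_obs R).
  by have [_ [H|//]] := (segmentE ObsOrigin nR ns).1 sOR; apply: below_trans H (O_below _ nR).
congr point_of; apply: below_anti.
  by apply: (obs_below ns nt sR'); rewrite tE; apply: bracket_below.
by apply: (obs_below nt ns tR); rewrite tE' -(obs_sym R' R).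
Qed.

End Tree.

(** * Relative multiplicities *)

Section RelativeMultiplicity.
Variable K : realType.
Local Notation O := (formalring K).
Implicit Types (f g : O) (mu nu sig tau : O -> \bar K) (C : branch K) (P Q X : PV K).
Implicit Types (S R : observer K).
Local Open Scope ereal_scope.

Lemma relmult_below S mu : normal mu -> below mu (I_obs S) -> relmult S (point_of mu) = 1.
Proof.
move=> nmu mS; apply: relmult_min => //.
  by move=> C _; apply: le_trans (bracket_ge1 S (nbranch_normal C)) (bracket_le_obs S C).
have [C CE] := obs_transversal S; exists C; last exact: CE.
split; last by left.
by apply: le_trans (bracket_le_obs S C) _; rewrite /val_branch CE; apply: bracket_ge1.
Qed.

(** The point is on the side of R, which must be a branch since the tripod center
    tau lies strictly below: that branch itself competes and realizes the bound
    coming from tau. *)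
Lemma relmult_near_branch R R' tau mu : normal tau -> normal mu ->
    below mu (I_obs R) -> bracket tau R = bracket (I_obs R) R' ->
    bracket tau R' = bracket (I_obs R) R' -> below tau (I_obs R) -> below tau (I_obs R') ->
    bracket (I_obs R) R' <= bracket mu R -> mu <> tau ->
  relmult R' (point_of mu) = bracket (I_obs R) R'.
Proof.
move=> nt nmu mR tR tR' tbR tbR' le mt.
have tm : below tau mu by apply: (obs_below nt nmu tbR); rewrite tR.
have mR' : ~ below mu (I_obs R').
  move=> mR'; apply: mt; apply: below_anti => //.
  by apply: (obs_below nmu nt mR'); rewrite tR'; apply: bracket_below (obs_normal R) mR.
apply: relmult_min => //.
  move=> C [_ [//|mc]]; apply: le_trans (bracket_le_obs R' C); rewrite -tR'.
  by apply: bracket_below => //; [exact: nbranch_normal|exact: below_trans tm mc].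
case: R mR mR' tR tR' tbR le => [|L sL] mR mR' tR tR' tbR le.
  by exfalso; apply: mt; apply: below_anti => // f; apply: le_trans (mR f) (I_origin_min nt f).
exists L; last exact: obs_branch.
rewrite /competes (smooth_nbranch sL); split; last by right.
by rewrite -[leLHS]tR'; apply: bracket_below.
Qed.

(** In an ultrametric triangle the two sides of length less than n are equal. *)
Lemma ultra_eq (x y n : \bar K) : mine x n <= y -> mine y n <= x -> x < n -> x = y.
Proof.
move=> xy yx xn; apply/eqP; rewrite eq_le; apply/andP; split.
  by move: xy; rewrite (min_idPl (ltW xn)).
by move: yx; rewrite ge_min leNgt orbC leNgt xn /= -leNgt.
Qed.

Definition off_segment R R' mu := ~ segment (obs_point R') (obs_point R) (point_of mu).

Lemma off_sym R R' mu : off_segment R R' mu -> off_segment R' R mu.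
Proof. by move=> off /segment_sym. Qed.

Lemma off_below R R' mu : normal mu -> off_segment R R' mu ->
  below mu (I_obs R') \/ below mu (I_obs R) -> bracket mu R' < bracket (I_obs R) R'.
Proof.
move=> nmu off le; rewrite ltNge; apply/negP => nle.
by apply: off; apply/(segmentE R' (obs_normal R) nmu).
Qed.

Lemma off_real R R' mu : normal mu -> off_segment R R' mu ->
  exists2 x, (1 <= x)%R & bracket mu R' = x%:E.
Proof.
move=> nmu off; have [E|//] := normal_real R' nmu; exfalso.
have le : below mu (I_obs R') by rewrite (obs_infinite nmu E) => f.
by have := off_below nmu off (or_introl le); rewrite E ltNge leey.
Qed.

(** In the ultrametric triangle of the two observers and the point, the two short
    sides are equal; the strict inequality with the third one then puts the point
    below each observer. *)
Lemma off_below_both R R' mu : normal mu -> off_segment R R' mu ->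
    below mu (I_obs R') \/ below mu (I_obs R) ->
  [/\ below mu (I_obs R), below mu (I_obs R') & bracket mu R = bracket mu R'].
Proof.
move=> nmu off le; have lt' := off_below nmu off le.
have lt : bracket mu R < bracket (I_obs R') R.
  by apply: off_below nmu (off_sym off) _; case: le; [right|left].
have E : bracket mu R = bracket mu R'.
  apply: ultra_eq lt; first by rewrite -obs_sym; apply: obs_ultra.
  by apply: obs_ultra.
by split=> //; case: le => // H;
   [apply: (obs_strict nmu (obs_normal R') H lt)|apply: (obs_strict nmu (obs_normal R) H lt')].
Qed.

(** Below both observers, the brackets of a competing branch are smaller than n, so
    that the ultrametric inequality applies to it as well. Otherwise a strict
    increase of a bracket between mu and the branch would put mu below the
    observer. *)
Lemma off_competes R R' mu C : normal mu -> off_segment R R' mu -> competes R mu C ->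
  let c := nbranch C in competes R' mu C /\
  ((bracket mu R = bracket mu R' /\ bracket c R = bracket c R') \/
   (bracket c R = bracket mu R /\ bracket c R' = bracket mu R')).
Proof.
move=> nmu off [cmu or] c; have nc : normal c := nbranch_normal C.
have [[mR mR']|nboth] := pselect (below mu (I_obs R) /\ below mu (I_obs R')).
  have [_ _ E] := off_below_both nmu off (or_introl mR').
  have lt := off_below nmu off (or_introl mR').
  have cE : bracket c R = bracket c R'.
    apply: (@ultra_eq _ _ (bracket (I_obs R) R')); last by apply: le_lt_trans cmu _; rewrite E.
      exact: obs_ultra.
    by rewrite -(obs_sym R'); apply: obs_ultra.
  by split; [split; [rewrite -cE -E|left]|left].
have nR : ~ below mu (I_obs R).
  by move=> mR; apply: nboth; have [] := off_below_both nmu off (or_intror mR).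
have nR' : ~ below mu (I_obs R').
  by move=> mR'; apply: nboth; have [] := off_below_both nmu off (or_introl mR').
have mc : below mu c by case: or.
have eq S : ~ below mu (I_obs S) -> bracket c S = bracket mu S.
  move=> nS; apply/eqP; rewrite eq_le (bracket_below S nmu nc mc) andbT leNgt.
  by apply/negP => /(obs_strict nmu nc mc).
by split; [split; [rewrite eq|right]|right; rewrite !eq].
Qed.

Lemma off_val_branch R R' mu C (x y : K) : normal mu -> off_segment R R' mu ->
    bracket mu R = x%:E -> bracket mu R' = y%:E -> (1 <= x)%R -> competes R mu C ->
  val_branch (I_obs R') C = (y / x)%:E * val_branch (I_obs R) C.
Proof.
move=> nmu off xE yE x1 cC; have x0 : (x != 0)%R by rewrite gt_eqF // (lt_le_trans ltr01).
have [_] := off_competes nmu off cC; rewrite !val_branch_obs xE yE.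
move=> [[[E] ->]|[-> ->]]; first by rewrite -E divff // mul1e.
by rewrite -!EFinM; congr EFin; field.
Qed.

Lemma relmult_off R R' mu (x y : K) : normal mu -> off_segment R R' mu ->
    bracket mu R = x%:E -> bracket mu R' = y%:E -> (1 <= x)%R -> (1 <= y)%R ->
  relmult R' (point_of mu) = (y / x)%:E * relmult R (point_of mu).
Proof.
move=> nmu off xE yE x1 y1; rewrite !relmultE //.
have r0 : (0 < y / x)%R by rewrite divr_gt0 // (lt_le_trans ltr01).
rewrite -(ereal_inf_pZl _ r0); congr ereal_inf; apply/seteqP; split=> [_ [C cC <-]|_ [_ [C cC <-] <-]].
  have [cC' _] := off_competes nmu (off_sym off) cC.
  exists (val_branch (I_obs R) C); first by exists C.
  exact/esym/(off_val_branch nmu off xE yE x1 cC').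
have [cC' _] := off_competes nmu off cC.
by exists C; rewrite // (off_val_branch nmu off xE yE x1 cC).
Qed.

Lemma gamma_scale R R' mu (c x y : K) : normal mu -> (0 < c)%R -> (1 <= x)%R ->
    bracket mu R = x%:E -> bracket mu R' = y%:E ->
  gamma R R' (fun f => c%:E * mu f) = (y / x)%:E.
Proof.
move=> nmu c0 x1 xE yE; rewrite /gamma !bracket_scale // xE yE -!EFinM.
have x0 : (0 < x)%R by apply: lt_le_trans x1.
rewrite inver mulf_eq0 (gt_eqF x0) (gt_eqF c0) /= -EFinM; congr EFin.
by field; rewrite !gt_eqF.
Qed.

(** A centered semivaluation falls in the first case of [represents]. *)
Lemma centered_point (nu : Vstar K) : centered (val_of nu) -> exists mu (c : K),
  [/\ normal mu, (0 < c)%R, val_of nu = (fun f => c%:E * mu f) & toPV nu = point_of mu].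
Proof.
move=> cen; have [mu [nmu [[c c0 H]|[M0 _]]]] := represents_exists nu.
  exists mu, c; split=> //; first exact/funext.
  by rewrite -point_of_val; apply: (point_scale nmu c0 H).
have : 0 < mine (val_of nu varX) (val_of nu varY).
  by rewrite lt_min; apply/andP; split; apply/cen/Mge1P; [exact: MgeX_var|exact: MgeY_var].
by rewrite -(sv_M (Vstar_sv nu)) M0 ltxx.
Qed.

End RelativeMultiplicity.

Theorem proposition9p7 (K : realType) (R R' : observer K) (hRR' : R <> R') :
  let T := tripod_center (obs_point R) (obs_point R') (obs_point ObsOrigin) in
  [/\ forall P, segment (obs_point R') T P -> relmult R' P = 1%E,
      forall P, (segment T (obs_point R) `\ T) P ->
        relmult R' P = bracket (I_obs R) R'
    & forall P, ~ segment (obs_point R') (obs_point R) P ->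
        forall nuP : Vstar K, centered (val_of nuP) -> val_of nuP <> @trivO K ->
          toPV nuP = P ->
          relmult R' P = (gamma R R' (val_of nuP) * relmult R P)%E].
Proof.
move=> T; have [tau [nt tR tR' [tE tE'] TE]] := tripod_centerE R R'.
rewrite -/T in TE; split=> [P|P|P off nuP cen _ nuPE].
- move=> sP; have [mu nmu PE] := segment_normal sP; rewrite PE in sP *.
  move: sP; rewrite TE => /(segmentE R' nt nmu)[_ or].
  by apply: relmult_below => //; case: or => // H; apply: below_trans H tR'.
- move=> [/segment_sym sP PT]; have [mu nmu PE] := segment_normal sP; rewrite PE in sP *.
  move: sP; rewrite TE => /(segmentE R nt nmu)[le or].
  apply: (relmult_near_branch nt nmu _ tE tE' tR tR'); first by case: or => // H; apply: below_trans H tR.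
    by rewrite -tE.
  by move=> mt; apply: PT; rewrite /= PE TE mt.
have [mu [c [nmu c0 nuE muE]]] := centered_point cen.
rewrite -nuPE muE in off *; have [x x1 xE] := off_real nmu (off_sym off).
have [y y1 yE] := off_real nmu off.
by rewrite nuE (gamma_scale nmu c0 x1 xE yE); apply: relmult_off.
Qed.
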